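(* Let $\Gamma$ be a Coxeter diagram with associated Coxeter group $W_\Gamma$ and, for each $k\ge 1$, let $\Gamma^k$ be its $k$-odd graph. Then, for each $k \geq 1$, the number of connected components of $\Gamma^k$ is equal to the number of conjugacy classes of involutions of rank $k$ in $W_\Gamma$. The total number $\mathrm{cc}_2(W_\Gamma)$ of conjugacy classes of involutions in $W_\Gamma$ is $$\mathrm{cc}_2(W_\Gamma)=\sum_{k=1}^{|V(\Gamma)|}|\pi_0(\Gamma^k)|.$$
   Context: A Coxeter system $(W,S)$ of finite rank has $S=\{s_i\mid i\in I\}$, $I$ finite, and $W=\langle S\mid (s_is_j)^{m_{i,j}}\ (i,j\in I,\ m_{i,j}<\infty)\rangle$, with $m_{i,i}=1$ and $m_{i,j}=m_{j,i}\in\{2,3,\dots\}\cup\{\infty\}$ for $i\neq j$. Its Coxeter diagram $\Gamma$ has vertex set $V(\Gamma)=S$ and an edge $\{s_i,s_j\}$ iff $m_{i,j}\ge 3$, labeled by $m_{i,j}$ when $m_{i,j}\geq 4$ and unlabeled when $m_{i,j}=3$; one writes $W=W_\Gamma$. An edge is odd if $m_{i,j}$ is finite and odd (this includes unlabeled edges). For $J\subseteq I$, $S_J=\{s_j\mid j\in J\}$, $W_J=\langle S_J\rangle$ is a standard parabolic subgroup of rank $|J|$, and $\Gamma_J$ is the full subgraph of $\Gamma$ on $S_J$. A parabolic subgroup is a conjugate of a standard parabolic subgroup, with the same rank. An involution is an element of order exactly $2$. The parabolic closure of an element is the smallest parabolic subgroup containing it; the rank of an involution is the rank of its parabolic closure.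 Odd-adjacency: $W_J$ and $W_K$ are odd-adjacent if there exist $\ell\ge1$ and $L,M,X\subseteq I$ such that (1) $W_J=W_L\times W_X$ with $J=L\sqcup X$ and $W_K=W_M\times W_X$ with $K=M\sqcup X$ (internal direct products); (2) $W_L\cong W_M\cong(\mathbb Z/2\mathbb Z)^\ell$; (3) $S_L$ and $S_M$ differ by exactly one generator, i.e. $S_L\setminus S_M=\{s_l\}$ and $S_M\setminus S_L=\{s_m\}$; (4) $\{s_l,s_m\}$ is an odd edge of $\Gamma$. The $k$-odd graph $\Gamma^k$ ($k\ge1$): its vertices are the rank-$k$ standard parabolic subgroups $W_J$ such that every connected component of $\Gamma_J$ is a Coxeter diagram of one of the types $\mathtt A_1$, $\mathtt B_n$ ($n\ge2$), $\mathtt D_{2n}$ ($n\ge2$), $\mathtt E_7$, $\mathtt E_8$, $\mathtt F_4$, $\mathtt G_2$, $\mathtt H_3$, $\mathtt H_4$, $\mathtt I_2(2m)$ ($m\ge2$); two vertices span an edge iff they are odd-adjacent. $\pi_0$ denotes the set of connected components. *)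

(* Defs.v *)
From mathcomp Require Import all_boot zmodp matrix.
From mathcomp Require Import boolp classical_sets cardinality.

Set Implicit Arguments.
Unset Strict Implicit.
Unset Printing Implicit Defensive.

Local Open Scope group_scope.
Local Open Scope classical_set_scope.

(** * Coxeter matrices and diagrams *)

(* [m i j = 0] encodes the label infinity: the relator [(s_i s_j)^0] is then
   trivial, [0] is not odd, and [{i, j}] is still an edge. *)
Definition coxeter_matrix (I : Type) (m : I -> I -> nat) : Prop :=
  [/\ forall i, m i i = 1%N,
      forall i j, m i j = m j i
    & forall i j, i <> j -> m i j <> 1%N].

Definition diagram_edge (I : finType) (m : I -> I -> nat) : rel I :=
  fun i j => [&& i != j & m i j != 2%N].

Definition odd_edge (I : finType) (m : I -> I -> nat) : rel I :=
  fun i j => (i != j) && odd (m i j).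

Definition full_subdiagram_edge (I : finType) (m : I -> I -> nat)
    (J : {set I}) : rel I :=
  fun i j => [&& i \in J, j \in J & diagram_edge m i j].

(* The connected component containing [i], for [i \in J]. *)
Definition subdiagram_component (I : finType) (m : I -> I -> nat)
    (J : {set I}) (i : I) : {set I} :=
  [set j | connect (full_subdiagram_edge m J) i j]%SET.

(* Coxeter matrices of standard diagrams, on the vertices 0, ..., n - 1;
   [e] is only used on pairs [(i, j)] with [i < j]. *)
Definition matrix_of_labels (e : nat -> nat -> nat) : nat -> nat -> nat :=
  fun i j => if i == j then 1%N else e (minn i j) (maxn i j).

(* The path whose consecutive edges carry the given labels. *)
Definition path_diagram (labels : seq nat) : nat -> nat -> nat :=
  matrix_of_labels
    (fun i j => if j == i.+1 then nth 2%N labels i else 2%N).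

(* The path 0 - 1 - ... - (n - 2), with n - 1 joined to [b]; no labels. *)
Definition branched_diagram (n b : nat) : nat -> nat -> nat :=
  matrix_of_labels
    (fun i j => if j == n.-1 then (if i == b then 3 else 2)%N
                else (if j == i.+1 then 3 else 2)%N).

Inductive listed_type : nat -> (nat -> nat -> nat) -> Prop :=
| TypeA1 : listed_type 1 (path_diagram [::])
| TypeB n : (2 <= n)%N ->
    listed_type n (path_diagram (rcons (nseq (n - 2) 3) 4))
| TypeDeven n : (2 <= n)%N ->
    listed_type (2 * n) (branched_diagram (2 * n) (2 * n - 3))
| TypeE7 : listed_type 7 (branched_diagram 7 2)
| TypeE8 : listed_type 8 (branched_diagram 8 2)
| TypeF4 : listed_type 4 (path_diagram [:: 3; 4; 3])
| TypeG2 : listed_type 2 (path_diagram [:: 6])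
| TypeH3 : listed_type 3 (path_diagram [:: 3; 5])
| TypeH4 : listed_type 4 (path_diagram [:: 3; 3; 5])
| TypeI2even p : (2 <= p)%N -> listed_type 2 (path_diagram [:: (2 * p)%N]).

Definition has_listed_type (I : finType) (m : I -> I -> nat)
    (C : {set I}) : Prop :=
  exists (n : nat) (M : nat -> nat -> nat) (f : 'I_n -> I),
    [/\ listed_type n M, injective f,
        C = [set f x | x : 'I_n]%SET
      & forall x y : 'I_n, m (f x) (f y) = M x y].

(** * Subgroups of a possibly infinite group *)

Definition is_subgroup (G : groupType) (H : set G) : Prop :=
  H 1 /\ (forall x y, H x -> H y -> H (x * y^-1)).

Definition generated_subgroup (G : groupType) (A : set G) : set G :=
  smallest (@is_subgroup G) A.

Definition conj_set (G : groupType) (H : set G) (g : G) : set G :=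
  [set x ^ g | x in H].

Definition conj_class (G : groupType) (x : G) : set G :=
  [set x ^ g | g in setT].

Definition internal_direct_product (G : groupType) (H A B : set G) : Prop :=
  [/\ H = [set x * y | x in A & y in B],
      A `&` B = [set 1]
    & forall x y, A x -> B y -> commute x y].

(* [H] is isomorphic to (Z/2Z)^l, realised as the additive group 'F_2^l. *)
Definition elementary_abelian2 (G : groupType) (H : set G) (l : nat) : Prop :=
  exists f : 'rV['F_2]_l -> G,
    [/\ injective f, range f = H
      & forall u v, f (u + v)%R = f u * f v].

(** * Coxeter systems *)

Definition std_parabolic (I : finType) (W : groupType) (s : I -> W)
    (J : {set I}) : set W :=
  generated_subgroup [set s j | j in [set` J]].

(* W = < s_i | (s_i s_j)^(m i j) >, by generation and von Dyck's
   universal property. *)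
Record coxeter_system (I : finType) (m : I -> I -> nat)
    (W : groupType) (s : I -> W) : Prop := CoxeterSystem {
  coxeter_system_matrix : coxeter_matrix m;
  coxeter_system_generated : generated_subgroup (range s) = setT;
  coxeter_system_relations : forall i j, (s i * s j) ^+ m i j = 1;
  coxeter_system_universal :
    forall (G : groupType) (t : I -> G),
      (forall i j, (t i * t j) ^+ m i j = 1) ->
      exists f : {multiplicative W -> G}, forall i, f (s i) = t i
}.

Definition is_parabolic_of_rank (I : finType) (W : groupType) (s : I -> W)
    (k : nat) (P : set W) : Prop :=
  exists (J : {set I}) (g : W),
    #|J| = k /\ P = conj_set (std_parabolic s J) g.

Definition is_parabolic (I : finType) (W : groupType) (s : I -> W)
    (P : set W) : Prop :=
  exists k, is_parabolic_of_rank s k P.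

Definition is_parabolic_closure (I : finType) (W : groupType) (s : I -> W)
    (w : W) (P : set W) : Prop :=
  [/\ is_parabolic s P, P w
    & forall Q, is_parabolic s Q -> Q w -> P `<=` Q].

Definition is_involution (W : groupType) (w : W) : Prop :=
  w <> 1 /\ w ^+ 2 = 1.

Definition is_involution_of_rank (I : finType) (W : groupType) (s : I -> W)
    (k : nat) (w : W) : Prop :=
  is_involution w /\
  exists P, is_parabolic_closure s w P /\ is_parabolic_of_rank s k P.

Definition involution_classes (W : groupType) : set (set W) :=
  [set conj_class w | w in [set w : W | is_involution w]].
Arguments involution_classes W : clear implicits.

Definition involution_classes_of_rank (I : finType) (W : groupType)
    (s : I -> W) (k : nat) : set (set W) :=
  [set conj_class w | w in [set w : W | is_involution_of_rank s k w]].

(** * The k-odd graph *)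

Definition odd_adjacent (I : finType) (m : I -> I -> nat)
    (W : groupType) (s : I -> W) (J K : {set I}) : Prop :=
  exists (l : nat) (L M X : {set I}),
    [/\ (1 <= l)%N,
        [/\ J = L :|: X, [disjoint L & X]%B,
            internal_direct_product (std_parabolic s J)
              (std_parabolic s L) (std_parabolic s X)
          & [/\ K = M :|: X, [disjoint M & X]%B
              & internal_direct_product (std_parabolic s K)
                  (std_parabolic s M) (std_parabolic s X)]],
        elementary_abelian2 (std_parabolic s L) l,
        elementary_abelian2 (std_parabolic s M) l
      & exists a b : I,
          [/\ L :\: M = [set a]%SET, M :\: L = [set b]%SET
            & odd_edge m a b]].

(* The vertex W_J is represented by J; J |-> W_J is injective. *)
Definition odd_graph_vertex (I : finType) (m : I -> I -> nat) (k : nat) :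
    pred {set I} :=
  fun J => `[< #|J| = k /\
    (forall i, i \in J -> has_listed_type m (subdiagram_component m J i)) >].

Definition odd_graph_edge (I : finType) (m : I -> I -> nat)
    (W : groupType) (s : I -> W) (k : nat) : rel {set I} :=
  fun J K => [&& odd_graph_vertex m k J, odd_graph_vertex m k K
               & `[< odd_adjacent m s J K >]].

Definition card_pi0_odd_graph (I : finType) (m : I -> I -> nat)
    (W : groupType) (s : I -> W) (k : nat) : nat :=
  n_comp (odd_graph_edge m s k) (odd_graph_vertex m k).

(* Main.v *)
Require Import Defs.
From HB Require Import structures.
From mathcomp Require Import all_boot order ssralg ssrnum zmodp matrix.
From mathcomp Require Import ring lra zify.
From mathcomp Require Import boolp classical_sets cardinality.
From mathcomp Require Import Rstruct reals trigo.

(** [W] acts faithfully on the free module with basis the simple roots, each root being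
    positive or negative.  If [y] has minimal length in the conjugacy class of an
    involution, every simple root made negative by [y] is mapped to its opposite; hence
    every involution is conjugate to some [w_J] which belongs to [W_J] and acts as [-1] on
    the span of the roots of [J]; its rank is the cardinality of [J].

    If such a [w_J] exists, no nonzero [v >= 0] supported on [J] pairs nonpositively with
    all simple roots of its support; testing this on the isotropic vectors of the affine
    diagrams bounds the subdiagrams of [J].  The argument is an induction that deletes
    one vertex at a time: when [J] minus a vertex has listed components only, the
    component of that vertex in [J] is listed, or of type [D_(2n+1)], or an odd dihedral
    diagram, and in the last two cases the longest element acts by a nontrivial diagram
    automorphism.  So [w_J] exists iff all components of [J] are listed.

    An element conjugating [w_J] to [w_K] may be taken to map the simple roots of [J] to
    those of [K], and then it is a product of elementary moves [J -> K], where [J] and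
    [K] are obtained by deleting one vertex of a common [L].  By the same classification
    such a move changes [J] only when the vertex lies in an odd dihedral component of
    [L], and this is odd-adjacency. *)

Set Implicit Arguments.
Unset Strict Implicit.
Unset Printing Implicit Defensive.
Import Order.TTheory GRing.Theory Num.Theory.

Local Open Scope ring_scope.

(** * Sequences of sines *)

(** The scalars form a real closed field (square roots of 2 and 3 occur in test vectors) with a
    family [c] known only through signs and a recurrence; actual cosines enter at the very end. The
    induction on one added vertex is manageable because the list contains no A_n with n >= 2: a
    listed component with more than one vertex has an edge of label at least 4 or a branch vertex,
    and a connected diagram passing the isotropic tests has room for only one such feature. Hence a
    new vertex meets at most one nontrivial listed component, at a leaf of it, and few attachments
    remain. Deleting an arbitrary vertex of J may destroy the existence of w_J; [neg_remove] finds
    one for which it survives. The same analysis of an added vertex serves twice: for the set J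
    itself, and for the elementary moves, where L is J with one vertex added. *)

Section SineNumbers.
Variable R : rcfType.
Implicit Types (c : R) (k m : nat).

(** Chebyshev polynomials of the second kind: [chebU c k] is U_(k-1) at c/2. With this shift they
    are the coefficients of the roots of a dihedral group. *)
Fixpoint chebU c k : R :=
  match k with
  | 0 => 0
  | 1 => 1
  | (k''.+1 as k').+1 => c * chebU c k' - chebU c k''
  end.

Lemma chebUSS c k : chebU c k.+2 = c * chebU c k.+1 - chebU c k.
Proof. by []. Qed.

(** Determinant invariant of the recurrence: just before a zero of the sequence the value is 1 or
    -1. *)
Lemma chebU_cassini c k :
  chebU c k.+1 ^+ 2 - chebU c k.+2 * chebU c k = 1.
Proof.
elim: k => [|k IHk]; first by rewrite /=; ring.
rewrite -[RHS]IHk [chebU c k.+3]chebUSS [chebU c k.+2]chebUSS; ring.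
Qed.

(* With [c = 2 cos (pi / m)] one has [chebU c k = sin (k pi / m) / sin (pi / m)]. *)
Definition is_dcos m c :=
  (forall k, (0 < k < m)%N -> 0 < chebU c k) /\ chebU c m = 0.

Variables (m : nat) (c : R).
Hypotheses (m_gt1 : (1 < m)%N) (cP : is_dcos m c).

Lemma dcos_gt0 k : (0 < k < m)%N -> 0 < chebU c k.
Proof. by case: cP => h _; apply: h. Qed.

Lemma dcos_ge0 k : (k <= m)%N -> 0 <= chebU c k.
Proof.
case: k => [|k] // le_km.
have [->|neq] := eqVneq k.+1 m; first by case: cP => _ ->.
by apply/ltW/dcos_gt0; rewrite /= ltn_neqAle neq.
Qed.

Lemma dcos_m : chebU c m = 0. Proof. by case: cP. Qed.

Lemma dcos_pred : chebU c m.-1 = 1.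
Proof.
case: m m_gt1 (dcos_m) (dcos_gt0) => [|[|k]] // _ /= um upos.
have := chebU_cassini c k; rewrite chebUSS um mul0r subr0 => /eqP.
by rewrite sqrf_eq1 => /orP[/eqP//|/eqP h]; have := upos k.+1; rewrite h ltnSn => /(_ isT); lra.
Qed.

(** The values at [m] and [m + 1] are 0 and -1, opposite to the two initial ones, and the recurrence
    propagates the sign, as in sin (x + pi) = - sin x. *)
Lemma dcosD k : chebU c (m + k) = - chebU c k.
Proof.
have um1 : chebU c m.+1 = -1.
  case: m m_gt1 dcos_m dcos_pred => [|n] // _ um up; rewrite chebUSS um.
  by rewrite (_ : chebU c n = 1) //; ring.
suff [] : chebU c (m + k) = - chebU c k /\ chebU c (m + k).+1 = - chebU c k.+1 by [].
elim: k => [|k [IH1 IH2]]; first by rewrite addn0 dcos_m um1 /= oppr0.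
by rewrite addnS; split=> //; rewrite !chebUSS IH1 IH2; ring.
Qed.

(** For c >= 2 the sequence would grow by at least 1 at each step and never return to 0. *)
Lemma dcos_lt2 : c < 2.
Proof.
rewrite ltNge; apply/negP => c_ge2.
suff H k : 0 <= chebU c k /\ chebU c k + 1 <= chebU c k.+1.
  by case: m m_gt1 dcos_m => [|n] // _ um; have [] := H n; rewrite um; lra.
elim: k => [|k [ge0 IH]]; first by rewrite /=; lra.
by rewrite chebUSS; split; nra.
Qed.

Lemma dcos_ge : 0 <= c.
Proof. by have := dcos_ge0 m_gt1; rewrite /=; lra. Qed.

Lemma dcos_gt1 : (3 < m)%N -> 1 < c.
Proof.
move=> m_gt3; have := @dcos_gt0 3%N m_gt3; have := dcos_ge; rewrite /=.
by move=> c0 c1; nra.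
Qed.

(** This bound and the next two express that [chebU c] is nonnegative at 4, 5 and 6, after removing
    factors that are positive for c > 1. They are equalities for [m] = 4, 5, 6. *)
Lemma dcos_sqr_ge2 : (3 < m)%N -> 2 <= c ^+ 2.
Proof.
move=> m_gt3; have := @dcos_ge0 4%N m_gt3; have := dcos_gt1 m_gt3; rewrite /=.
by rewrite expr2 => c1; nra.
Qed.

Lemma dcos_golden_ge : (4 < m)%N -> c + 1 <= c ^+ 2.
Proof.
move=> m_gt4; have := @dcos_ge0 5%N m_gt4; have := dcos_gt1 (ltnW m_gt4); rewrite /=.
move=> c1; rewrite (_ : _ - _ = (c ^+ 2 - c - 1) * (c ^+ 2 + c - 1)); last by ring.
by rewrite pmulr_lge0; [lra | nra].
Qed.

Lemma dcos_sqr_ge3 : (5 < m)%N -> 3 <= c ^+ 2.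
Proof.
move=> m_gt5; have := @dcos_ge0 6%N m_gt5; have := dcos_gt1 (ltnW (ltnW m_gt5)); rewrite /=.
move=> c1; rewrite (_ : _ - _ = (c ^+ 2 - 3) * (c * (c ^+ 2 - 1))); last by ring.
by rewrite pmulr_lge0; [lra | nra].
Qed.

Lemma dcos2 : m = 2%N -> c = 0.
Proof. by move=> m2; have := dcos_m; rewrite m2 /=; lra. Qed.

Lemma dcos3 : m = 3%N -> c = 1.
Proof. by move=> m3; have := dcos_m; have := dcos_ge; rewrite m3 /=; nra. Qed.

Lemma dcos4 : m = 4%N -> c ^+ 2 = 2.
Proof.
move=> m4; have := dcos_m; have := @dcos_gt1; rewrite m4 => /(_ isT) c1 /=.
rewrite (_ : _ - _ = (c ^+ 2 - 2) * c); last by ring.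
by move/eqP; rewrite mulf_eq0 => /orP[]/eqP; lra.
Qed.

Lemma dcos5 : m = 5%N -> c ^+ 2 = c + 1.
Proof.
move=> m5; have := dcos_m; have := @dcos_gt1; rewrite m5 => /(_ isT) c1 /=.
rewrite (_ : _ - _ = (c ^+ 2 - c - 1) * (c ^+ 2 + c - 1)); last by ring.
by move/eqP; rewrite mulf_eq0 => /orP[]/eqP; [lra | nra].
Qed.

End SineNumbers.
Arguments chebU : simpl never.

(** * The geometric representation *)

Section BijectionGroup.
Variable T : Type.

(** Target group for the universal property. The inverse is stored as data, yet equality depends on
    [bij_fun] only. Linearity is not built in: it is recovered by induction on words. *)
Record bijection := Bijection {
  bij_fun :> T -> T;
  bij_inv : T -> T;
  bij_funK : cancel bij_fun bij_inv;
  bij_invK : cancel bij_inv bij_fun }.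

Lemma bijectionP (f g : bijection) : bij_fun f =1 bij_fun g -> f = g.
Proof.
move=> /funext; case: f g => [f f' fK f'K] [g g' gK g'K] /= e; move: gK g'K.
rewrite -e => gK g'K.
have ei : f' = g' by apply: funext => x; rewrite -[LHS]gK f'K.
by move: gK g'K; rewrite -ei => gK g'K; congr Bijection; apply: Prop_irrelevance.
Qed.

HB.instance Definition _ := gen_eqMixin bijection.
HB.instance Definition _ := gen_choiceMixin bijection.

Definition bijection_one : bijection := @Bijection id id (fun=> erefl) (fun=> erefl).
Definition bijection_inv (f : bijection) : bijection := Bijection (bij_invK f) (bij_funK f).
Definition bijection_mul (f g : bijection) : bijection :=
  Bijection (can_comp (bij_funK f) (bij_funK g)) (can_comp (bij_invK g) (bij_invK f)).

Lemma bijection_mulA : associative bijection_mul.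
Proof. by move=> f g h; apply: bijectionP. Qed.
Lemma bijection_mul1 : left_id bijection_one bijection_mul.
Proof. by move=> f; apply: bijectionP. Qed.
Lemma bijection_mulr1 : right_id bijection_one bijection_mul.
Proof. by move=> f; apply: bijectionP. Qed.
Lemma bijection_mulV : left_inverse bijection_one bijection_inv bijection_mul.
Proof. by move=> f; apply: bijectionP => x /=; apply: bij_funK. Qed.
Lemma bijection_mulVr : right_inverse bijection_one bijection_inv bijection_mul.
Proof. by move=> f; apply: bijectionP => x /=; apply: bij_invK. Qed.

HB.instance Definition _ := isGroup.Build bijection bijection_mulA bijection_mul1
  bijection_mulr1 bijection_mulV bijection_mulVr.

Lemma bijection_expE (f : bijection) n x : (f ^+ n)%g x = iter n f x.
Proof. by elim: n => [|n IHn] //; rewrite expgS iterS -IHn. Qed.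

End BijectionGroup.

(** * The bilinear form and its reflections *)

Section TitsForm.
Variables (R : rcfType) (I : finType) (m : I -> I -> nat).

(* [c n] is [2 cos (pi / n)]; the value at [0] is the one used for an infinite label. *)
Definition dcos_family (c : nat -> R) :=
  [/\ c 0%N = 2, c 1%N = -2 & forall n, (1 < n)%N -> is_dcos n (c n)].

Variable c : nat -> R.
Hypotheses (cP : dcos_family c) (mP : coxeter_matrix m).
Local Notation V := {ffun I -> R^o}.
Implicit Types (i j k : I) (u v : V).

Lemma addfE u v i : (u + v) i = u i + v i :> R. Proof. by rewrite ffunE. Qed.
Lemma oppfE v i : (- v) i = - v i :> R. Proof. by rewrite ffunE. Qed.
Lemma scalefE (a : R) v i : (a *: v) i = a * v i :> R. Proof. by rewrite ffunE. Qed.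
Lemma zerofE i : (0 : V) i = 0 :> R. Proof. by rewrite ffunE. Qed.

(** With c 1 = -2 and c 0 = 2 one formula gives 2 on the diagonal and -2 for an infinite label:
    twice the usual Gram matrix of the simple roots. *)
Definition cox i j : R := - c (m i j).
Lemma coxE i j : cox i j = - c (m i j). Proof. by []. Qed.

Definition sroot i : V := [ffun j => (j == i)%:R].
Lemma srootE i j : sroot i j = (j == i)%:R :> R. Proof. by rewrite ffunE. Qed.
Definition vE := (addfE, oppfE, scalefE, zerofE, srootE).

Definition pair i v : R := \sum_k cox i k * v k.
Definition refl i v : V := v - pair i v *: sroot i.
(* Twice the usual Tits form. *)
Definition form u v : R := \sum_i u i * pair i v.

Lemma cox_matrix_diag i : m i i = 1%N. Proof. by case: mP. Qed.
Lemma cox_matrixC i j : m i j = m j i. Proof. by case: mP. Qed.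
Lemma cox_matrix_neq1 i j : i != j -> m i j != 1%N.
Proof. by case: mP => _ _ h /eqP/h/eqP. Qed.

Lemma coxC i j : cox i j = cox j i. Proof. by rewrite /cox cox_matrixC. Qed.
Lemma cox_diag i : cox i i = 2.
Proof. by rewrite /cox cox_matrix_diag; case: cP => _ -> _; rewrite opprK. Qed.

Lemma cox_le0 i j : i != j -> cox i j <= 0.
Proof.
move=> neq; rewrite /cox oppr_le0; have := cox_matrix_neq1 neq.
case: (m i j) => [|[|n]] // _; first by case: cP => -> _ _; lra.
by case: cP => _ _ h; apply: (@dcos_ge R n.+2 _ _ (h n.+2 isT)).
Qed.

Lemma cox2 i j : m i j = 2%N -> cox i j = 0.
Proof.
by rewrite /cox => e; case: cP => _ _ h; rewrite e (dcos2 (h 2%N isT) erefl) oppr0.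
Qed.

Lemma pairD i u v : pair i (u + v) = pair i u + pair i v.
Proof. by rewrite -big_split; apply: eq_bigr => k _; rewrite vE mulrDr. Qed.
Lemma pairN i v : pair i (- v) = - pair i v.
Proof. by rewrite -sumrN; apply: eq_bigr => k _; rewrite vE mulrN. Qed.
Lemma pairB i u v : pair i (u - v) = pair i u - pair i v.
Proof. by rewrite pairD pairN. Qed.
Lemma pairZ i a v : pair i (a *: v) = a * pair i v.
Proof. by rewrite mulr_sumr; apply: eq_bigr => k _; rewrite vE mulrCA. Qed.
Lemma pair0 i : pair i 0 = 0.
Proof. by rewrite -(scale0r 0) pairZ mul0r. Qed.
Lemma pair_sroot i j : pair i (sroot j) = cox i j.
Proof.
rewrite /pair (bigD1 j) //= ffunE eqxx mulr1 big1 ?addr0 // => k /negbTE nk.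
by rewrite vE nk mulr0.
Qed.

Lemma sroot_decomp v : v = \sum_i v i *: sroot i.
Proof.
apply/ffunP => j; rewrite sum_ffunE (bigD1 j) //= !vE eqxx big1 ?addr0; first exact/esym/mulr1.
by move=> i; rewrite eq_sym !vE => /negbTE ->; apply: mulr0.
Qed.

Lemma reflD i : {morph refl i : u v / u + v}.
Proof. by move=> u v; rewrite /refl pairD scalerDl opprD addrACA. Qed.
Lemma reflZ i a : {morph refl i : v / a *: v}.
Proof. by move=> v; rewrite /refl pairZ scalerBr scalerA. Qed.
Lemma reflK i : involutive (refl i).
Proof.
move=> v; rewrite /refl pairB pairZ pair_sroot cox_diag.
by apply/ffunP => k; rewrite !vE; ring.
Qed.

Lemma formC u v : form u v = form v u.
Proof.
rewrite /form /pair; under eq_bigr do rewrite mulr_sumr.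
rewrite exchange_big; apply: eq_bigr => i _; rewrite mulr_sumr; apply: eq_bigr => j _.
by rewrite coxC; ring.
Qed.
Lemma formDr u v w : form u (v + w) = form u v + form u w.
Proof. by rewrite -big_split; apply: eq_bigr => k _; rewrite pairD mulrDr. Qed.
Lemma formZr u a v : form u (a *: v) = a * form u v.
Proof. by rewrite mulr_sumr; apply: eq_bigr => k _; rewrite pairZ mulrCA. Qed.
Lemma form_sroot i v : form (sroot i) v = pair i v.
Proof.
rewrite /form (bigD1 i) //= ffunE eqxx mul1r big1 ?addr0 // => k /negbTE nk.
by rewrite vE nk mul0r.
Qed.
Lemma formNr u v : form u (- v) = - form u v.
Proof. by rewrite -scaleN1r formZr mulN1r. Qed.

Lemma form_refl i u v : form (refl i u) (refl i v) = form u v.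
Proof.
have fs w : form w (sroot i) = pair i w by rewrite formC form_sroot.
rewrite /refl formDr formNr formZr fs formC formDr formNr formZr fs.
by rewrite pairB pairZ pair_sroot cox_diag (formC v); ring.
Qed.

Section Rank2.
Variables (i j : I).
Hypothesis neq_ij : i != j.
Local Notation d := (c (m i j)).

Lemma refl_pairE v : refl i (refl j v) = v - (pair i v + d * pair j v) *: sroot i - pair j v *: sroot j.
Proof.
rewrite /refl pairB pairZ pair_sroot /cox -/d.
by apply/ffunP => k; rewrite !vE; ring.
Qed.

Lemma iter_rot_fix v (k : nat) : pair i v = 0 -> pair j v = 0 -> iter k (refl i \o refl j) v = v.
Proof. by move=> vi vj; elim: k => [|k IHk] //=; rewrite IHk refl_pairE vi vj mulr0 addr0 !scale0r !subr0. Qed.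

Lemma iter_rotD (k : nat) : {morph iter k (refl i \o refl j) : u v / u + v}.
Proof. by elim: k => // k IHk u v; rewrite !iterS IHk /= !reflD. Qed.
Lemma iter_rotZ (k : nat) a : {morph iter k (refl i \o refl j) : v / a *: v}.
Proof. by elim: k => // k IHk v; rewrite !iterS IHk /= !reflZ. Qed.

Lemma cox_dE : cox i j = - d. Proof. by []. Qed.
Lemma cox_dE' : cox j i = - d. Proof. by rewrite coxC. Qed.

Lemma iter_rot_l (k : nat) : iter k (refl i \o refl j) (sroot i) =
  chebU d k.*2.+1 *: sroot i + chebU d k.*2 *: sroot j.
Proof.
elim: k => [|k IHk]; first by rewrite /chebU /= scale1r scale0r addr0.
rewrite iterS IHk /= refl_pairE !(pairD, pairZ) !pair_sroot !cox_diag cox_dE cox_dE'.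
rewrite ?doubleS [chebU d k.*2.+3]chebUSS [chebU d k.*2.+2]chebUSS.
by apply/ffunP => x; rewrite !vE; ring.
Qed.

Lemma iter_rot_r (k : nat) : iter k.+1 (refl i \o refl j) (sroot j) =
  - (chebU d k.*2.+2 *: sroot i + chebU d k.*2.+1 *: sroot j).
Proof.
elim: k => [|k IHk].
  rewrite /= refl_pairE !pair_sroot cox_dE cox_diag /chebU /=.
  by apply/ffunP => x; rewrite !vE; ring.
rewrite iterS IHk /= refl_pairE !(pairD, pairZ, pairN) !pair_sroot !cox_diag cox_dE cox_dE'.
rewrite ?doubleS [chebU d k.*2.+4]chebUSS [chebU d k.*2.+3]chebUSS [chebU d k.*2.+2]chebUSS.
by apply/ffunP => x; rewrite !vE; ring.
Qed.

(** For a finite label at least 2 the form is nondegenerate on the plane of the two roots, so a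
    vector splits into a plane part and a part fixed by both reflections. On the plane, shifting the
    indices twice by the label changes the sign twice. For label 0 nothing is iterated. *)
Lemma iter_rot_order v : iter (m i j) (refl i \o refl j) v = v.
Proof.
have := cox_matrix_neq1 neq_ij; case e: (m i j) => [|[|n]] // _.
have dP : is_dcos n.+2 d by rewrite e; case: cP => _ _ h; apply: h.
have n1 : (1 < n.+2)%N by [].
have d4 : 4 - d ^+ 2 != 0.
  have := dcos_lt2 n1 dP; have := dcos_ge n1 dP; move: (d) => z h1 h2.
  by rewrite (_ : _ - _ = (2 - z) * (2 + z)); [rewrite mulf_neq0 // gt_eqF //; lra | ring].
(* Solution of the linear system making [v - p] orthogonal to both roots; its determinant is 4 - d ^
   2. *)
pose x := (2 * pair i v + d * pair j v) / (4 - d ^+ 2).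
pose y := (2 * pair j v + d * pair i v) / (4 - d ^+ 2).
pose p := x *: sroot i + y *: sroot j.
have fixq : iter n.+2 (refl i \o refl j) (v - p) = v - p.
  apply: iter_rot_fix; rewrite /p !(pairN, pairD, pairZ) !pair_sroot !cox_diag ?cox_dE ?cox_dE' /x /y.
    by field.
  by field.
suff fixp : iter n.+2 (refl i \o refl j) p = p.
  by rewrite -[v in LHS](subrK p) iter_rotD fixq fixp subrK.
rewrite iter_rotD !iter_rotZ iter_rot_l iter_rot_r.
have -> : (n.+2.*2.+1 = n.+2 + n.+3)%N by lia.
have -> : (n.+2.*2 = n.+2 + n.+2)%N by lia.
have -> : (n.+1.*2.+2 = n.+2 + n.+2)%N by lia.
have -> : (n.+1.*2.+1 = n.+2 + n.+1)%N by lia.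
rewrite !(dcosD n1 dP) (dcos_m dP) -[n.+3]addn1 dcosD // (dcos_pred n1 dP) /chebU /= /p.
by apply/ffunP => k; rewrite !vE; ring.
Qed.
End Rank2.

Definition refl_bij i : bijection V := Bijection (reflK i) (reflK i).

Lemma refl_bij_relation i j : ((refl_bij i * refl_bij j) ^+ m i j = 1)%g.
Proof.
apply: bijectionP => v; rewrite bijection_expE.
have [<-|neq] := eqVneq i j; first by rewrite cox_matrix_diag /= reflK.
exact: iter_rot_order.
Qed.

End TitsForm.

Section GeomRep.
Variables (R : rcfType) (c : nat -> R) (cP : dcos_family c).
Variables (I : finType) (m : I -> I -> nat) (W : groupType) (s : I -> W).
Hypothesis hW : coxeter_system m s.

Lemma geom_rep_exists : exists act : W -> {ffun I -> R^o} -> {ffun I -> R^o},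
  [/\ forall v, act 1%g v = v, forall x y v, act (x * y)%g v = act x (act y v)
    & forall i v, act (s i) v = refl m c i v].
Proof.
have [f fs] := coxeter_system_universal hW
  (refl_bij_relation cP (coxeter_system_matrix hW)).
exists (fun w => bij_fun (f w)); split=> [v|x y v|i v]; last by rewrite fs.
  suff -> : f 1%g = 1%g by [].
  by apply: (@mulIg _ (f 1%g)); rewrite -gmulfM !mul1g.
by rewrite gmulfM.
Qed.

End GeomRep.

(** The case of an infinite label: the sequence never returns to 0, just as there is no braid
    relation. *)
Lemma chebU2 (R : rcfType) k : chebU (2 : R) k = k%:R.
Proof.
suff [] : chebU (2 : R) k = k%:R /\ chebU (2 : R) k.+1 = k.+1%:R by [].
elim: k => [|k [IH1 IH2]] //; split=> //; rewrite chebUSS IH1 IH2.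
by rewrite -addn1 -[k.+2]addn2 -[k.+1]addn1 !natrD; ring.
Qed.

(** * Words and length *)

Section Words.
Variables (I : finType) (m : I -> I -> nat) (W : groupType) (s : I -> W).
Hypothesis hW : coxeter_system m s.
Implicit Types (i j : I) (p q : seq I) (w v : W) (J K : {set I}).
Local Open Scope group_scope.

Definition wprod p : W := foldr (fun i x => s i * x) 1 p.
Definition inW J w := exists2 p, {subset p <= J} & wprod p = w.

Lemma wprod_cat p q : wprod (p ++ q) = wprod p * wprod q.
Proof. by elim: p => [|i p IHp] /=; rewrite ?mul1g // IHp mulgA. Qed.

Lemma wprod_rcons p i : wprod (rcons p i) = wprod p * s i.
Proof. by rewrite -cats1 wprod_cat /= mulg1. Qed.

Lemma gen_sq i : s i * s i = 1.
Proof.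
have := coxeter_system_relations hW i i.
by rewrite (cox_matrix_diag (coxeter_system_matrix hW)) expg1.
Qed.

Lemma genV i : (s i)^-1 = s i.
Proof. by apply: mulg1_eq; apply: gen_sq. Qed.

Lemma mul_genK w i : w * s i * s i = w.
Proof. by rewrite -mulgA gen_sq mulg1. Qed.

Lemma wprod_rev p : wprod (rev p) = (wprod p)^-1.
Proof.
elim: p => [|i p IHp] /=; first by rewrite invg1.
by rewrite rev_cons wprod_rcons IHp invgM genV.
Qed.

Lemma inW1 J : inW J 1. Proof. by exists [::]. Qed.
Lemma inWM J w v : inW J w -> inW J v -> inW J (w * v).
Proof.
move=> [p pJ <-] [q qJ <-]; exists (p ++ q); last exact: wprod_cat.
by move=> i; rewrite mem_cat => /orP[/pJ|/qJ].
Qed.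
Lemma inWV J w : inW J w -> inW J w^-1.
Proof.
by move=> [p pJ <-]; exists (rev p); [move=> i; rewrite mem_rev => /pJ | exact: wprod_rev].
Qed.
Lemma inW_gen J i : i \in J -> inW J (s i).
Proof. by move=> iJ; exists [:: i]; rewrite /= ?mulg1 // => j; rewrite inE => /eqP ->. Qed.
Lemma inWS J K w : J \subset K -> inW J w -> inW K w.
Proof. by move=> /fintype.subsetP JK [p pJ <-]; exists p => // i /pJ/JK. Qed.

Lemma inW_ind J (P : W -> Prop) :
  P 1 -> (forall i w, i \in J -> inW J w -> P w -> P (s i * w)) ->
  forall w, inW J w -> P w.
Proof.
move=> P1 PS w [p pJ <-]; elim: p pJ => [|i p IHp] //= pJ.
have pJ' : {subset p <= J} by move=> k kp; apply: pJ; rewrite inE kp orbT.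
by apply: PS; [apply: pJ; rewrite inE eqxx | exists p | apply: IHp].
Qed.

Lemma std_parabolicE J : std_parabolic s J = [set w | inW J w]%classic.
Proof.
apply/seteqP; split=> w.
  apply; split; last by move=> _ [i iJ <-]; apply: inW_gen.
  by split=> [|x y Jx Jy]; [apply: inW1 | apply: inWM Jx (inWV Jy)].
move=> Jw H [[H1 HM] sH].
have HV x : H x -> H x^-1 by move=> Hx; rewrite -[x^-1]mul1g; apply: HM.
apply: (inW_ind (P := fun w => H w)) Jw => // i v iJ _ Hv.
by rewrite -[v]invgK; apply: HM; [apply: sH; exists i | apply: HV].
Qed.

Lemma wordP w : exists p, wprod p = w.
Proof.
have : inW [set: I]%SET w.
  have := std_parabolicE [set: I]%SET; rewrite /std_parabolic.
  have -> : [set s j | j in [set` [set: I]%SET]]%classic = range s.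
    by apply/seteqP; split=> _ [i _ <-]; exists i => //=; rewrite inE.
  rewrite (coxeter_system_generated hW) => /seteqP[h _].
  exact: h.
by case=> p _ <-; exists p.
Qed.

Lemma inWT w : inW [set: I]%SET w.
Proof. by have [p <-] := wordP w; exists p. Qed.

Lemma len_subproof w : exists n, `[< exists2 p, wprod p = w & size p = n >].
Proof. by have [p pw] := wordP w; exists (size p); apply/asboolP; exists p. Qed.

Definition len w := ex_minn (len_subproof w).

Lemma lenP w : exists2 p, wprod p = w & size p = len w.
Proof. by rewrite /len; case: ex_minnP => n /asboolP. Qed.

Lemma len_le p : (len (wprod p) <= size p)%N.
Proof. by rewrite /len; case: ex_minnP => n _; apply; apply/asboolP; exists p. Qed.

Lemma lenM w v : (len (w * v) <= len w + len v)%N.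
Proof.
have [p pw <-] := lenP w; have [q qv <-] := lenP v.
by rewrite -pw -qv -wprod_cat -size_cat len_le.
Qed.

Lemma len_gen i : (len (s i) <= 1)%N.
Proof. by have := len_le [:: i]; rewrite /= mulg1. Qed.

Lemma len_mul_gen w i : (len (w * s i) <= (len w).+1)%N.
Proof. by rewrite -addn1; apply: leq_trans (lenM _ _) _; rewrite leq_add2l len_gen. Qed.

Lemma len_mul_gen' w i : (len w <= (len (w * s i)).+1)%N.
Proof. by rewrite -{1}[w](mul_genK w i) len_mul_gen. Qed.

Lemma lenV_le w : (len w^-1 <= len w)%N.
Proof. by have [p <- <-] := lenP w; rewrite -wprod_rev -(size_rev p) len_le. Qed.

Lemma lenV w : len w^-1 = len w.
Proof. by apply/eqP; rewrite eqn_leq lenV_le -{1}[w]invgK lenV_le. Qed.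

Lemma len_wprod_lt w : w != 1 -> exists i, (len (w * s i) < len w)%N.
Proof.
have [p pw sp] := lenP w; case/lastP: p pw sp => [<-|p i pw sp _]; first by rewrite eqxx.
exists i; rewrite -sp size_rcons ltnS -pw wprod_rcons mul_genK; exact: len_le.
Qed.

(** The alternating word of length [k] ending in [j]: it grows on the left, so the last letter does
    not depend on the parity of [k]. *)
Fixpoint alt i j k : seq I :=
  if k is k'.+1 then (if odd k' then i else j) :: alt i j k' else [::].

Lemma alt_cat i j a b : exists2 p, alt i j (a + b) = p ++ alt i j b & size p = a.
Proof.
elim: a => [|a [p /= e sp]]; first by exists [::].
by exists ((if odd (a + b) then i else j) :: p); rewrite /= ?e ?sp.
Qed.

Lemma alt_rcons i j k : exists2 p, alt i j k.+1 = rcons p j & size p = k.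
Proof. by have [p] := alt_cat i j k 1; rewrite addn1 cats1; exists p. Qed.

Lemma alt_braid_quotient i j k : wprod (alt i j k) * (wprod (alt j i k))^-1 =
  if odd k then (s j * s i) ^+ k else (s i * s j) ^+ k.
Proof.
elim: k => [|k IHk]; first by rewrite /= invg1 mulg1.
rewrite /= invgM genV mulgA -(mulgA _ (wprod _)) IHk.
have expgSS x n : x ^+ n.+1 = x ^+ n * x :> W by apply: expgSr.
have aux x y n : s x * (s y * s x) ^+ n * s y = (s x * s y) ^+ n.+1.
  by elim: n => [|n IHn]; rewrite ?mulg1 // [RHS]expgSS -IHn [in LHS]expgSS !mulgA.
by case: (odd k); rewrite /= aux.
Qed.

Lemma alt_braid i j : wprod (alt i j (m i j)) = wprod (alt j i (m i j)).
Proof.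
apply: divg1_eq; rewrite alt_braid_quotient (coxeter_system_relations hW).
by rewrite (cox_matrixC (coxeter_system_matrix hW)) (coxeter_system_relations hW) if_same.
Qed.

(** Letters [i] and [j] are stripped from the right as long as the length drops. Since lengths add,
    positivity for [w] separates into a rank 2 question and one about the shorter [v]. *)
Lemma dihedral_decomp i j w : exists v x,
  [/\ w = v * wprod x, {subset x <= [:: i; j]}, len w = (len v + size x)%N,
      (len v <= len (v * s i))%N & (len v <= len (v * s j))%N].
Proof.
have [n] := ubnP (len w); elim: n w => // n IHn w lt_wn.
have step k : k \in [:: i; j] -> (len (w * s k) < len w)%N -> exists v x,
  [/\ w = v * wprod x, {subset x <= [:: i; j]}, len w = (len v + size x)%N,
      (len v <= len (v * s i))%N & (len v <= len (v * s j))%N].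
  move=> kij lt_wk; have [|v [x [e xij el h1 h2]]] := IHn (w * s k); first by lia.
  exists v, (rcons x k); split=> //; first by rewrite wprod_rcons mulgA -e mul_genK.
    by move=> y; rewrite mem_rcons inE => /orP[/eqP->|/xij].
  by rewrite size_rcons; have := len_mul_gen' w k; lia.
have [hi|hi] := leqP (len w) (len (w * s i)); last by apply: step hi; rewrite inE eqxx.
have [hj|hj] := leqP (len w) (len (w * s j)); last by apply: step hj; rewrite !inE eqxx orbT.
by exists w, [::]; split; rewrite ?mulg1 ?addn0.
Qed.

(** In a shortest word no two adjacent letters agree, since they would cancel. The default [j] in
    [last j x] admits the empty word. *)
Lemma alt_of_reduced i j x : {subset x <= [:: i; j]} ->
  (forall y, {subset y <= [:: i; j]} -> wprod y = wprod x -> (size x <= size y)%N) ->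
  last j x = j -> x = alt i j (size x).
Proof.
elim: x => [|a x IHx] // axij red_ax la /=.
have xij : {subset x <= [:: i; j]} by move=> k kx; apply: axij; rewrite inE kx orbT.
have aij : a \in [:: i; j] by apply: axij; rewrite inE eqxx.
case: x => [|b x] in IHx axij red_ax la xij *; first by rewrite /= in la; rewrite la.
have e : b :: x = alt i j (size (b :: x)).
  apply: IHx => // y yij e; have := red_ax (a :: y); rewrite /= ltnS; apply; last by rewrite e.
  by move=> k; rewrite inE => /orP[/eqP->|/yij].
rewrite -/(size (b :: x)) -e; congr (_ :: _).
have eb : b = if odd (size x) then i else j by case: e.
have neq_ab : a != b.
  apply/eqP => eab; have := red_ax x; rewrite /= eab mulgA gen_sq mul1g.
  move=> h; suff : ((size x).+1 < size x)%N by lia.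
  by apply: h => // k kx; apply: xij; rewrite inE kx orbT.
move: aij neq_ab; rewrite !inE /= eb => /orP[]/eqP ->; case: odd => //=; rewrite ?eqxx //.
Qed.

End Words.

(** * Signs of roots *)

Section Action.
Variables (R : rcfType) (c : nat -> R) (cP : dcos_family c).
Variables (I : finType) (m : I -> I -> nat) (W : groupType) (s : I -> W).
Hypothesis hW : coxeter_system m s.
Local Notation V := {ffun I -> R^o}.
Local Notation sroot := (@sroot R I).
Local Notation pair := (pair m c).
Local Notation form := (form m c).
Local Notation cox := (cox m c).
Local Notation wprod := (wprod s).
Local Notation len := (len hW).
Implicit Types (i j k : I) (u v : V) (x y w : W) (J K L : {set I}).

Local Notation mP := (coxeter_system_matrix hW).

Definition act : W -> V -> V := projT1 (cid (geom_rep_exists cP hW)).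

Lemma act1 v : act 1%g v = v.
Proof. by rewrite /act; case: cid => a [h _ _] /=; apply: h. Qed.
Lemma actM x y v : act (x * y)%g v = act x (act y v).
Proof. by rewrite /act; case: cid => a [_ h _] /=; apply: h. Qed.
Lemma act_gen i v : act (s i) v = refl m c i v.
Proof. by rewrite /act; case: cid => a [_ _ h] /=; apply: h. Qed.
Lemma act_genE i v : act (s i) v = v - pair i v *: sroot i.
Proof. exact: act_gen. Qed.

Lemma actD w : {morph act w : u v / u + v}.
Proof.
have [p <-] := wordP hW w; elim: p => [|i p IHp] u v; first by rewrite !act1.
by rewrite !actM IHp !act_gen reflD.
Qed.
Lemma actZ w (a : R) : {morph act w : v / a *: v}.
Proof.
have [p <-] := wordP hW w; elim: p => [|i p IHp] v; first by rewrite !act1.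
by rewrite !actM IHp !act_gen reflZ.
Qed.
Lemma actN w : {morph act w : v / - v}.
Proof. by move=> v; rewrite -scaleN1r actZ scaleN1r. Qed.
Lemma actB w : {morph act w : u v / u - v}.
Proof. by move=> u v; rewrite actD actN. Qed.
Lemma act0 w : act w 0 = 0.
Proof. by rewrite -(scale0r 0) actZ !scale0r. Qed.
Lemma act_sum w (T : Type) (r : seq T) (P : pred T) (F : T -> V) :
  act w (\sum_(t <- r | P t) F t) = \sum_(t <- r | P t) act w (F t).
Proof. exact: (big_morph (act w) (actD w) (act0 w)). Qed.

Lemma act_decomp w v : act w v = \sum_i v i *: act w (sroot i).
Proof. by rewrite {1}[v]sroot_decomp act_sum; under eq_bigr do rewrite actZ. Qed.

Lemma actK w v : act w^-1 (act w v) = v.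
Proof. by rewrite -actM mulVg act1. Qed.
Lemma actKV w v : act w (act w^-1 v) = v.
Proof. by rewrite -actM mulgV act1. Qed.
Lemma act_inj w : injective (act w).
Proof. exact: can_inj (actK w). Qed.

Lemma act_form w u v : form (act w u) (act w v) = form u v.
Proof.
have [p <-] := wordP hW w; elim: p => [|i p IHp]; first by rewrite !act1.
by rewrite /= !actM !act_gen (form_refl cP mP).
Qed.

Lemma form_diag i : form (sroot i) (sroot i) = 2.
Proof. by rewrite form_sroot pair_sroot (cox_diag cP mP). Qed.

Lemma act_gen_sroot i : act (s i) (sroot i) = - sroot i.
Proof.
by rewrite act_genE pair_sroot (cox_diag cP mP); apply/ffunP => k; rewrite !vE; ring.
Qed.

Definition ge0 v := forall i, 0 <= v i :> R.
Definition le0 v := forall i, v i <= 0 :> R.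

Lemma ge0_sroot i : ge0 (sroot i).
Proof. by move=> k; rewrite srootE ler0n. Qed.
Lemma ge0D u v : ge0 u -> ge0 v -> ge0 (u + v).
Proof. by move=> hu hv k; rewrite vE addr_ge0. Qed.
Lemma ge0Z (a : R) v : 0 <= a -> ge0 v -> ge0 (a *: v).
Proof. by move=> ha hv k; rewrite vE mulr_ge0. Qed.
Lemma ge0_sum (T : Type) (r : seq T) (P : pred T) (F : T -> V) :
  (forall t, P t -> ge0 (F t)) -> ge0 (\sum_(t <- r | P t) F t).
Proof.
by move=> h; elim/big_rec: _ => [k|t v Pt hv]; [rewrite vE | apply: ge0D => //; apply: h].
Qed.
Lemma le0N v : le0 v <-> ge0 (- v).
Proof. by split=> h k; have := h k; rewrite vE oppr_ge0. Qed.
Lemma ge0_le0 v : ge0 v -> le0 v -> v = 0.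
Proof. by move=> h1 h2; apply/ffunP => k; apply/eqP; rewrite zerofE eq_le h1 h2. Qed.

Lemma sroot_neq0 i : sroot i != 0.
Proof. by apply/eqP => /ffunP/(_ i); rewrite !vE eqxx => /eqP; rewrite oner_eq0. Qed.
Lemma act_sroot_neq0 w i : act w (sroot i) != 0.
Proof. by apply/eqP => h; have := sroot_neq0 i; rewrite -(actK w (sroot i)) h act0 eqxx. Qed.
Lemma sroot_inj : injective (fun i => sroot i).
Proof.
move=> i j /ffunP/(_ i); rewrite !vE eqxx; have [//|_ /eqP] := eqVneq i j.
by rewrite oner_eq0.
Qed.

Lemma act_alt i j (k : nat) : act (wprod (alt i j k)) (sroot i) =
  let d := c (m i j) in
  chebU d k.+1 *: sroot (if odd k then j else i) + chebU d k *: sroot (if odd k then i else j).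
Proof.
elim: k => [|k IHk]; first by rewrite /= act1 /chebU /= scale1r scale0r addr0.
rewrite actM IHk /= act_genE !(pairD, pairZ) !pair_sroot.
rewrite [chebU _ k.+2]chebUSS; case: (odd k) => /=;
  by rewrite !(cox_diag cP mP) /cox ?(cox_matrixC mP j i); apply/ffunP => l; rewrite !vE; ring.
Qed.

(** With [j] a descent of [w], split off the part of [w] in the dihedral group of [i] and [j]. That
    part is an alternating word shorter than [m i j], so it takes [sroot i] to a combination of the
    two roots whose coefficients are nonnegative terms of the sine sequence; the induction
    hypothesis applies to the remaining factor. *)
Lemma act_ge0_sroot w i : (len w <= len (w * s i))%N -> ge0 (act w (sroot i)).
Proof.
have [n] := ubnP (len w); elim: n w i => // n IHn w i lt_wn le_wi.
have [->|w1] := eqVneq w 1%g; first by rewrite act1; apply: ge0_sroot.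
have [j lt_wj] := len_wprod_lt hW w1.
have neq_ij : i != j by apply: contraL lt_wj => /eqP <-; rewrite -leqNgt.
have [v [x [ew xij el hvi hvj]]] := dihedral_decomp hW i j (w * s j)%g.
(* The decomposition was applied to [w * s j], so that the word obtained for [w] is nonempty and
   ends in [j]. *)
pose x1 := rcons x j.
have x1ij : {subset x1 <= [:: i; j]}.
  by move=> k; rewrite mem_rcons inE => /orP[/eqP->|/xij //]; rewrite !inE eqxx orbT.
have ew1 : w = (v * wprod x1)%g by rewrite wprod_rcons mulgA -ew (mul_genK hW).
have el1 : len w = (len v + size x1)%N.
  by rewrite size_rcons addnS -el; have := len_mul_gen' hW w j; lia.
have red (y : seq I) : wprod y = wprod x1 -> (size x1 <= size y)%N.
  move=> e; have := lenM hW v (wprod y); rewrite e -ew1 el1.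
  by have := len_le hW y; rewrite e; lia.
have ex1 : x1 = alt i j (size x1).
  apply: (alt_of_reduced hW) => //; last by rewrite last_rcons.
  by move=> y _; apply: red.
(* Otherwise the braid relation would rewrite the word so as to end in [i], and [w * s i] would be
   shorter than [w]. *)
have bound : m i j = 0%N \/ (size x1 < m i j)%N.
  have [m0|m_gt0] := posnP (m i j); [by left | right; rewrite ltnNge; apply/negP => le_m].
  have [p ep sp] := alt_cat i j (size x1 - m i j) (m i j).
  rewrite subnK // -ex1 in ep.
  have [q eq sq] := alt_rcons j i (m i j).-1; rewrite prednK // in eq.
  have e1 : wprod x1 = wprod (rcons (p ++ q) i).
    by rewrite ep wprod_cat (alt_braid hW) eq -wprod_cat rcons_cat.
  have : (len (w * s i) <= len v + size (p ++ q))%N.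
    rewrite ew1 e1 wprod_rcons mulgA (mul_genK hW).
    by apply: leq_trans (lenM hW _ _) _; rewrite leq_add2l len_le.
  by rewrite size_cat sq sp; lia.
have upos (k : nat) : (k <= (size x1).+1)%N -> 0 <= chebU (c (m i j)) k.
  have [c0 _ hc] := cP.
  case: bound => [->|lt_x1 le_k]; first by rewrite c0 chebU2 ler0n.
  by apply: (dcos_ge0 (hc _ _)); lia.
rewrite ew1 actM ex1 act_alt /= actD !actZ.
have [vi vj] : ge0 (act v (sroot i)) /\ ge0 (act v (sroot j)).
  have lt_vn : (len v < n)%N by move: el1; rewrite size_rcons; lia.
  by split; apply: IHn.
by apply: ge0D; apply: ge0Z; try (by apply: upos); case: odd.
Qed.

Lemma act_le0_sroot w i : (len (w * s i) < len w)%N -> le0 (act w (sroot i)).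
Proof.
move=> lt_wi; apply/le0N; rewrite -actN -act_gen_sroot -actM.
by apply: act_ge0_sroot; rewrite (mul_genK hW) ltnW.
Qed.

Lemma act_sroot_sign w i : ge0 (act w (sroot i)) \/ le0 (act w (sroot i)).
Proof.
have [/act_ge0_sroot|/act_le0_sroot] := leqP (len w) (len (w * s i)); by [left|right].
Qed.

Lemma act_ge0_le0 w i : ge0 (act w (sroot i)) -> le0 (act w (sroot i)) -> False.
Proof. by move=> h1 h2; have := act_sroot_neq0 w i; rewrite (ge0_le0 h1 h2) eqxx. Qed.

Lemma len_lt_le0 w i : le0 (act w (sroot i)) -> (len (w * s i) < len w)%N.
Proof.
move=> h; have [/act_ge0_sroot h'|//] := leqP (len w) (len (w * s i)).
by case: (act_ge0_le0 h' h).
Qed.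

Lemma ge0_of_pos w i k : 0 < act w (sroot i) k :> R -> ge0 (act w (sroot i)).
Proof. by move=> h; case: (act_sroot_sign w i) => // /(_ k); rewrite leNgt h. Qed.
Lemma le0_of_neg w i k : act w (sroot i) k < 0 :> R -> le0 (act w (sroot i)).
Proof. by move=> h; case: (act_sroot_sign w i) => // /(_ k); rewrite leNgt h. Qed.

Lemma act_eq1 w : (forall i, ge0 (act w (sroot i))) -> w = 1%g.
Proof.
move=> h; apply/eqP/negP => /negP /(len_wprod_lt hW)[i /act_le0_sroot].
exact: act_ge0_le0.
Qed.

Lemma act_faithful x y : (forall i, act x (sroot i) = act y (sroot i)) -> x = y.
Proof.
move=> h; apply: (@mulgI _ y^-1%g); rewrite mulVg; apply: act_eq1 => i.
by rewrite actM h actK; apply: ge0_sroot.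
Qed.

Lemma ge0_act w v : ge0 v -> (forall i, v i != 0 -> ge0 (act w (sroot i))) -> ge0 (act w v).
Proof.
move=> hv hw; rewrite act_decomp; apply: ge0_sum => i _.
by have [->|/hw h] := eqVneq (v i) 0; [rewrite scale0r => k; rewrite vE | apply: ge0Z].
Qed.

Lemma le0_act w v : ge0 v -> (forall i, v i != 0 -> le0 (act w (sroot i))) -> le0 (act w v).
Proof.
move=> hv hw; apply/le0N; rewrite act_decomp -sumrN; apply: ge0_sum => i _.
rewrite -scalerN; have [->|/hw/le0N h] := eqVneq (v i) 0; last exact: ge0Z.
by rewrite scale0r => k; rewrite vE.
Qed.

End Action.

(** * Parabolic subgroups *)

Section Parabolic.
Variables (R : rcfType) (c : nat -> R) (cP : dcos_family c).
Variables (I : finType) (m : I -> I -> nat) (W : groupType) (s : I -> W).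
Hypothesis hW : coxeter_system m s.
Local Notation V := {ffun I -> R^o}.
Local Notation sroot := (@sroot R I).
Local Notation pair := (@pair R I m c).
Local Notation inW := (inW s).
Local Notation len := (len hW).
Local Notation act := (act cP hW).
Local Notation mP := (coxeter_system_matrix hW).
Implicit Types (i j k l : I) (u v : V) (x y w g h : W) (J K L : {set I}).

Definition supp J v := forall i, i \notin J -> v i = 0 :> R.

Lemma supp_sroot J j : j \in J -> supp J (sroot j).
Proof. by move=> jJ i iJ; rewrite srootE; case: eqP iJ => // ->; rewrite jJ. Qed.
Lemma suppD J u v : supp J u -> supp J v -> supp J (u + v).
Proof. by move=> hu hv i iJ; rewrite vE hu // hv // addr0. Qed.
Lemma suppZ J (a : R) v : supp J v -> supp J (a *: v).
Proof. by move=> hv i iJ; rewrite vE hv // mulr0. Qed.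
Lemma suppS J K v : J \subset K -> supp J v -> supp K v.
Proof.
by move=> /fintype.subsetP JK hv i iK; apply: hv; apply: contra iK => /JK.
Qed.

(** A letter of [J] changes only a coordinate in [J]; coordinates outside [J] are invariants of W_J,
    and most sign arguments start from one of them. *)
Lemma inW_act_off J w v i : inW J w -> i \notin J -> act w v i = v i :> R.
Proof.
move=> Jw iJ; elim/inW_ind: Jw => [|j {}w jJ _ IHw]; first by rewrite act1.
rewrite actM act_genE !vE IHw; case: eqP iJ => [->|_ _]; first by rewrite jJ.
by rewrite mulr0 subr0.
Qed.

Lemma inW_supp J w v : inW J w -> supp J v -> supp J (act w v).
Proof. by move=> Jw hv i iJ; rewrite (inW_act_off _ Jw) // hv. Qed.

Lemma inW_act_perp J w v : inW J w -> (forall j, j \in J -> pair j v = 0) -> act w v = v.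
Proof.
move=> Jw hv; elim/inW_ind: Jw => [|j {}w jJ _ IHw]; first by rewrite act1.
by rewrite actM IHw act_genE hv // scale0r subr0.
Qed.

Lemma inW_act_ge0 J w i : inW J w -> i \notin J -> ge0 (act w (sroot i)).
Proof.
move=> Jw iJ; apply: (@ge0_of_pos _ _ _ _ _ _ _ _ _ _ i).
by rewrite (inW_act_off _ Jw) // srootE eqxx ltr01.
Qed.

Lemma inW_eq1 J w : inW J w -> (forall j, j \in J -> ge0 (act w (sroot j))) -> w = 1%g.
Proof.
move=> Jw hw; apply: (@act_eq1 _ _ cP _ _ _ _ hW) => i.
by have [/hw|] := boolP (i \in J); last exact: inW_act_ge0.
Qed.

Lemma inW_faithful J x y : inW J x -> inW J y ->
  (forall j, j \in J -> act x (sroot j) = act y (sroot j)) -> x = y.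
Proof.
move=> Jx Jy hxy; apply: (@mulgI _ y^-1%g); rewrite mulVg.
apply: (@inW_eq1 J); first by apply: inWM => //; apply: (inWV hW).
by move=> j jJ; rewrite actM hxy // actK; apply: ge0_sroot.
Qed.

(** Descents in [J] are moved into the right factor until none remains. The last clause provides the
    decrease for later inductions on length. *)
Lemma coset_min w J : exists x (u : W), [/\ w = (x * u)%g, inW J u,
  forall j, j \in J -> ge0 (act x (sroot j)) & x = w \/ (len x < len w)%N].
Proof.
have [n] := ubnP (len w); elim: n w => // n IHn w lt_wn.
have [h|] := boolP [forall j in J, (len w <= len (w * s j)%g)%N].
  exists w, 1%g; rewrite mulg1; split=> //; [exact: inW1 | | by left].
  by move=> j jJ; apply: act_ge0_sroot; move/forall_inP: h => /(_ j jJ).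
rewrite negb_forall_in => /exists_inP[j jJ]; rewrite -ltnNge => lt_wj.
have [|x [u [e Ju hx hl]]] := IHn (w * s j)%g; first exact: leq_trans lt_wj _.
exists x, (u * s j)%g; split=> //; first by rewrite mulgA -e (mul_genK hW).
  by apply: inWM => //; apply: inW_gen.
by right; case: hl => [->//|/leq_trans]; apply; apply: ltnW.
Qed.

Lemma sroot_of_ge0_scale h j i (a : R) : 0 <= a -> act h (sroot j) = a *: sroot i ->
  act h (sroot j) = sroot i.
Proof.
move=> a0 e; suff a1 : a = 1 by rewrite e a1 scale1r.
have := act_form cP hW h (sroot j) (sroot j).
rewrite e formZr (formC c mP) formZr !(form_diag cP hW) => h2.
have : (a - 1) * (a + 1) == 0 by apply/eqP; lra.
by rewrite mulf_eq0 => /orP[]/eqP; lra.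
Qed.

(* A nonnegative combination of [J]-roots made simple by an element positive on [J]
   was simple already: [h] sends each of its terms to a multiple of [sroot i]. *)
Lemma simple_of_act_simple J h x j i : (forall k, k \in J -> ge0 (act h (sroot k))) ->
  ge0 (act x (sroot j)) -> supp J (act x (sroot j)) ->
  act h (act x (sroot j)) = sroot i ->
  exists2 k, k \in J & act x (sroot j) = sroot k /\ act h (sroot k) = sroot i.
Proof.
move=> hJ pos sJ e; set b := act x (sroot j) in pos sJ e *.
have [k bk] : exists k, b k != 0.
  apply/existsP; rewrite -negb_forall; apply/negP => /forallP b0.
  have := act_sroot_neq0 cP hW x j; rewrite -/b => /eqP; apply.
  by apply/ffunP => k; rewrite zerofE; apply/eqP/b0.
have kJ : k \in J by apply: contraNT bk => /sJ ->.
have bk0 : 0 < b k by rewrite lt_neqAle eq_sym bk pos.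
have hk l : l != i -> act h (sroot k) l = 0 :> R.
  move=> li; apply/eqP; rewrite eq_le hJ // andbT.
  have : sroot i l = 0 :> R by rewrite srootE (negbTE li).
  rewrite -e act_decomp (bigD1 k) //= vE sum_ffunE vE => sum0.
  set S := (X in _ + X = _) in sum0; have S0 : 0 <= S.
    apply: sumr_ge0 => q _; rewrite vE.
    have [->|bq] := eqVneq (b q) 0; first by rewrite mul0r.
    by rewrite mulr_ge0 ?pos // hJ //; apply: contraNT bq => /sJ ->.
  by rewrite -(pmulr_rle0 _ bk0); move: sum0 S0; lra.
have hki : act h (sroot k) = sroot i.
  apply: (@sroot_of_ge0_scale _ _ _ (act h (sroot k) i)); first exact: hJ.
  apply/ffunP => l; rewrite !vE; have [->|/hk ->] := eqVneq l i; first by rewrite mulr1.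
  by rewrite mulr0.
by exists k => //; split=> //; apply: (@act_inj _ _ cP _ _ _ _ hW h); rewrite e hki.
Qed.

Definition isneg J w := inW J w /\ forall j, j \in J -> act w (sroot j) = - sroot j.
Definition neg J := exists w, isneg J w.

Lemma isneg_supp J w v : isneg J w -> supp J v -> act w v = - v.
Proof.
move=> [_ hw] hv; rewrite act_decomp [in RHS](sroot_decomp v) -sumrN; apply: eq_bigr => i _.
by have [/hw ->|/hv ->] := boolP (i \in J); rewrite ?scalerN // !scale0r oppr0.
Qed.

Lemma isneg_uniq J w w' : isneg J w -> isneg J w' -> w = w'.
Proof.
by move=> [Jw hw] [Jw' hw']; apply: inW_faithful Jw Jw' _ => j jJ; rewrite hw ?hw'.
Qed.

Lemma isneg_sq J w : isneg J w -> (w * w = 1)%g.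
Proof.
move=> [Jw hw]; apply: (@inW_eq1 J); first exact: inWM.
by move=> j jJ; rewrite actM !(hw, actN) // opprK; apply: ge0_sroot.
Qed.

(** A coordinate outside [J] is both kept and negated. Thus the eigenspace of w_J for -1 is exactly
    the span of [J], and the element determines this span. *)
Lemma inW_eigenN1 J w v : inW J w -> act w v = - v -> supp J v.
Proof.
move=> Jw e i iJ; have := inW_act_off v Jw iJ; rewrite e vE => h; lra.
Qed.

Lemma isneg_set1 i : isneg [set i]%SET (s i).
Proof.
split; first by apply: inW_gen; rewrite inE.
by move=> j; rewrite inE => /eqP ->; apply: act_gen_sroot.
Qed.

Lemma negU J K : (forall j k, j \in J -> k \in K -> m j k = 2%N) ->
  neg J -> neg K -> neg (J :|: K)%SET.
Proof.
move=> JK [w [Jw hw]] [y [Ky hy]]; exists (w * y)%g; split.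
  by apply: inWM; [apply: inWS Jw; apply: finset.subsetUl | apply: inWS Ky; apply: finset.subsetUr].
move=> i; rewrite inE actM => /orP[iJ|iK].
  rewrite (inW_act_perp Ky) ?hw // => k kK.
  by rewrite pair_sroot (cox2 cP) // (cox_matrixC mP) JK.
rewrite hy // actN (inW_act_perp Jw) // => j jJ.
by rewrite pair_sroot (cox2 cP) // JK.
Qed.

(** [y0] sends simple roots of [L] to opposites of simple roots, which [y] makes nonnegative. This
    is uniqueness of the longest element, in terms of signs only. *)
Lemma le0_longest L y y0 (p : I -> I) : inW L y -> inW L y0 ->
  (forall l, l \in L -> le0 (act y (sroot l))) ->
  (forall l, l \in L -> p l \in L /\ act y0 (sroot l) = - sroot (p l)) ->
  y = y0^-1%g.
Proof.
move=> Ly Ly0 hy hy0; suff e : (y * y0)%g = 1%g by rewrite -[y](mulgK y0) e mul1g.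
apply: (@inW_eq1 L); first exact: inWM.
move=> l lL; have [pL e] := hy0 l lL; rewrite actM e actN.
by have /le0N := hy _ pL.
Qed.

End Parabolic.

(** * Involutions *)

Section Involutions.
Variables (R : rcfType) (c : nat -> R) (cP : dcos_family c).
Variables (I : finType) (m : I -> I -> nat) (W : groupType) (s : I -> W).
Hypothesis hW : coxeter_system m s.
Local Notation V := {ffun I -> R^o}.
Local Notation sroot := (@sroot R I).
Local Notation pair := (@pair R I m c).
Local Notation inW := (inW s).
Local Notation len := (len hW).
Local Notation act := (act cP hW).
Local Notation mP := (coxeter_system_matrix hW).
Implicit Types (i j k l : I) (u v : V) (x y w g h : W) (J K L : {set I}).
Local Notation isneg := (isneg cP hW).
Local Notation neg := (neg cP hW).

(** The conjugating element is minimised inside W_L, so that the result applies within a parabolic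
    subgroup as well as in the whole group; [K] collects the simple roots made negative by the
    shortest conjugate. *)
Lemma inW_involution L w : inW L w -> (w * w = 1)%g ->
  exists g K, [/\ inW L g, K \subset L & isneg K (g * w * g^-1)%g].
Proof.
move=> Lw ww.
pose P n := `[< exists2 g, inW L g & len (g * w * g^-1)%g = n >].
have exP : exists n, P n.
  by exists (len (1 * w * 1^-1)%g); apply/asboolP; exists 1%g => //; apply: inW1.
have /asboolP[g Lg eg] : P (ex_minn exP) by case: ex_minnP.
have gmin h : inW L h -> (len (g * w * g^-1) <= len (h * w * h^-1))%N.
  by move=> Lh; rewrite eg; case: ex_minnP => n _; apply; apply/asboolP; exists h.
set x := (g * w * g^-1)%g in eg gmin.
have xx : (x * x = 1)%g by rewrite /x !mulgA mulgVK -(mulgA g) ww mulg1 mulgV.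
have xV : (x^-1 = x)%g by apply: mulg1_eq.
have Lx : inW L x by apply: inWM; [apply: inWM | apply: (inWV hW)].
pose K := [set k | `[< le0 (act x (sroot k)) >]]%SET.
have KL : K \subset L.
  apply/fintype.subsetP => k; rewrite inE => /asboolP hk; apply/negPn/negP => kL.
  exact: (act_ge0_le0 (inW_act_ge0 cP hW Lx kL) hk).
have xK k : k \in K -> act x (sroot k) = - sroot k.
  move=> kK; have kL := fintype.subsetP KL k kK; move: kK; rewrite inE => /asboolP hk.
  have lt_xk := len_lt_le0 hk.
  have le_x : (len x <= len (s k * x * s k))%N.
    have := gmin (s k * g)%g; rewrite invgM (genV hW) !mulgA -(mulgA (s k)) -(mulgA (s k)).
    by rewrite -/x; apply; apply: inWM => //; apply: inW_gen.
  (* [s k] changes only coordinate [k]; hence every other coordinate of [act x (sroot k)] is both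
     nonnegative and nonpositive. *)
  have pos : ge0 (act (s k * x) (sroot k)).
    apply: act_ge0_sroot; apply: leq_trans le_x.
    by rewrite -(lenV hW) invgM xV (genV hW) ltnW.
  have e : act x (sroot k) = act x (sroot k) k *: sroot k.
    apply/ffunP => l; rewrite !vE; have [->|lk] := eqVneq l k; first by rewrite mulr1.
    rewrite mulr0; apply/eqP; rewrite eq_le hk /=; have := pos l.
    by rewrite actM act_genE !vE (negbTE lk) mulr0 subr0.
  set a : R := act x (sroot k) k in e; have a0 : a <= 0 := hk k.
  have a2 : a * a = 1.
    have <- : act (x * x) (sroot k) k = a * a :> R by rewrite actM e actZ e !vE eqxx mulr1.
    by rewrite xx act1 srootE eqxx.
  suff a1 : a = -1 by rewrite e a1 scaleN1r.
  have : (a - 1) * (a + 1) == 0 by apply/eqP; rewrite (_ : _ * _ = a * a - 1); [lra | ring].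
  by rewrite mulf_eq0 => /orP[]/eqP; lra.
have xN v : supp K v -> act x v = - v.
  move=> hv; rewrite act_decomp [in RHS](sroot_decomp v) -sumrN; apply: eq_bigr => i _.
  by have [/xK ->|/hv ->] := boolP (i \in K); rewrite ?scalerN // !scale0r oppr0.
exists g, K; split=> //; split=> //.
have [y [u [exyu Ku hy _]]] := coset_min cP hW x K.
suff y1 : y = 1%g by rewrite -/x exyu y1 mul1g.
apply: (@act_eq1 _ _ cP _ _ _ _ hW) => i.
have [/hy //|iK] := boolP (i \in K).
have ey : y = (x * u^-1)%g by rewrite exyu mulgK.
have xi : ge0 (act x (sroot i)).
  by case: (act_sroot_sign cP hW x i) => // h; move: iK; rewrite inE => /asboolP[].
(* If the image lay in the span of [K], applying [x] again would give [act x (sroot i) = - sroot i],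
   putting [i] in [K]. The coordinate [l] found here is untouched by the correction [r], which is
   supported on [K]. *)
have [l /andP[lK xil]] : exists l, (l \notin K) && (act x (sroot i) l != 0).
  apply/existsP; apply: contraT => /existsPn h.
  have hs : supp K (act x (sroot i)).
    by move=> l lK; apply/eqP; have := h l; rewrite lK /= negbK.
  have := xN _ hs; rewrite -actM xx act1 => e.
  have : le0 (act x (sroot i)) by apply/le0N; rewrite -e; apply: ge0_sroot.
  by move=> h'; case: (act_ge0_le0 xi h').
apply: (@ge0_of_pos _ _ _ _ _ _ _ _ _ _ l).
have Ku' := inWV hW Ku.
rewrite ey actM; set r := act u^-1 (sroot i) - sroot i.
have hr : supp K r by move=> q qK; rewrite !vE (inW_act_off cP hW _ Ku' qK) srootE subrr.
have -> : act u^-1 (sroot i) = sroot i + r by rewrite addrC subrK.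
clearbody r; by rewrite actD (xN r) // !vE hr // subr0 lt_neqAle eq_sym xil xi.
Qed.

(** Each letter of a reduced word adds a nonnegative multiple of a positive root. *)
Lemma antidominant_act w v : (forall i, pair i v <= 0) -> ge0 (act w v - v).
Proof.
move=> hv; have [n] := ubnP (len w); elim: n w => // n IHn w lt_wn.
have [->|w1] := eqVneq w 1%g; first by rewrite act1 subrr => k; rewrite vE.
have [i lt_wi] := len_wprod_lt hW w1.
have pos : ge0 (act (w * s i) (sroot i)).
  by apply: act_ge0_sroot; rewrite (mul_genK hW) ltnW.
have -> : act w v - v = (act (w * s i) v - v) + (- pair i v) *: act (w * s i) (sroot i).
  rewrite -{1}[w](mul_genK hW _ i) actM act_genE actB actZ.
  by apply/ffunP => k; rewrite !vE; ring.
by apply: ge0D; [apply: IHn; lia | apply: ge0Z => //; rewrite oppr_ge0].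
Qed.

(* Only the part of positive definiteness, for the form on the span of [L], that excludes
   the affine and indefinite subdiagrams. *)
Definition posdef L := forall v : V, ge0 v -> supp L v ->
  (forall l, l \in L -> v l != 0 -> pair l v <= 0) -> v = 0.

(** Such a [v] pairs nonpositively with every simple root, off its support because the off-diagonal
    entries are nonpositive. Then v <= y v <= 0 coordinatewise. *)
Lemma le0_posdef L y : (forall l, l \in L -> le0 (act y (sroot l))) -> posdef L.
Proof.
move=> hy v v0 vL hv; have hp i : pair i v <= 0.
  have [vi|vi] := eqVneq (v i) 0; last first.
    by apply: hv => //; apply: contraNT vi => /vL ->.
  apply: sumr_le0 => k _; have [->|ki] := eqVneq k i; first by rewrite vi mulr0.
  by rewrite mulr_le0_ge0 ?v0 // (cox_le0 cP mP) // eq_sym.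
apply: ge0_le0 => //.
have h1 := antidominant_act y hp.
have h2 : le0 (act y v) by apply: le0_act => // l vl; apply: hy; apply: contraNT vl => /vL ->.
by move=> k; have := h1 k; have := h2 k; rewrite !vE; lra.
Qed.

Lemma isneg_le0 J w : isneg J w -> forall j, j \in J -> le0 (act w (sroot j)).
Proof. by move=> [_ hw] j /hw ->; apply/le0N; rewrite opprK; apply: ge0_sroot. Qed.

Lemma neg_posdef J : neg J -> posdef J.
Proof. by move=> [w /isneg_le0]; apply: le0_posdef. Qed.

(* [w_J s_i] is an involution of [W_J] with a single eigenvalue [1] on the span of [J], so
   that it is conjugate in [W_J] to [w_K] where [K] is [J] minus one element. *)
Lemma neg_remove J i : neg J -> i \in J -> exists2 k, k \in J & neg (J :\ k)%SET.
Proof.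
move=> [w hw] iJ; have [Jw hwJ] := hw.
have wN v : supp J v -> act w v = - v := isneg_supp hw.
have Jsi : inW J (s i) by apply: inW_gen.
have comm : (w * s i = s i * w)%g.
  apply: (@inW_faithful _ _ cP _ _ _ _ hW J _ _ (inWM Jw Jsi) (inWM Jsi Jw)) => j jJ.
  by rewrite !actM hwJ // actN wN //; apply: inW_supp Jsi _; apply: supp_sroot.
pose x := (w * s i)%g; have Jx : inW J x by apply: inWM.
have xx : (x * x = 1)%g.
  by rewrite /x {2}comm mulgA (mul_genK hW) (isneg_sq hw).
have [g [K [Jg KJ hy]]] := inW_involution Jx xx.
set y := (g * x * g^-1)%g in hy; have [Ky hyK] := hy.
have yy := isneg_sq hy.
have fixx v : supp J v -> act x v = v -> exists a : R, v = a *: sroot i.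
  move=> vJ; rewrite actM wN; last exact: inW_supp vJ.
  rewrite act_genE => e; exists (pair i v / 2).
  by apply/ffunP => k; have /ffunP/(_ k) := e; rewrite !vE; lra.
pose ga := act g (sroot i).
have fixy v : supp J v -> act y v = v -> exists a : R, v = a *: ga.
  move=> vJ e; have [||a ea] := fixx (act g^-1 v).
  - by apply: inW_supp vJ; apply: (inWV hW).
  - by rewrite -{2}e /y actM actM actK.
  - by exists a; rewrite /ga -actZ -ea actKV.
have fixa a : a \in J -> exists t : R, sroot a + act y (sroot a) = t *: ga.
  move=> aJ; apply: fixy; last by rewrite actD -actM yy act1 addrC.
  apply: suppD; first exact: supp_sroot.
  by apply: inW_supp (supp_sroot _ aJ); apply: inWS Ky.
(* Since [y] fixes coordinates outside [K], the vectors [sroot a + act y (sroot a)] for [a] in [J]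
   minus [K] form twice an identity matrix there. All are multiples of [ga], so there is at most one
   such [a]; there is one, since for [J] = [K] the vector [ga] would be both fixed and negated by
   [y]. *)
have coef a b : b \notin K -> (sroot a + act y (sroot a)) b = 2 * (b == a)%:R :> R.
  by move=> bK; rewrite vE (inW_act_off cP hW _ Ky bK) srootE; lra.
have [k /finset.setDP[kJ kK]|JK] := pickP [in J :\: K]%SET; last first.
  have eJK : J = K.
    apply/eqP; rewrite finset.eqEsubset KJ andbT; apply/fintype.subsetP => a aJ.
    by have := JK a; rewrite !inE aJ andbT => /negbFE.
  have yga : act y ga = ga.
    by rewrite /ga /y !actM actK act_gen_sroot actN hwJ // opprK.
  have : act y ga = - ga.
    by apply: (isneg_supp hy); rewrite -eJK; apply: inW_supp Jg _; apply: supp_sroot.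
  rewrite yga => e; have := act_sroot_neq0 cP hW g i; case/eqP.
  by apply/ffunP => l; have /ffunP/(_ l) := e; rewrite -/ga !vE; lra.
exists k => //; suff -> : (J :\ k)%SET = K by exists y.
apply/setP => a; rewrite !inE; apply/andP/idP => [[ak aJ]|aK]; last first.
  by split; [apply: contraNneq kK => <- | apply: fintype.subsetP aK].
apply/negPn/negP => aK; have [t et] := fixa a aJ; have [r er] := fixa k kJ.
have := coef a a aK; have := coef a k kK; have := coef k k kK.
rewrite et er !vE !eqxx eq_sym (negbTE ak) mulr0 mulr1 => h1 /eqP.
rewrite mulf_eq0 => /orP[]/eqP h2; first by rewrite h2 mul0r; lra.
by move: h1; rewrite h2 mulr0; lra.
Qed.

End Involutions.

(** * Forbidden subdiagrams *)

Section Forbidden.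
Variables (R : rcfType) (c : nat -> R) (cP : dcos_family c).
Variables (I : finType) (m : I -> I -> nat).
Hypothesis mP : coxeter_matrix m.
Local Notation V := {ffun I -> R^o}.
Implicit Types (i j k l x y z : I) (u v : V) (J K L P : {set I}) (p q r : seq I).

Definition wt i j : R := c (m i j).
Definition edge i j := diagram_edge m i j.
Definition heavy i j := edge i j && (m i j != 3%N).

Lemma edgeC i j : edge i j = edge j i.
Proof. by rewrite /edge /diagram_edge eq_sym (cox_matrixC mP). Qed.
Lemma heavyC i j : heavy i j = heavy j i.
Proof. by rewrite /heavy edgeC (cox_matrixC mP). Qed.
Lemma edge_neq i j : edge i j -> i != j.
Proof. by case/andP. Qed.
Lemma heavy_edge i j : heavy i j -> edge i j.
Proof. by case/andP. Qed.

Lemma edge_label i j : edge i j -> m i j = 0%N \/ (2 < m i j)%N.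
Proof.
case/andP => neq m2; have := cox_matrix_neq1 mP neq; move: m2.
by case: (m i j) => [|[|[|n]]] //; [left | right].
Qed.
Lemma heavy_label i j : heavy i j -> m i j = 0%N \/ (3 < m i j)%N.
Proof.
by case/andP => /edge_label[->|m2 m3]; [left | right; rewrite ltn_neqAle eq_sym m3].
Qed.

Lemma wt_ge0 i j : i != j -> 0 <= wt i j.
Proof. by move=> neq; have := cox_le0 cP mP neq; rewrite /cox oppr_le0. Qed.

Lemma wt_ge1 i j : edge i j -> 1 <= wt i j.
Proof.
have [c0 _ hc] := cP; rewrite /wt => /edge_label[->|m2]; first by rewrite c0 ler1n.
have [m3|m3] := eqVneq (m i j) 3%N.
  by rewrite m3 (dcos3 _ (hc 3%N isT)).
have := dcos_gt1 _ (hc _ (ltnW m2)); move=> h; apply/ltW/h; lia.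
Qed.

Lemma wt_heavy i j : heavy i j -> Num.sqrt 2 <= wt i j.
Proof.
have [c0 _ hc] := cP => hv; have w1 := wt_ge1 (heavy_edge hv).
rewrite -(ger0_norm (le_trans ler01 w1)) -sqrtr_sqr ler_wsqrtr //.
rewrite /wt; case: (heavy_label hv) => [->|m3]; first by rewrite c0 expr2; lra.
by have m1 := ltnW (ltnW m3); apply: (dcos_sqr_ge2 m1 (hc _ m1)).
Qed.

Lemma sqrt2_sq : Num.sqrt 2 * Num.sqrt 2 = 2 :> R.
Proof. by rewrite -expr2 sqr_sqrtr // ler0n. Qed.
Lemma sqrt2_ge1 : 1 <= Num.sqrt 2 :> R.
Proof. by rewrite -{1}sqrtr1 ler_wsqrtr // ler1n. Qed.

Section Fixed.
Variable L : {set I}.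
Hypothesis hL : posdef c m L.

(** The list [r] is a certificate that the pairing at [i] is nonpositive: vertices left out of it
    can only lower the pairing. *)
Lemma posdef_contra (f : I -> R) : (forall i, 0 <= f i) -> (forall i, i \notin L -> f i = 0) ->
  (forall i, i \in L -> f i != 0 ->
     exists r, [/\ uniq r, i \notin r & 2 * f i <= \sum_(k <- r) wt i k * f k]) ->
  forall i, f i = 0.
Proof.
move=> f0 fL hf i; pose v : V := [ffun k => f k].
have vE k : v k = f k :> R by rewrite ffunE.
suff /ffunP/(_ i) : v = 0 by rewrite vE zerofE.
apply: hL => [k|k kL|k kL]; rewrite vE; [exact: f0 | exact: fL | move=> fk].
have [r [ur kr hr]] := hf k kL fk.
rewrite /pair (bigD1 k) //= (cox_diag cP mP) vE.
have -> : \sum_(l | l != k) cox m c k l * v l = - \sum_(l | l != k) wt k l * f l.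
  by rewrite -sumrN; apply: eq_bigr => l _; rewrite vE /cox mulNr.
rewrite subr_le0; apply: le_trans hr _.
rewrite big_uniq //= [X in _ <= X](bigID (mem r)) /=.
rewrite [X in X <= _](eq_bigl (fun l => (l != k) && (l \in r))) ; last first.
  by move=> l; have [->|//] := eqVneq l k; rewrite (negbTE kr).
by rewrite lerDl; apply: sumr_ge0 => l /andP[lk _]; rewrite mulr_ge0 // wt_ge0 // eq_sym.
Qed.

Section Neighbourhood.
Variable P : {set I}.
Hypothesis PL : P \subset L.

(* [P] stands for the inner vertices of a diagram of classical affine type; the values
   are those of a suitably scaled isotropic vector of that diagram. *)
Definition nbh_weight x : R :=
  if x \in P then 2 else if (x \in L) && [exists p in P, heavy p x] then Num.sqrt 2
  else if (x \in L) && [exists p in P, edge p x] then 1 else 0.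

Lemma nbh_weight_ge0 x : 0 <= nbh_weight x.
Proof. by rewrite /nbh_weight; do !case: ifP => _ //; rewrite ?sqrtr_ge0 ?ler0n. Qed.

Lemma nbh_weight_edge x k : x \in P -> k \in L -> edge x k -> 1 <= nbh_weight k.
Proof.
move=> xP kL xk; rewrite /nbh_weight; case: ifP => [_|_]; first by rewrite ler1n.
rewrite kL /=; case: ifP => [_|_]; first exact: sqrt2_ge1.
by case: existsP => // -[]; exists x; rewrite xP.
Qed.

Lemma nbh_weight_heavy x k : x \in P -> k \in L -> heavy x k -> Num.sqrt 2 <= nbh_weight k.
Proof.
move=> xP kL xk; rewrite /nbh_weight; case: ifP => [_|_].
  by have := sqrt2_sq; have := sqrt2_ge1; nra.
by rewrite kL /=; case: existsP => // -[]; exists x; rewrite xP.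
Qed.

Lemma score1 x k : x \in P -> k \in L -> edge x k -> 1 <= wt x k * nbh_weight k.
Proof.
move=> xP kL xk; rewrite -[1]mulr1; apply: ler_pM; rewrite ?ler01 ?wt_ge1 //.
exact: nbh_weight_edge xk.
Qed.

Definition strong x k := edge x k && ((k \in P) || heavy x k).

Lemma score2 x k : x \in P -> k \in L -> strong x k -> 2 <= wt x k * nbh_weight k.
Proof.
move=> xP kL /andP[xk /orP[kP|hk]].
  by rewrite /nbh_weight kP -[X in X <= _]mul1r ler_wpM2r ?ler0n // wt_ge1.
rewrite -sqrt2_sq; apply: ler_pM; rewrite ?sqrtr_ge0 ?wt_heavy //.
exact: nbh_weight_heavy hk.
Qed.

(** An inner vertex has value 2, so its neighbours must contribute 4. A [strong] edge contributes at
    least 2 and any other at least 1, whence the patterns 2 + 2, 2 + 1 + 1 and 1 + 1 + 1 + 1. An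
    outer vertex is balanced by a single inner neighbour. *)
Lemma nbh_contra x0 : x0 \in P ->
  (forall x, x \in P ->
    [\/ exists a b, [/\ a != b, a \in L, b \in L, strong x a & strong x b],
        exists a b d, [/\ uniq [:: a; b; d], [/\ a \in L, b \in L & d \in L],
          strong x a, edge x b & edge x d]
      | exists a b d e, [/\ uniq [:: a; b; d; e],
          [/\ a \in L, b \in L, d \in L & e \in L] &
          [/\ edge x a, edge x b, edge x d & edge x e]]]) -> False.
Proof.
move=> x0P hP; suff : nbh_weight x0 = 0.
  by rewrite /nbh_weight x0P => /eqP; rewrite pnatr_eq0.
move: x0 {x0P}; apply: posdef_contra => [x|x xL|x xL xn]; first exact: nbh_weight_ge0.
  by rewrite /nbh_weight (negbTE xL) ifN //; apply: contra xL => /(fintype.subsetP PL).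
have [xP|xP] := boolP (x \in P).
  have -> : nbh_weight x = 2 by rewrite /nbh_weight xP.
  have neq k : edge x k -> (x == k) = false by move/edge_neq/negbTE.
  have sneq k : strong x k -> (x == k) = false by move=> /andP[/neq].
  case: (hP x xP) => [[a [b [ab aL bL xa xb]]]
    |[a [b [d [u [aL bL dL] xa xb xd]]]]|[a [b [d [e [u [aL bL dL eL] [xa xb xd xe]]]]]]].
  - exists [:: a; b]; rewrite /= !inE ab !sneq // !big_cons big_nil.
    by split=> //; have := score2 xP aL xa; have := score2 xP bL xb; lra.
  - exists [:: a; b; d]; split=> //; first by rewrite !inE sneq // !neq.
    rewrite !big_cons big_nil.
    by have := score2 xP aL xa; have := score1 xP bL xb; have := score1 xP dL xd; lra.
  - exists [:: a; b; d; e]; split=> //; first by rewrite !inE !neq.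
    rewrite !big_cons big_nil; have := score1 xP aL xa; have := score1 xP bL xb.
    by have := score1 xP dL xd; have := score1 xP eL xe; lra.
have [hv|hv] := boolP [exists p in P, heavy p x].
  have -> : nbh_weight x = Num.sqrt 2 by rewrite /nbh_weight (negbTE xP) xL hv.
  have /exists_inP[p pP px] := hv; exists [:: p]; split=> //.
    by rewrite inE eq_sym edge_neq // heavy_edge.
  rewrite big_seq1 mulrC; have -> : nbh_weight p = 2 by rewrite /nbh_weight pP.
  by rewrite ler_wpM2r ?ler0n // wt_heavy // heavyC.
have [ev|ev] := boolP [exists p in P, edge p x]; last first.
  by move: xn; rewrite /nbh_weight (negbTE xP) xL (negbTE hv) (negbTE ev) eqxx.
have -> : nbh_weight x = 1 by rewrite /nbh_weight (negbTE xP) xL (negbTE hv) ev.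
have /exists_inP[p pP px] := ev; exists [:: p]; split=> //.
  by rewrite inE eq_sym edge_neq.
rewrite big_seq1; have -> : nbh_weight p = 2 by rewrite /nbh_weight pP.
by rewrite mulrC ler_wpM2r ?ler0n // wt_ge1 // edgeC.
Qed.

End Neighbourhood.
End Fixed.
End Forbidden.

(** * Paths, branch vertices and cycles *)

Section Chains.
Variables (R : rcfType) (c : nat -> R) (cP : dcos_family c).
Variables (I : finType) (m : I -> I -> nat).
Hypothesis mP : coxeter_matrix m.
Implicit Types (i j k x y z a b d e : I) (J K L P : {set I}) (p q r l : seq I).
Local Notation edge := (edge m).
Local Notation heavy := (heavy m).

Definition chain L l := [/\ sorted edge l, uniq l & {subset l <= L}].
Definition branch L b := exists a d e,
  [/\ uniq [:: a; d; e], [/\ a \in L, d \in L & e \in L] & [/\ edge b a, edge b d & edge b e]].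

Lemma chain_rev L l : chain L l -> chain L (rev l).
Proof.
move=> [sl ul lL]; split; last by move=> x; rewrite mem_rev => /lL.
  by rewrite rev_sorted; move: sl; rewrite (eq_sorted (edgeC mP)).
by rewrite rev_uniq.
Qed.

Lemma chain_behead L x l : chain L (x :: l) -> chain L l.
Proof.
move=> [/= sl /andP[_ ul] lL]; split=> //; first exact: path_sorted sl.
by move=> y yl; apply: lL; rewrite inE yl orbT.
Qed.

Lemma chain_of_connect L x y : x != y -> connect (full_subdiagram_edge m L) x y ->
  exists2 l, chain L (x :: l) & last x l = y.
Proof.
move=> neq /connectP[p px ey]; case: (shortenP px) ey => p' px' up' _ ey.
exists p'; last by rewrite ey.
have pe : path edge x p' by apply: sub_path px' => a b /and3P[].
split=> //; case: p' px' {up' pe} ey => [|b p'] /=; first by move=> _ e; rewrite e eqxx in neq.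
move=> /andP[/and3P[xL bL _] pb] _ z; rewrite !inE => /or3P[/eqP->|/eqP->|zp] //.
elim: p' b pb zp {bL} => // d p' IH b /= /andP[/and3P[_ dL _] pd].
by rewrite inE => /orP[/eqP->|] //; apply: IH pd.
Qed.

Lemma chain_interior L x l y : chain L (x :: l) -> y \in l -> y != last x l ->
  exists a b, [/\ a \in x :: l, b \in l, a != b, edge y a & edge y b].
Proof.
move=> [/= + + _] yl; case/splitPr: yl => p1 p2.
case: p2 => [|b p2]; first by rewrite last_cat /= eqxx.
rewrite cat_path /= => /and4P[_ ay yb _] /andP[xn un] _; exists (last x p1), b.
have mp : last x p1 \in x :: p1 by apply: mem_last.
split=> //; [ | by rewrite mem_cat !inE eqxx !orbT | | by rewrite (edgeC mP)].
  by move: mp; rewrite !inE mem_cat => /orP[->|->] //; rewrite orbT.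
move: xn un; rewrite mem_cat !inE !negb_or cat_uniq /= => /and4P[_ _ xb _] /and3P[_ h _].
move: mp; rewrite inE => /orP[/eqP->//|mp]; apply: contraNneq h => <-.
by rewrite mp orbT.
Qed.

Section Fixed.
Variable L : {set I}.
Hypothesis hL : posdef c m L.

Lemma star4_contra b a d e f : b \in L -> uniq [:: a; d; e; f] ->
  [/\ a \in L, d \in L, e \in L & f \in L] ->
  [/\ edge b a, edge b d, edge b e & edge b f] -> False.
Proof.
move=> bL u iL ed; apply: (@nbh_contra _ _ cP _ _ mP _ hL [set b]%SET _ b).
- by rewrite finset.sub1set.
- by rewrite inE.
by move=> x; rewrite inE => /eqP ->; apply: Or33; exists a, d, e, f.
Qed.

Lemma heavy_fork_contra b a d e : b \in L -> uniq [:: a; d; e] ->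
  [/\ a \in L, d \in L & e \in L] -> heavy b a -> edge b d -> edge b e -> False.
Proof.
move=> bL u iL ba bd be; apply: (@nbh_contra _ _ cP _ _ mP _ hL [set b]%SET _ b).
- by rewrite finset.sub1set.
- by rewrite inE.
move=> x; rewrite inE => /eqP ->; apply: Or32; exists a, d, e; split=> //.
by rewrite /strong ba orbT heavy_edge.
Qed.

Lemma heavy2_contra b a d : b \in L -> a != d -> a \in L -> d \in L ->
  heavy b a -> heavy b d -> False.
Proof.
move=> bL ad aL dL ba bd; apply: (@nbh_contra _ _ cP _ _ mP _ hL [set b]%SET _ b).
- by rewrite finset.sub1set.
- by rewrite inE.
move=> x; rewrite inE => /eqP ->; apply: Or31; exists a, d; split=> //;
  by rewrite /strong ?ba ?bd orbT heavy_edge.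
Qed.

(** An end of a diagram of type affine B, C or D: besides its successor, the first vertex has a
    heavy edge or two more edges. The extra neighbours may lie on the path, where their weight is
    only larger. *)
Definition affine_end l := if l is x :: y :: _ then
    (exists q : I, [/\ q \in L, q != y & heavy x q]) \/
    (exists a b, [/\ uniq [:: a; b; y], a \in L, b \in L, edge x a & edge x b])
  else False.

Lemma branch_affine_end x y l : branch L x -> affine_end (x :: y :: l).
Proof.
move=> [a [d [e [u [aL dL eL] [xa xd xe]]]]]; right; move: u; rewrite /= !inE !negb_or.
move=> /and3P[/andP[ad ae] de _].
have [<-|ay] := eqVneq a y.
  by exists d, e; rewrite /= !inE !negb_or de !(eq_sym _ a) ad ae.
have [<-|dy] := eqVneq d y.
  by exists a, e; rewrite /= !inE !negb_or ae ad (eq_sym e) de.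
by exists a, d; rewrite /= !inE !negb_or ad ay dy.
Qed.

Lemma endok_rcons l z : (1 < size l)%N -> affine_end (rcons l z) -> affine_end l.
Proof. by case: l => [|x [|y l]]. Qed.

Lemma endok_score P x l : {subset x :: l <= P} -> P \subset L -> chain L (x :: l) -> affine_end (x :: l) ->
    [\/ exists a b, [/\ a != b, a \in L, b \in L, strong m P x a & strong m P x b],
        exists a b d, [/\ uniq [:: a; b; d], [/\ a \in L, b \in L & d \in L],
          strong m P x a, edge x b & edge x d]
      | exists a b d e, [/\ uniq [:: a; b; d; e],
          [/\ a \in L, b \in L, d \in L & e \in L] &
          [/\ edge x a, edge x b, edge x d & edge x e]]].
Proof.
case: l => [|y l] // lP /fintype.subsetP PL [/= /andP[xy _] _ _].
have yP : y \in P by apply: lP; rewrite !inE eqxx orbT.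
have sxy : strong m P x y by rewrite /strong xy yP.
case=> [[q [qL qy xq]]|[a [b [u aL bL xa xb]]]].
  by apply: Or31; exists q, y; split=> //; [exact: PL | rewrite /strong xq orbT heavy_edge].
apply: Or32; exists y, a, b; split=> //; last by split=> //; apply: PL.
by move: u; rewrite /= !inE !negb_or (eq_sym y a) (eq_sym y b) => /and3P[/andP[-> ->] -> _].
Qed.

(** The vertices of the path are the inner ones: an interior vertex receives 2 + 2 from its path
    neighbours, an end receives 2 from its successor and 2 from the remaining edges of its end. *)
Lemma bridge_contra l : chain L l -> affine_end l -> affine_end (rev l) -> False.
Proof.
case: l => [|x l] // cl el erl; have crl := chain_rev cl.
have [_ _ lL] := cl.
apply: (@nbh_contra _ _ cP _ _ mP _ hL [set z in x :: l]%SET _ x).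
- by apply/fintype.subsetP => z; rewrite finset.in_set => /lL.
- by rewrite !inE eqxx.
have sP : [set z in x :: l]%SET \subset L by apply/fintype.subsetP => z; rewrite finset.in_set => /lL.
move=> y; rewrite finset.in_set => yl.
have [->|yx] := eqVneq y x; first by apply: endok_score cl el => // z zl; rewrite finset.in_set.
have [->|ylast] := eqVneq y (last x l).
  case/lastP: l => [|l z] in cl el erl crl lL sP yl yx *; first by case: el.
  rewrite last_rcons; rewrite -rcons_cons rev_rcons in erl crl.
  apply: endok_score crl erl => // t; rewrite finset.in_set in_cons mem_rev -rcons_cons mem_rcons.
  by rewrite [t \in z :: _]in_cons.
move: yl; rewrite inE (negbTE yx) /= => yl.
have [a [b [al bl ab ya yb]]] := chain_interior cl yl ylast.
apply: Or31; exists a, b; split=> //; first exact: lL.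
- by apply: lL; rewrite inE bl orbT.
- by rewrite /strong ya finset.in_set al.
- by rewrite /strong yb finset.in_set in_cons bl orbT.
Qed.

Lemma two_branch_contra b b' : b != b' -> branch L b -> branch L b' ->
  connect (full_subdiagram_edge m L) b b' -> False.
Proof.
move=> neq hb hb' /(chain_of_connect neq)[l cl el]; apply: (bridge_contra cl).
  case: l el {cl} => [/= e|y l _]; first by rewrite e eqxx in neq.
  exact: branch_affine_end.
case/lastP: l el {cl} => [/= e|l z]; first by rewrite e eqxx in neq.
rewrite last_rcons => ->; rewrite -rcons_cons rev_rcons.
by case/lastP: l => [|l t]; rewrite -?rcons_cons ?rev_rcons; apply: branch_affine_end.
Qed.

(** A path leaving [p] through [q] uses up the heavy edge; started at [q] instead, it has [p] as a
    heavy neighbour behind its first vertex. *)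
Lemma trim_heavy (p q : I) l : heavy p q -> p \in L -> q \in L -> chain L (p :: l) ->
  last p l != p -> last p l != q ->
  exists x t, [/\ chain L (x :: t), affine_end (x :: t), last x t = last p l,
    x :: t = p :: l \/ x :: t = l & x = p \/ x = q].
Proof.
move=> hpq pL qL cl; case: l => [|y l] in cl *; first by rewrite eqxx.
move=> lp lq; have [eyq|yq] := eqVneq y q; last first.
  by exists p, (y :: l); split=> //; [left; exists q; rewrite eq_sym | left | left].
exists y, l; split=> //; [exact: chain_behead cl | | by right | by right].
case: l => [|z l] in cl lp lq *; first by rewrite /= eyq eqxx in lq.
left; exists p; split=> //; last by rewrite (heavyC mP) eyq.
by case: cl => _ /=; rewrite !inE !negb_or => /andP[/and3P[_ pz _] _].
Qed.

Lemma heavy_branch_contra (p q : I) b : heavy p q -> p \in L -> q \in L -> branch L b -> b \in L ->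
  connect (full_subdiagram_edge m L) p b -> False.
Proof.
move=> hpq pL qL hb bL; have hb' := hb.
have aux x y : heavy x y -> y \in L -> x = b -> False.
  move=> hxy yL exb; case: hb' => a [d [e [u [aL dL eL] [ba bd be]]]]; subst x.
  move: u; rewrite /= !inE !negb_or => /and3P[/andP[ad ae] de _].
  have [eya|ya] := eqVneq y a.
    by apply: (heavy_fork_contra bL _ _ hxy bd be); rewrite //= !inE !negb_or eya ad ae de.
  have [eyd|yd] := eqVneq y d.
    by apply: (heavy_fork_contra bL _ _ hxy ba be); rewrite //= !inE !negb_or eyd eq_sym ad ae de.
  by apply: (heavy_fork_contra bL _ _ hxy ba bd); rewrite //= !inE !negb_or ya yd ad.
have [epb|pb] := eqVneq p b; first by case: (aux p q).
have [eqb|qb] := eqVneq q b; first by case: (aux q p) => //; rewrite (heavyC mP).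
move=> /(chain_of_connect pb)[l cl el].
have [||x [t [ct et lt _ _]]] := trim_heavy hpq pL qL cl; rewrite ?el; try by rewrite eq_sym.
apply: (bridge_contra ct et).
case/lastP: t => [|t z] in ct et lt *; first by case: et.
move: lt; rewrite last_rcons el => ->; rewrite -rcons_cons rev_rcons.
by case/lastP: t {ct et} => [|t u]; rewrite -?rcons_cons ?rev_rcons; apply: branch_affine_end.
Qed.

Lemma two_heavy_contra (p q p' q' : I) : heavy p q -> heavy p' q' ->
  [/\ p \in L, q \in L, p' \in L & q' \in L] ->
  ~~ ((p' == p) && (q' == q)) -> ~~ ((p' == q) && (q' == p)) ->
  connect (full_subdiagram_edge m L) p p' -> False.
Proof.
move=> h h' [pL qL p'L q'L] n1 n2.
have hC := heavyC mP.
have [e|pp'] := eqVneq p' p.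
  by move: n1; rewrite e eqxx /= => n1; case: (@heavy2_contra p q q'); rewrite // ?(eq_sym q) // -e.
have [e|qp'] := eqVneq p' q.
  move: n2; rewrite e eqxx /= => n2; case: (@heavy2_contra q p q'); rewrite // ?(eq_sym p) //.
  by rewrite hC. by rewrite -e.
have [e|pq'] := eqVneq q' p.
  by case: (@heavy2_contra p q p'); rewrite // ?(eq_sym q) // hC -e.
have [e|qq'] := eqVneq q' q.
  by case: (@heavy2_contra q p p'); rewrite // ?(eq_sym p) // hC // -e.
rewrite eq_sym in pp' => /(chain_of_connect pp')[l cl el].
have [||x [t [ct et lt _ hx]]] := trim_heavy h pL qL cl; rewrite ?el //; first by rewrite eq_sym.
case/lastP: t => [|t z] in ct et lt *; first by case: et.
rewrite last_rcons el in lt; subst z.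
have crt := chain_rev ct; rewrite -rcons_cons rev_rcons in crt.
have lrt : last p' (rev (x :: t)) = x by rewrite rev_cons last_rcons.
have xp' : x != p' by case: hx => ->; rewrite // eq_sym.
have xq' : x != q' by case: hx => ->; rewrite // eq_sym.
have [||y [r [cr er _ hr _]]] := trim_heavy h' p'L q'L crt; rewrite ?lrt //.
apply: (bridge_contra cr er).
case: hr => hr; rewrite hr.
  by rewrite -rev_rcons revK rcons_cons.
rewrite revK; apply: (@endok_rcons _ p'); last by rewrite rcons_cons.
by move: er; rewrite -(size_rev (x :: t)) -hr; case: (r).
Qed.

(** The path joining the two neighbours closes to a cycle through [x], of type affine A, in which
    every vertex has two inner neighbours. *)
Lemma cycle_contra x a a' : x \in L -> a != a' -> edge x a -> edge x a' ->
  connect (full_subdiagram_edge m (L :\ x)%SET) a a' -> False.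
Proof.
move=> xL neq xa xa' /(chain_of_connect neq)[l [sl ul lL] el].
have lL' z : z \in a :: l -> z \in L by move/lL; rewrite !inE => /andP[].
have xl : x \notin a :: l by apply/negP => /lL; rewrite !inE eqxx.
have cl : chain L (x :: a :: l).
  split; [by rewrite /= xa | by rewrite cons_uniq xl | ].
  by move=> z; rewrite inE => /orP[/eqP->|/lL'].
have ll : a' \in l.
  by case: l el {sl ul lL lL' xl cl} => [/= e|b l /= <-]; [rewrite e eqxx in neq | apply: mem_last].
apply: (@nbh_contra _ _ cP _ _ mP _ hL [set z in x :: a :: l]%SET _ x).
- by apply/fintype.subsetP => z; rewrite finset.in_set; case: cl => _ _; apply.
- by rewrite !inE eqxx.
move=> y; rewrite inE => yl; apply: Or31.
have yL : forall z, z \in x :: a :: l -> z \in L by case: cl.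
have st y1 z : edge y1 z -> z \in x :: a :: l -> strong m [set z in x :: a :: l]%SET y1 z.
  by move=> e1 zl; rewrite /strong e1 finset.in_set zl.
have al : a \in x :: a :: l by rewrite !inE eqxx orbT.
have a'l : a' \in x :: a :: l by rewrite !inE ll !orbT.
have xxl : x \in x :: a :: l by rewrite !inE eqxx.
have [->|yx] := eqVneq y x; first by exists a, a'; split; rewrite ?yL // st.
have yl' : y \in a :: l by move: yl; rewrite inE (negbTE yx).
have [ya'|ya'] := eqVneq y a'; last first.
  have [|b [d [bl dl bd yb yd]]] := @chain_interior L x (a :: l) y cl yl'; first by rewrite /= el.
  by exists b, d; split; rewrite ?yL ?st // inE dl orbT.
have [b bl yb] : exists2 b, b \in a :: l & edge y b.
  have crl : chain L (rev (a :: l)) by apply: chain_rev; apply: chain_behead cl.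
  rewrite ya'; case/lastP: l {ul lL sl cl ll a'l al xxl yl yl' st yL} => [|l z] in el lL' xl crl *.
    by rewrite /= in el; rewrite el eqxx in neq.
  rewrite last_rcons in el; subst z; rewrite -rcons_cons rev_rcons in crl.
  case/lastP: l => [|l z] in lL' xl crl *.
    by exists a; [rewrite inE eqxx | case: crl => /= /andP[]].
  exists z; first by rewrite !(inE, mem_rcons) eqxx !orbT.
  by move: crl; rewrite -rcons_cons rev_rcons => -[/= /andP[]].
have bl' : b \in x :: a :: l by rewrite inE bl orbT.
exists x, b; split; rewrite ?yL ?st //; last by rewrite ya' (edgeC mP).
by apply: contraNneq xl => ->.
Qed.

End Fixed.
End Chains.

(** * Explicit forbidden diagrams *)

Section ForbiddenLists.
Variables (R : rcfType) (c : nat -> R) (cP : dcos_family c).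
Variables (I : finType) (m : I -> I -> nat).
Hypothesis mP : coxeter_matrix m.
Variables (L : {set I}) (hL : posdef c m L).
Implicit Types (x y z a b d e : I) (J K P : {set I}) (p q r l xs : seq I).
Local Notation edge := (edge m).
Local Notation heavy := (heavy m).
Local Notation wt := (wt c m).

Lemma list_contra (z0 : I) xs (cs : seq R) : uniq xs -> {subset xs <= L} ->
  (0 < size xs)%N -> size cs = size xs -> all (fun t => 0 < t) cs ->
  (forall k : nat, (k < size xs)%N ->
    2 * nth 0 cs k <= \sum_(j <- iota 0 (size xs) | j != k)
                        wt (nth z0 xs k) (nth z0 xs j) * nth 0 cs j) -> False.
Proof.
move=> u xL xs0 sc c0 hk.
pose f x := nth 0 cs (index x xs).
have fpos x : x \in xs -> 0 < f x.
  by move=> xx; apply: (allP c0); rewrite mem_nth // sc index_mem.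
have f0 x : x \notin xs -> f x = 0.
  by move=> xx; rewrite /f nth_default // sc leqNgt index_mem.
have fn (j : nat) : (j < size xs)%N -> f (nth z0 xs j) = nth 0 cs j.
  by move=> lj; rewrite /f index_uniq.
have := @posdef_contra _ _ cP _ _ mP _ hL f _ _ _ (nth z0 xs 0).
have h0 := fpos _ (mem_nth z0 xs0); move=> h.
suff e : f (nth z0 xs 0) = 0 by rewrite e ltxx in h0.
apply: h => [x|x xnL|x xiL fx].
- by have [/fpos/ltW|/f0 ->] := boolP (x \in xs).
- by apply: f0; apply: contra xnL => /xL.
have xx : x \in xs by apply: contraNT fx => /f0 ->.
pose k := index x xs; have lk : (k < size xs)%N by rewrite index_mem.
have ex : x = nth z0 xs k by rewrite nth_index.
exists [seq nth z0 xs j | j <- iota 0 (size xs) & j != k]; split.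
- rewrite map_inj_in_uniq ?filter_uniq ?iota_uniq // => i j.
  rewrite !mem_filter !mem_iota !add0n /= => /andP[_ li] /andP[_ lj] /eqP.
  by rewrite nth_uniq // => /eqP.
- apply/mapP => -[j]; rewrite mem_filter mem_iota add0n /= => /andP[jk lj].
  by rewrite {1}ex => /eqP; rewrite nth_uniq // eq_sym (negbTE jk).
rewrite big_map big_filter ex fn //.
apply: le_trans (hk k lk) _; rewrite big_seq_cond [leRHS]big_seq_cond le_eqVlt.
apply/orP; left; apply/eqP; apply: eq_bigr => j /andP[]; rewrite mem_iota add0n => /= lj _.
by rewrite fn.
Qed.

(* [E] lists edges between positions of [xs]; [cs] are the (integer) coefficients
   of an isotropic vector of an affine diagram. *)
Definition affine_check n (cs : seq nat) (E : seq (nat * nat)) :=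
  all (fun k => 2 * nth 0 cs k <=
    sumn [seq if ((k, j) \in E) || ((j, k) \in E) then nth 0 cs j else 0 | j <- iota 0 n])%N (iota 0 n).

Lemma affine_contra (z0 : I) xs (cs : seq nat) (E : seq (nat * nat)) : uniq xs -> {subset xs <= L} ->
  (0 < size xs)%N -> size cs = size xs -> all (fun t => 0 < t)%N cs ->
  all (fun ab => edge (nth z0 xs ab.1) (nth z0 xs ab.2)) E ->
  affine_check (size xs) cs E -> False.
Proof.
move=> u xL xs0 sc c0 hE hc.
apply: (@list_contra z0 xs [seq t%:R | t <- cs]) => //.
- by rewrite size_map.
- by rewrite all_map; apply: sub_all c0 => t /=; rewrite ltr0n.
move=> k lk.
have ncs j : nth 0 [seq t%:R | t <- cs] j = (nth 0%N cs j)%:R :> R.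
  have [lj|lj] := ltnP j (size cs); first by rewrite (nth_map 0%N).
  by rewrite !nth_default ?size_map.
rewrite ncs -natrM; have := allP hc k; rewrite mem_iota add0n => /(_ lk).
rewrite -(ler_nat R) => /le_trans; apply.
rewrite sumnE big_map natr_sum (bigID (fun j => j != k)) /=.
rewrite [X in _ + X]big1 ?addr0 => [|j /negPn/eqP ->]; last first.
  case: ifP => // /orP h; have : (k, k) \in E by case: h.
  by move/(allP hE)/(edge_neq) => /=; rewrite eqxx.
rewrite big_seq_cond [leRHS]big_seq_cond; apply: ler_sum => j /andP[].
rewrite mem_iota add0n /= => lj jk; rewrite ncs.
have neq : nth z0 xs k != nth z0 xs j by rewrite nth_uniq // eq_sym.
case: ifP => [h|_]; last by rewrite mulr_ge0 ?ler0n // (wt_ge0 cP mP).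
rewrite -[X in X <= _]mul1r ler_wpM2r ?ler0n // (wt_ge1 cP mP) //.
by case/orP: h => /(allP hE) //=; rewrite (edgeC mP).
Qed.

Lemma forbidden_inf x y : x \in L -> y \in L -> x != y -> m x y = 0%N -> False.
Proof.
move=> xL yL xy m0; have [c0 _ _] := cP.
apply: (@list_contra x [:: x; y] [:: 1; 1]) => //=.
- by rewrite inE xy.
- by move=> z; rewrite !inE => /orP[]/eqP ->.
- by rewrite !ltr01.
by case=> [|[|k]] //= _; rewrite !big_cons big_nil /= /wt ?(cox_matrixC mP y) m0 c0; lra.
Qed.

(** The marks of affine F4 are 1, 2, 3, 4, 2; the last two are divided by sqrt 2 because all roots
    have the same norm here. *)
Lemma forbidden_F4 x0 x1 x2 x3 x4 : uniq [:: x0; x1; x2; x3; x4] ->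
  {subset [:: x0; x1; x2; x3; x4] <= L} ->
  edge x0 x1 -> edge x1 x2 -> heavy x2 x3 -> edge x3 x4 -> False.
Proof.
move=> u xL /(wt_ge1 cP mP) h1 /(wt_ge1 cP mP) h2 /(wt_heavy cP mP) h3 /(wt_ge1 cP mP) h4.
have r2 := sqrt2_sq R; have r1 := sqrt2_ge1 R.
apply: (@list_contra x0 _ [:: 1; 2; 3; 2 * Num.sqrt 2; Num.sqrt 2] u xL) => //=.
  by rewrite andbT; apply/and5P; split; nra.
have wC i j : wt i j = wt j i by rewrite /wt (cox_matrixC mP).
have wpos i j : i != j -> 0 <= wt i j := @wt_ge0 _ _ cP _ _ mP i j.
move: u; rewrite /= !inE !negb_or => /and5P[/and4P[u01 u02 u03 u04] /and3P[u12 u13 u14] /andP[u23 u24] u34 _].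
move: (wpos _ _ u02) (wpos _ _ u03) (wpos _ _ u04) (wpos _ _ u13) (wpos _ _ u14) (wpos _ _ u24).
move=> w02 w03 w04 w13 w14 w24.
case=> [|[|[|[|[|k]]]]] //= _; rewrite !big_cons big_nil /=.
- by nra.
- by rewrite (wC x1 x0); nra.
- by rewrite (wC x2 x0) (wC x2 x1); nra.
- by rewrite (wC x3 x0) (wC x3 x1) (wC x3 x2); nra.
- by rewrite (wC x4 x0) (wC x4 x1) (wC x4 x2) (wC x4 x3); nra.
Qed.

Lemma wt_golden i j : edge i j -> m i j != 3%N -> m i j != 4%N -> wt i j + 1 <= wt i j ^+ 2.
Proof.
have [c0 _ hc] := cP; rewrite /wt => eij m3 m4.
have [->|m5] : m i j = 0%N \/ (4 < m i j)%N; first by case: (edge_label mP eij); [left | right; lia].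
  by rewrite c0 expr2; lra.
by apply: dcos_golden_ge (hc _ _) _; lia.
Qed.

Lemma wt_ge_sqrt3 i j : edge i j -> m i j != 3%N -> m i j != 4%N -> m i j != 5%N -> 3 <= wt i j ^+ 2.
Proof.
have [c0 _ hc] := cP; rewrite /wt => eij m3 m4 m5.
have [->|m6] : m i j = 0%N \/ (5 < m i j)%N; first by case: (edge_label mP eij); [left | right; lia].
  by rewrite c0 expr2; lra.
by apply: dcos_sqr_ge3 (hc _ _) _; lia.
Qed.

(** The marks of affine G2 are 1, 2, 3, the last divided by sqrt 3. *)
Lemma forbidden_G2 x0 x1 x2 : uniq [:: x0; x1; x2] -> {subset [:: x0; x1; x2] <= L} ->
  edge x0 x1 -> edge x1 x2 -> m x1 x2 != 3%N -> m x1 x2 != 4%N -> m x1 x2 != 5%N -> False.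
Proof.
move=> u xL h1 h2 m3 m4 m5; have := wt_ge_sqrt3 h2 m3 m4 m5.
move: h1 h2 => /(wt_ge1 cP mP) h1 /(wt_ge1 cP mP) h2; rewrite expr2 => h3.
pose t := Num.sqrt 3 : R; have t2 : t * t = 3 by rewrite -expr2 sqr_sqrtr // ler0n.
have t1 : 1 <= t by rewrite -{1}sqrtr1 ler_wsqrtr // ler1n.
have wt3 : t <= wt x1 x2 by clearbody t; nra.
apply: (@list_contra x0 _ [:: 1; 2; t] u xL) => //=.
  by rewrite andbT; apply/and3P; split; clearbody t; nra.
have wC i j : wt i j = wt j i by rewrite /wt (cox_matrixC mP).
have wpos i j : i != j -> 0 <= wt i j := @wt_ge0 _ _ cP _ _ mP i j.
move: u; rewrite /= !inE !negb_or => /and3P[/andP[u01 u02] u12 _].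
move: (wpos _ _ u02) => w02; clearbody t.
case=> [|[|[|k]]] //= _; rewrite !big_cons big_nil /=.
- by nra.
- by rewrite (wC x1 x0); nra.
- by rewrite (wC x2 x0) (wC x2 x1); nra.
Qed.

(** The diagram 3, 5, 3 is hyperbolic, so there is room for a vector with slack: 1, 2, 2, 1 only
    asks that the middle weight be at least 3/2, which is below the golden ratio. *)
Lemma forbidden_353 x0 x1 x2 x3 : uniq [:: x0; x1; x2; x3] -> {subset [:: x0; x1; x2; x3] <= L} ->
  edge x0 x1 -> edge x1 x2 -> edge x2 x3 -> m x1 x2 != 3%N -> m x1 x2 != 4%N -> False.
Proof.
move=> u xL h1 h2 h3 m3 m4; have := wt_golden h2 m3 m4.
move: h1 h2 h3 => /(wt_ge1 cP mP) h1 /(wt_ge1 cP mP) h2 /(wt_ge1 cP mP) h3; rewrite expr2 => h4.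
have w12 : 3 / 2 <= wt x1 x2 by nra.
apply: (@list_contra x0 _ [:: 1; 2; 2; 1] u xL) => //=.
  by rewrite andbT; apply/and4P; split; lra.
have wC i j : wt i j = wt j i by rewrite /wt (cox_matrixC mP).
have wpos i j : i != j -> 0 <= wt i j := @wt_ge0 _ _ cP _ _ mP i j.
move: u; rewrite /= !inE !negb_or => /and4P[/and3P[u01 u02 u03] /andP[u12 u13] u23 _].
move: (wpos _ _ u02) (wpos _ _ u03) (wpos _ _ u13) => w02 w03 w13.
case=> [|[|[|[|k]]]] //= _; rewrite !big_cons big_nil /=.
- by nra.
- by rewrite (wC x1 x0); nra.
- by rewrite (wC x2 x0) (wC x2 x1); nra.
- by rewrite (wC x3 x0) (wC x3 x1) (wC x3 x2); nra.
Qed.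

(** Also hyperbolic. The values 4, 3, 2, 1 balance the simple chain; with 31/10 at the other end,
    the two remaining inequalities hold once the first weight is at least 50/31, hence for
    1613/1000, just below the golden ratio. *)
Lemma forbidden_5333 x0 x1 x2 x3 x4 : uniq [:: x0; x1; x2; x3; x4] ->
  {subset [:: x0; x1; x2; x3; x4] <= L} ->
  edge x0 x1 -> edge x1 x2 -> edge x2 x3 -> edge x3 x4 ->
  m x0 x1 != 3%N -> m x0 x1 != 4%N -> False.
Proof.
move=> u xL h1 h2 h3 h4 m3 m4; have := wt_golden h1 m3 m4.
move: h1 h2 h3 h4 => /(wt_ge1 cP mP) h1 /(wt_ge1 cP mP) h2 /(wt_ge1 cP mP) h3 /(wt_ge1 cP mP) h4.
rewrite expr2 => h5; have w01 : 1613 / 1000 <= wt x0 x1 by nra.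
apply: (@list_contra x0 _ [:: 31 / 10; 4; 3; 2; 1] u xL) => //=.
  by rewrite andbT; apply/and5P; split; lra.
have wC i j : wt i j = wt j i by rewrite /wt (cox_matrixC mP).
have wpos i j : i != j -> 0 <= wt i j := @wt_ge0 _ _ cP _ _ mP i j.
move: u; rewrite /= !inE !negb_or => /and5P[/and4P[u01 u02 u03 u04] /and3P[u12 u13 u14] /andP[u23 u24] u34 _].
move: (wpos _ _ u02) (wpos _ _ u03) (wpos _ _ u04) (wpos _ _ u13) (wpos _ _ u14) (wpos _ _ u24).
move=> w02 w03 w04 w13 w14 w24.
case=> [|[|[|[|[|k]]]]] //= _; rewrite !big_cons big_nil /=.
- by nra.
- by rewrite (wC x1 x0); nra.
- by rewrite (wC x2 x0) (wC x2 x1); nra.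
- by rewrite (wC x3 x0) (wC x3 x1) (wC x3 x2); nra.
- by rewrite (wC x4 x0) (wC x4 x1) (wC x4 x2) (wC x4 x3); nra.
Qed.

End ForbiddenLists.

(** * Listed diagrams *)

Section Labels.

Definition path_label (labels : seq nat) (x y : nat) : nat :=
  if y == x.+1 then nth 2%N labels x else 2%N.
(** The heavy edge is at the far end, as is the fork of [D_label], so that both series grow by
    adding a vertex at position 0. *)
Definition B_label (n x y : nat) : nat :=
  if y == x.+1 then (if y == n.-1 then 4 else 3)%N else 2%N.
Definition branch_label (n b x y : nat) : nat :=
  if y == n.-1 then (if x == b then 3 else 2)%N else (if y == x.+1 then 3 else 2)%N.
Definition D_label (n : nat) := branch_label n (n - 3).
(* A new vertex, numbered [0], joined by a simple edge to the former vertex [x]. *)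
Definition ext_label (x : nat) (e : nat -> nat -> nat) (i j : nat) : nat :=
  if i is i'.+1 then e i' j.-1 else (if j.-1 == x then 3 else 2)%N.
Definition sym_label (e : nat -> nat -> nat) (i j : nat) : nat := e (minn i j) (maxn i j).

Variables (I : finType) (m : I -> I -> nat).
Hypothesis mP : coxeter_matrix m.
Variable z0 : I.
Implicit Types (p q : seq I) (e : nat -> nat -> nat).
Local Notation edge := (edge m).

Definition realizes e p := uniq p /\
  forall x y, (x < y)%N -> (y < size p)%N -> m (nth z0 p x) (nth z0 p y) = e x y.

(** G2 is [ListedI] with [k] = 3. *)
Variant listed_seq p : Prop :=
| ListedA1 of size p = 1%N
| ListedB of (2 <= size p)%N & realizes (B_label (size p)) p
| ListedD of (4 <= size p)%N & ~~ odd (size p) & realizes (D_label (size p)) p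
| ListedE7 of size p = 7%N & realizes (branch_label 7 2) p
| ListedE8 of size p = 8%N & realizes (branch_label 8 2) p
| ListedF4 of size p = 4%N & realizes (path_label [:: 3; 4; 3]%N) p
| ListedI k of size p = 2%N & (2 <= k)%N & realizes (path_label [:: (2 * k)%N]) p
| ListedH3 of size p = 3%N & realizes (path_label [:: 3; 5]%N) p
| ListedH4 of size p = 4%N & realizes (path_label [:: 3; 3; 5]%N) p.

Lemma realizes_matrix e p : realizes e p -> forall x y, (x < size p)%N -> (y < size p)%N ->
  m (nth z0 p x) (nth z0 p y) = matrix_of_labels e x y.
Proof.
move=> [u h] x y lx ly; rewrite /matrix_of_labels; have [->|neq] := eqVneq x y.
  exact: cox_matrix_diag mP _.
have [lt|lt|e1] := ltngtP x y; last by rewrite e1 eqxx in neq.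
  by rewrite h.
by rewrite (cox_matrixC mP) h.
Qed.

Lemma eq_realizes e e' p : (forall x y, (x < y)%N -> (y < size p)%N -> e x y = e' x y) ->
  realizes e p -> realizes e' p.
Proof. by move=> ee [u h]; split=> // x y lxy ly; rewrite h // ee. Qed.

Lemma B_labelE n x y : (x < y)%N -> (y < n)%N ->
  path_label (rcons (nseq (n - 2) 3) 4)%N x y = B_label n x y.
Proof.
rewrite /path_label /B_label => lxy ly; case: eqP => // e.
rewrite nth_rcons size_nseq nth_nseq.
case: ltnP => h; first by rewrite ifF //; apply/eqP; lia.
have -> : x == (n - 2)%N by apply/eqP; lia.
by have -> : y == n.-1 by apply/eqP; lia.
Qed.

Lemma listed_type_seq n M p : listed_type n M -> size p = n -> uniq p ->
  (forall x y, (x < size p)%N -> (y < size p)%N -> m (nth z0 p x) (nth z0 p y) = M x y) ->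
  listed_seq p.
Proof.
move=> hM sp u hp.
have real e : M = matrix_of_labels e -> realizes e p.
  move=> eM; split=> // x y lxy ly; rewrite hp ?eM //; last exact: ltn_trans lxy ly.
  by rewrite /matrix_of_labels ltn_eqF // (minn_idPl (ltnW lxy)) (maxn_idPr (ltnW lxy)).
case: hM sp real => [|k k2|k k2|||||||k k2] sp real.
- exact: ListedA1.
- apply: ListedB; rewrite sp //; apply: eq_realizes (real _ erefl) => x y lxy ly.
  by apply: B_labelE => //; rewrite -sp.
- have e3 : (2 * k - 3 = size p - 3)%N by rewrite sp.
  apply: ListedD; rewrite sp ?oddM //; first lia.
  exact: (real _ erefl).
- by apply: ListedE7 => //; apply: real.
- by apply: ListedE8 => //; apply: real.
- by apply: ListedF4 => //; apply: real.
- by apply: (@ListedI _ 3) => //; apply: real.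
- by apply: ListedH3 => //; apply: real.
- by apply: ListedH4 => //; apply: real.
- by apply: (@ListedI _ k) => //; apply: real.
Qed.

Lemma seq_listed_type p : listed_seq p -> uniq p ->
  exists2 M, listed_type (size p) M &
  forall x y, (x < size p)%N -> (y < size p)%N -> m (nth z0 p x) (nth z0 p y) = M x y.
Proof.
case=> [sp|sp r|sp o r|sp r|sp r|sp r|k sp k2 r|sp r|sp r] u.
- exists (path_diagram [::]); first by rewrite sp; exact: TypeA1.
  by move=> x y; rewrite sp => /ltnSE; rewrite leqn0 => /eqP -> /ltnSE; rewrite leqn0 => /eqP ->; apply: cox_matrix_diag mP _.
- exists (path_diagram (rcons (nseq (size p - 2) 3) 4)%N); first exact: TypeB.
  apply: realizes_matrix; apply: eq_realizes r => x y lxy ly.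
  by rewrite -B_labelE.
- have [k ek] : exists k, size p = (2 * k)%N by exists (size p)./2; lia.
  exists (branched_diagram (2 * k) (2 * k - 3)).
    by rewrite ek; apply: TypeDeven; lia.
  by rewrite ek in r; apply: realizes_matrix r.
- by exists (branched_diagram 7 2); [rewrite sp; exact: TypeE7 | exact: realizes_matrix r].
- by exists (branched_diagram 8 2); [rewrite sp; exact: TypeE8 | exact: realizes_matrix r].
- by exists (path_diagram [:: 3; 4; 3]%N); [rewrite sp; exact: TypeF4 | exact: realizes_matrix r].
- by exists (path_diagram [:: (2 * k)%N]); [rewrite sp; exact: TypeI2even | exact: realizes_matrix r].
- by exists (path_diagram [:: 3; 5]%N); [rewrite sp; exact: TypeH3 | exact: realizes_matrix r].
- by exists (path_diagram [:: 3; 3; 5]%N); [rewrite sp; exact: TypeH4 | exact: realizes_matrix r].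
Qed.

Lemma has_listed_typeP (C : {set I}) : has_listed_type m C <->
  exists p, [/\ uniq p, listed_seq p & C = [set x in p]%SET].
Proof.
split=> [[n [M [f [hM injf -> hf]]]]|[p [u lp ->]]].
  pose p := [seq f x | x <- enum 'I_n].
  have sp : size p = n by rewrite size_map size_enum_ord.
  have up : uniq p by rewrite map_inj_uniq ?enum_uniq.
  have hn x (lx : (x < n)%N) : nth z0 p x = f (Ordinal lx).
    rewrite (nth_map (Ordinal lx)) ?size_enum_ord //; congr f.
    by apply: val_inj; rewrite /= nth_enum_ord.
  exists p; split=> //.
    apply: (listed_type_seq hM) => // x y; rewrite sp => lx ly.
    by rewrite !hn hf.
  apply/setP => x; rewrite finset.in_set; apply/imsetP/mapP => -[y _ ->]; exists y => //.
  by rewrite mem_enum.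
have [M hM hp] := seq_listed_type lp u.
exists (size p), M, (fun i : 'I_(size p) => nth z0 p i); split=> //.
- by move=> i j /eqP; rewrite nth_uniq // => /eqP/val_inj.
- apply/setP => x; rewrite finset.in_set; apply/idP/imsetP => [xp|[i _ ->]]; last exact: mem_nth.
  have lx : (index x p < size p)%N by rewrite index_mem.
  by exists (Ordinal lx) => //=; rewrite nth_index.
by move=> x y; apply: hp.
Qed.

Lemma realizes_sym e p x y : realizes e p -> x != y -> (x < size p)%N -> (y < size p)%N ->
  m (nth z0 p x) (nth z0 p y) = sym_label e x y.
Proof.
move=> r neq lx ly; rewrite (realizes_matrix r) //.
by rewrite /matrix_of_labels (negbTE neq).
Qed.

Lemma realizes_edge e p x y : realizes e p -> x != y -> (x < size p)%N -> (y < size p)%N ->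
  edge (nth z0 p x) (nth z0 p y) = (sym_label e x y != 2%N).
Proof.
move=> r neq lx ly; rewrite /edge /diagram_edge (realizes_sym r) // nth_uniq ?neq //.
by case: r.
Qed.

Lemma realizes_ext e p s x : realizes e p -> s \notin p ->
  (forall j, (j < size p)%N -> m s (nth z0 p j) = if j == x then 3%N else 2%N) ->
  realizes (ext_label x e) (s :: p).
Proof.
move=> [u h] sp hs; split; first by rewrite /= sp.
case=> [|i] [|j] //= lij lj; first exact: hs.
exact: h.
Qed.

Definition reindex_check n e e' (idx : seq nat) :=
  [&& uniq idx, all (fun i => i < n)%N idx &
   all (fun x => all (fun y => (x < y)%N ==> (e' x y == sym_label e (nth 0%N idx x) (nth 0%N idx y)))
      (iota 0 (size idx))) (iota 0 (size idx))].

Lemma realizes_reindex e e' p idx : realizes e p -> reindex_check (size p) e e' idx ->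
  realizes e' [seq nth z0 p i | i <- idx].
Proof.
move=> r /and3P[ui /allP li hi]; have [u h] := r.
have inj : {in idx &, injective (nth z0 p)}.
  by move=> i j /li li' /li lj' /eqP; rewrite nth_uniq // => /eqP.
split; first by rewrite map_inj_in_uniq.
move=> x y lxy; rewrite size_map => ly; have lx := ltn_trans lxy ly.
rewrite !(nth_map 0%N) //.
have := allP hi x; rewrite mem_iota add0n => /(_ lx)/allP/(_ y).
rewrite mem_iota add0n => /(_ ly); rewrite lxy => /eqP ->.
apply: realizes_sym => //; last by apply: li; rewrite mem_nth.
  by rewrite nth_uniq // neq_ltn lxy.
by apply: li; rewrite mem_nth.
Qed.

Lemma reindex_mem p idx : perm_eq idx (iota 0 (size p)) -> [seq nth z0 p i | i <- idx] =i p.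
Proof.
move=> h x; rewrite (perm_mem (perm_map (nth z0 p) h)).
by rewrite map_nth_iota0 // take_size.
Qed.

Lemma realizes_drop e e' p k : (forall x y, (x < y)%N -> (y < size p - k)%N -> e (k + x)%N (k + y)%N = e' x y) ->
  realizes e p -> realizes e' (drop k p).
Proof.
move=> ee [u h]; split; first by rewrite drop_uniq.
move=> x y lxy; rewrite size_drop => ly; rewrite !nth_drop h ?ee //; lia.
Qed.

Lemma D_label_shift n k x y : (k + 3 <= n)%N -> (x < y)%N -> (y < n - k)%N ->
  D_label n (k + x)%N (k + y)%N = D_label (n - k) x y.
Proof.
rewrite /D_label /branch_label => h1 h2 h3.
have -> : ((k + y)%N == n.-1) = (y == (n - k).-1) by lia.
have -> : ((k + x)%N == (n - 3)%N) = (x == (n - k - 3)%N) by lia.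
by have -> : ((k + y)%N == (k + x).+1) = (y == x.+1) by lia.
Qed.

Lemma B_label_shift n k x y : (x < y)%N -> (y < n - k)%N ->
  B_label n (k + x)%N (k + y)%N = B_label (n - k) x y.
Proof.
rewrite /B_label => h2 h3.
have -> : ((k + y)%N == n.-1) = (y == (n - k).-1) by lia.
by have -> : ((k + y)%N == (k + x).+1) = (y == x.+1) by lia.
Qed.

Lemma realizes_Bcons p s : (2 <= size p)%N ->
  realizes (ext_label 0 (B_label (size p))) (s :: p) -> realizes (B_label (size p).+1) (s :: p).
Proof.
move=> h2; apply: eq_realizes => -[|x] [|y] //= lxy ly; rewrite /B_label /= eqSS.
  by case: y {lxy} ly => [|y] //= ly; rewrite ifF //; apply/eqP; lia.
by have -> : (y == (size p).-1) = (y.+1 == size p) by lia.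
Qed.

Lemma realizes_Dcons p s : (3 <= size p)%N ->
  realizes (ext_label 0 (D_label (size p))) (s :: p) -> realizes (D_label (size p).+1) (s :: p).
Proof.
move=> h3; apply: eq_realizes => -[|x] [|y] //= lxy ly; rewrite /D_label /branch_label /=.
  rewrite eqSS; have -> : (0%N == ((size p).+1 - 3)%N) = false by lia.
  by case: y {lxy} ly => [|y] //= ly; rewrite ?if_same // ifF //; lia.
have -> : (y.+1 == size p) = (y == (size p).-1) by lia.
have -> : (x.+1 == ((size p).+1 - 3)%N) = (x == (size p - 3)%N) by lia.
by rewrite eqSS.
Qed.

End Labels.

(** * Forbidden subdiagrams by index, and leaves *)

Section Attach.
Variables (R : rcfType) (c : nat -> R) (cP : dcos_family c).
Variables (I : finType) (m : I -> I -> nat).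
Hypothesis mP : coxeter_matrix m.
Variables (L : {set I}) (hL : posdef c m L) (z0 : I).
Implicit Types (p q P : seq I) (e : nat -> nat -> nat).
Local Notation edge := (edge m).
Local Notation heavy := (heavy m).
Local Notation realizes := (realizes m z0).

Lemma nth_uniq_idx e P (idx : seq nat) : realizes e P -> {subset P <= L} ->
  uniq idx -> all (fun i => i < size P)%N idx ->
  uniq [seq nth z0 P i | i <- idx] /\ {subset [seq nth z0 P i | i <- idx] <= L}.
Proof.
move=> [u _] PL ui /allP li; split.
  by rewrite map_inj_in_uniq // => i j /li li' /li lj' /eqP; rewrite nth_uniq // => /eqP.
by move=> x /mapP[i /li li' ->]; apply: PL; apply: mem_nth.
Qed.

Definition edge_check n e x y :=
  [&& x != y, (x < n)%N, (y < n)%N & sym_label e x y != 2%N].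

Lemma edge_checkP e P x y : realizes e P -> edge_check (size P) e x y ->
  edge (nth z0 P x) (nth z0 P y).
Proof. by move=> r /and4P[neq lx ly h]; rewrite (realizes_edge mP r). Qed.

Lemma affine_idx e P (idx cs : seq nat) (E : seq (nat * nat)) : realizes e P -> {subset P <= L} ->
  [&& uniq idx, all (fun i => i < size P)%N idx, (0 < size idx)%N, size cs == size idx,
   all (fun t => 0 < t)%N cs, affine_check (size idx) cs E &
   all (fun ab => [&& (ab.1 < size idx)%N, (ab.2 < size idx)%N &
      edge_check (size P) e (nth 0%N idx ab.1) (nth 0%N idx ab.2)]) E] -> False.
Proof.
move=> r PL /and5P[ui li s0 /eqP sc /and3P[c0 hc /allP hE]].
have [u xL] := nth_uniq_idx r PL ui li.
apply: (@affine_contra _ _ cP _ _ mP _ hL z0 _ cs E u xL); rewrite ?size_map //.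
apply/allP => -[a b] /hE/and3P[/= la lb h].
by rewrite !(nth_map 0%N) //; apply: edge_checkP r h.
Qed.

Definition leaf_at p x := forall y1 y2, (y1 < size p)%N -> (y2 < size p)%N -> y1 != y2 ->
  edge (nth z0 p x) (nth z0 p y1) -> edge (nth z0 p x) (nth z0 p y2) -> False.

Lemma leaf_check e p x y1 y2 : realizes e p -> leaf_at p x ->
  [&& y1 != y2, edge_check (size p) e x y1 & edge_check (size p) e x y2] -> False.
Proof.
move=> r hl /and3P[neq h1 h2]; apply: (hl y1 y2) => //; last 2 first.
- exact: edge_checkP h1.
- exact: edge_checkP h2.
- by case/and4P: h1.
- by case/and4P: h2.
Qed.

Definition pendant s p x :=
  forall j, (j < size p)%N -> m s (nth z0 p j) = if j == x then 3%N else 2%N.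

Lemma F4_idx e P x0 x1 x2 x3 x4 : realizes e P -> {subset P <= L} ->
  [&& uniq [:: x0; x1; x2; x3; x4], all (fun i => i < size P)%N [:: x0; x1; x2; x3; x4],
   edge_check (size P) e x0 x1, edge_check (size P) e x1 x2, edge_check (size P) e x2 x3,
   sym_label e x2 x3 != 3%N & edge_check (size P) e x3 x4] -> False.
Proof.
move=> r PL /and3P[ui li /and5P[h1 h2 h3 h3' h4]].
have [u xL] := nth_uniq_idx r PL ui li; apply: (forbidden_F4 cP mP hL u xL).
- exact: edge_checkP h1.
- exact: edge_checkP h2.
- rewrite /heavy (edge_checkP r h3); have /and4P[neq l2 l3 _] := h3.
  by rewrite (realizes_sym mP r).
- exact: edge_checkP h4.
Qed.

Lemma G2_idx e P x0 x1 x2 : realizes e P -> {subset P <= L} ->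
  [&& uniq [:: x0; x1; x2], all (fun i => i < size P)%N [:: x0; x1; x2],
   edge_check (size P) e x0 x1, edge_check (size P) e x1 x2 &
   (5 < sym_label e x1 x2)%N] -> False.
Proof.
move=> r PL /and5P[ui li h1 h2 h3].
have [u xL] := nth_uniq_idx r PL ui li.
have /and4P[neq l2 l3 _] := h2.
apply: (forbidden_G2 cP mP hL u xL (edge_checkP r h1) (edge_checkP r h2));
  by rewrite (realizes_sym mP r) //; apply/eqP; lia.
Qed.

Lemma H353_idx e P x0 x1 x2 x3 : realizes e P -> {subset P <= L} ->
  [&& uniq [:: x0; x1; x2; x3], all (fun i => i < size P)%N [:: x0; x1; x2; x3],
   edge_check (size P) e x0 x1, edge_check (size P) e x1 x2, edge_check (size P) e x2 x3 &
   (4 < sym_label e x1 x2)%N] -> False.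
Proof.
move=> r PL /and3P[ui li /and4P[h1 h2 h3 h4]].
have [u xL] := nth_uniq_idx r PL ui li.
have /and4P[neq l2 l3 _] := h2.
apply: (forbidden_353 cP mP hL u xL (edge_checkP r h1) (edge_checkP r h2) (edge_checkP r h3));
  by rewrite (realizes_sym mP r) //; apply/eqP; lia.
Qed.

Lemma H5333_idx e P x0 x1 x2 x3 x4 : realizes e P -> {subset P <= L} ->
  [&& uniq [:: x0; x1; x2; x3; x4], all (fun i => i < size P)%N [:: x0; x1; x2; x3; x4],
   edge_check (size P) e x0 x1, edge_check (size P) e x1 x2, edge_check (size P) e x2 x3,
   edge_check (size P) e x3 x4 & (4 < sym_label e x0 x1)%N] -> False.
Proof.
move=> r PL /and3P[ui li /and5P[h1 h2 h3 h4 h5]].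
have [u xL] := nth_uniq_idx r PL ui li.
have /and4P[neq l2 l3 _] := h1.
apply: (forbidden_5333 cP mP hL u xL (edge_checkP r h1) (edge_checkP r h2) (edge_checkP r h3) (edge_checkP r h4));
  by rewrite (realizes_sym mP r) //; apply/eqP; lia.
Qed.

Lemma reindex_listed e e' P idx : realizes e P -> reindex_check (size P) e e' idx ->
  perm_eq idx (iota 0 (size P)) ->
  let q := [seq nth z0 P i | i <- idx] in [/\ realizes e' q, uniq q, size q = size P & q =i P].
Proof.
move=> r h pe; have r' := realizes_reindex mP r h; split=> //; first by case: r'.
  by rewrite size_map (perm_size pe) size_iota.
exact: reindex_mem.
Qed.

Lemma pendant_perm e' e p s x idx : pendant s p x -> (x < size p)%N ->
  reindex_check (size p) e e' idx -> perm_eq idx (iota 0 (size p)) ->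
  pendant s [seq nth z0 p i | i <- idx] (index x idx).
Proof.
move=> hs lx h pe j; rewrite size_map => lj.
have /and3P[ui /allP li _] := h.
rewrite (nth_map 0%N) // hs; last by apply: li; rewrite mem_nth.
have xi : x \in idx by rewrite (perm_mem pe) mem_iota add0n.
rewrite -{1}(nth_index 0%N xi) nth_uniq ?index_mem //.
Qed.

Lemma sym_label_lt e x y : (x < y)%N -> sym_label e x y = e x y.
Proof. by move=> lt; rewrite /sym_label (minn_idPl (ltnW lt)) (maxn_idPr (ltnW lt)). Qed.
Lemma sym_label_gt e x y : (y < x)%N -> sym_label e x y = e y x.
Proof. by move=> lt; rewrite /sym_label (minn_idPr (ltnW lt)) (maxn_idPl (ltnW lt)). Qed.

Lemma interior_not_leaf e p x : realizes e p -> (0 < x)%N -> (x.+1 < size p)%N ->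
  e x.-1 x != 2%N -> e x x.+1 != 2%N -> leaf_at p x -> False.
Proof.
move=> r x0 lx e1 e2 hl; apply: (leaf_check (y1 := x.-1) (y2 := x.+1) r hl).
have l1 : (x.-1 < x)%N by lia.
apply/and3P; split; first by lia.
  by apply/and4P; split; [lia | lia | lia | rewrite sym_label_gt].
by apply/and4P; split; [lia | lia | lia | rewrite sym_label_lt].
Qed.

Lemma B_leaf p x : (2 <= size p)%N -> realizes (B_label (size p)) p -> (x < size p)%N ->
  leaf_at p x -> x = 0%N \/ x = (size p).-1.
Proof.
move=> h2 r lx hl; have [->|x0] := posnP x; first by left.
right; apply/eqP/negPn/negP => /eqP xn; apply: (interior_not_leaf r x0 _ _ _ hl); first lia.
  by rewrite /B_label prednK // eqxx; case: ifP.
by rewrite /B_label eqxx; case: ifP.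
Qed.

Lemma D_leaf p x : (4 <= size p)%N -> realizes (D_label (size p)) p -> (x < size p)%N ->
  leaf_at p x -> [\/ x = 0%N, x = (size p - 2)%N | x = (size p).-1].
Proof.
move=> h4 r lx hl; have [->|x0] := posnP x; first exact: Or31.
have [->|x1] := eqVneq x (size p).-1; first exact: Or33.
apply: Or32; apply/eqP/negPn/negP => /eqP xn; apply: (interior_not_leaf r x0 _ _ _ hl); first lia.
  by rewrite /D_label /branch_label prednK // eqxx (negbTE x1).
by rewrite /D_label /branch_label eqxx ifN //; lia.
Qed.

End Attach.

(** * Attaching a vertex to a leaf of a listed diagram *)

Section AttachCases.
Variables (R : rcfType) (c : nat -> R) (cP : dcos_family c).
Variables (I : finType) (m : I -> I -> nat).
Hypothesis mP : coxeter_matrix m.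
Variables (L : {set I}) (hL : posdef c m L) (z0 : I).
Implicit Types (p q P : seq I) (e : nat -> nat -> nat).
Local Notation realizes := (realizes m z0).
Local Notation pendant := (pendant m z0).
Local Notation leaf_at := (leaf_at m z0).
Local Notation listed_seq := (listed_seq m z0).

(** The attachments that survive the tests. With [s] added they give, in order, B_(n+1), D_(n+1)
    with n even, F4, E7, E8 and H4; only the second is not listed. *)
Variant attach_view s p : Prop :=
| AttachB q of q =i p & (2 <= size q)%N & realizes (B_label (size q)) q & pendant s q 0%N
| AttachD q of q =i p & (4 <= size q)%N & ~~ odd (size q) & realizes (D_label (size q)) q & pendant s q 0%N
| AttachB3 q of q =i p & size q = 3%N & realizes (B_label 3) q & pendant s q 2%N
| AttachD6 q of q =i p & size q = 6%N & realizes (D_label 6) q & pendant s q 4%N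
| AttachE7 q of q =i p & size q = 7%N & realizes (branch_label 7 2) q & pendant s q 5%N
| AttachH3 q of q =i p & size q = 3%N & realizes (path_label [:: 3; 5]%N) q & pendant s q 0%N.

Lemma pendant_drop s p x k : pendant s p x -> (k <= x)%N -> pendant s (drop k p) (x - k)%N.
Proof.
move=> hs lk j; rewrite size_drop => lj; rewrite nth_drop hs; last by lia.
by have -> : ((k + j)%N == x) = (j == (x - k)%N) by lia.
Qed.

Section Case.
Variables (s : I) (p : seq I) (x : nat).
Hypotheses (up : uniq p) (sp : s \notin p) (lx : (x < size p)%N) (hs : pendant s p x).
Hypotheses (PL : {subset s :: p <= L}) (hl : leaf_at p x).

Lemma drop_sub k : {subset s :: drop k p <= L}.
Proof.
by move=> y; rewrite inE => /orP[/eqP->|/mem_drop yp]; apply: PL; rewrite inE ?eqxx ?yp ?orbT.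
Qed.

Lemma drop_notin k : s \notin drop k p.
Proof. by apply: contra sp; apply: mem_drop. Qed.

Lemma attach_B : (2 <= size p)%N -> realizes (B_label (size p)) p -> attach_view s p.
Proof.
move=> h2 r; have [x0|xn] := B_leaf mP h2 r lx hl.
  by apply: (@AttachB _ _ p) => //; rewrite -x0.
have [s2|s2] := eqVneq (size p) 2%N.
  rewrite s2 in r; have ck : reindex_check (size p) (B_label 2) (B_label 2) [:: 1; 0]%N by rewrite s2.
  have pe : perm_eq [:: 1; 0]%N (iota 0 (size p)) by rewrite s2.
  have [r' u' s' e'] := reindex_listed mP r ck pe.
  have hs' := pendant_perm hs lx ck pe.
  by apply: (AttachB e'); rewrite ?s' ?s2 //; rewrite xn s2 in hs'.
have [s3|s3] := eqVneq (size p) 3%N.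
  by have hs3 := hs; rewrite xn s3 in hs3; rewrite s3 in r; apply: (@AttachB3 _ _ p).
(* The last four vertices together with [s] form affine F4. *)
exfalso; have h4 : (4 <= size p)%N by lia.
have s4 : size (drop (size p - 4) p) = 4%N by rewrite size_drop; lia.
have r4 : realizes (B_label 4) (drop (size p - 4) p).
  apply: (realizes_drop _ r) => a b lab lb.
  by rewrite B_label_shift //; congr (B_label _ _ _); lia.
have hs4 : pendant s (drop (size p - 4) p) 3%N.
  have e3 : (x - (size p - 4) = 3)%N by lia.
  by rewrite -[X in pendant _ _ X]e3; apply: pendant_drop => //; lia.
have re := realizes_ext r4 (drop_notin _) hs4.
apply: (F4_idx cP mP hL (x0 := 1%N) (x1 := 2%N) (x2 := 3%N) (x3 := 4%N) (x4 := 0%N) re (@drop_sub _)).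
by rewrite /= s4.
Qed.

Lemma attach_D : (4 <= size p)%N -> ~~ odd (size p) -> realizes (D_label (size p)) p -> attach_view s p.
Proof.
move=> h4 ev r; have hx := D_leaf mP h4 r lx hl.
have [x0|x0] := eqVneq x 0%N; first by apply: (@AttachD _ _ p) => //; rewrite -x0.
have {}hx : x = (size p - 2)%N \/ x = (size p).-1.
  by case: hx => [h|->|->]; [rewrite h in x0 | left | right].
(* The three leaves of D4 are equivalent: whichever carries [s] is renumbered 0. *)
have [s4|s4] := eqVneq (size p) 4%N.
  rewrite s4 in r.
  suff [idx [ck pe ix]] : exists idx, [/\ reindex_check (size p) (D_label 4) (D_label 4) idx,
      perm_eq idx (iota 0 (size p)) & index x idx = 0%N].
    have [r' u' s' e'] := reindex_listed mP r ck pe.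
    have hs' := pendant_perm hs lx ck pe.
    by apply: (AttachD e'); rewrite ?s' ?s4 //; rewrite ix in hs'.
  by case: hx => ->; rewrite s4; [exists [:: 2; 1; 0; 3]%N | exists [:: 3; 1; 2; 0]%N].
have [s6|s6] := eqVneq (size p) 6%N.
  rewrite s6 in r.
  suff [idx [ck pe ix]] : exists idx, [/\ reindex_check (size p) (D_label 6) (D_label 6) idx,
      perm_eq idx (iota 0 (size p)) & index x idx = 4%N].
    have [r' u' s' e'] := reindex_listed mP r ck pe.
    have hs' := pendant_perm hs lx ck pe.
    by apply: (AttachD6 e'); rewrite ?s' ?s6 //; rewrite ix in hs'.
  by case: hx => ->; rewrite s6; [exists [:: 0; 1; 2; 3; 4; 5]%N | exists [:: 0; 1; 2; 3; 5; 4]%N].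
(* The last eight vertices, with [s] at an end of the fork, form affine E8, whose marks are [cs]. *)
exfalso; have h8 : (8 <= size p)%N by lia.
have s8 : size (drop (size p - 8) p) = 8%N by rewrite size_drop; lia.
have r8 : realizes (D_label 8) (drop (size p - 8) p).
  apply: (realizes_drop _ r) => a b lab lb.
  by rewrite D_label_shift //; [congr (D_label _ _ _); lia | lia].
have hs8 : pendant s (drop (size p - 8) p) (x - (size p - 8))%N by apply: pendant_drop => //; lia.
have re := realizes_ext r8 (drop_notin _) hs8.
have := affine_idx cP mP hL (cs := [:: 6; 5; 4; 3; 2; 1; 4; 2; 3]%N)
  (E := [:: (0,1); (1,2); (2,3); (3,4); (4,5); (0,6); (6,7); (0,8)]%N) re (@drop_sub _).
have [ex|ex] : (x - (size p - 8) = 6 \/ x - (size p - 8) = 7)%N by lia.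
- by rewrite ex /= s8 => /(_ [:: 6; 5; 4; 3; 2; 1; 7; 0; 8]%N isT).
- by rewrite ex /= s8 => /(_ [:: 6; 5; 4; 3; 2; 1; 8; 0; 7]%N isT).
Qed.

Ltac not_leaf r y1 y2 := exfalso; apply: (leaf_check (y1 := y1) (y2 := y2) mP r hl).

(** The arms at the branch vertex 2 have lengths 2, 3 and 1. Lengthening the first gives affine E7,
    the second E8, and the third a diagram containing affine E6. *)
Lemma attach_E7 : size p = 7%N -> realizes (branch_label 7 2) p -> attach_view s p.
Proof.
move=> s7 r; have re := realizes_ext r sp hs.
have lx' := lx; rewrite s7 in lx'.
case ex: x lx' re => [|[|[|[|[|[|[|k]]]]]]] // _ re.
- exfalso; apply: (affine_idx cP mP hL (idx := [:: 3; 2; 1; 0; 4; 5; 6; 7]%N)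
   (cs := [:: 4; 3; 2; 1; 3; 2; 1; 2]%N)
   (E := [:: (0,1); (1,2); (2,3); (0,4); (4,5); (5,6); (0,7)]%N) re PL).
  by rewrite /= s7.
- by not_leaf r 0%N 2%N; rewrite s7 ex.
- by not_leaf r 1%N 3%N; rewrite s7 ex.
- by not_leaf r 2%N 4%N; rewrite s7 ex.
- by not_leaf r 3%N 5%N; rewrite s7 ex.
- by apply: (@AttachE7 _ _ p) => //; rewrite -ex.
- exfalso; apply: (affine_idx cP mP hL (idx := [:: 3; 2; 1; 4; 5; 7; 0]%N)
   (cs := [:: 3; 2; 1; 2; 1; 2; 1]%N) (E := [:: (0,1); (0,3); (0,5); (1,2); (3,4); (5,6)]%N) re PL).
  by rewrite /= s7.
Qed.

(** The arms have lengths 2, 4 and 1; lengthening them produces affine E7, E8 and E6 subdiagrams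
    respectively. *)
Lemma attach_E8 : size p = 8%N -> realizes (branch_label 8 2) p -> False.
Proof.
move=> s8 r; have re := realizes_ext r sp hs.
have lx' := lx; rewrite s8 in lx'.
case ex: x lx' re => [|[|[|[|[|[|[|[|k]]]]]]]] // _ re.
- apply: (affine_idx cP mP hL (idx := [:: 3; 2; 1; 0; 4; 5; 6; 8]%N)
   (cs := [:: 4; 3; 2; 1; 3; 2; 1; 2]%N)
   (E := [:: (0,1); (1,2); (2,3); (0,4); (4,5); (5,6); (0,7)]%N) re PL).
  by rewrite /= s8.
- by not_leaf r 0%N 2%N; rewrite s8 ex.
- by not_leaf r 1%N 3%N; rewrite s8 ex.
- by not_leaf r 2%N 4%N; rewrite s8 ex.
- by not_leaf r 3%N 5%N; rewrite s8 ex.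
- by not_leaf r 4%N 6%N; rewrite s8 ex.
- apply: (affine_idx cP mP hL (idx := [:: 3; 4; 5; 6; 7; 0; 2; 1; 8]%N)
   (cs := [:: 6; 5; 4; 3; 2; 1; 4; 2; 3]%N)
   (E := [:: (0,1); (1,2); (2,3); (3,4); (4,5); (0,6); (6,7); (0,8)]%N) re PL).
  by rewrite /= s8.
- apply: (affine_idx cP mP hL (idx := [:: 3; 2; 1; 4; 5; 8; 0]%N)
   (cs := [:: 3; 2; 1; 2; 1; 2; 1]%N) (E := [:: (0,1); (0,3); (0,5); (1,2); (3,4); (5,6)]%N) re PL).
  by rewrite /= s8.
Qed.

Lemma attach_F4 : size p = 4%N -> realizes (path_label [:: 3; 4; 3]%N) p -> False.
Proof.
move=> s4 r; have re := realizes_ext r sp hs.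
have lx' := lx; rewrite s4 in lx'.
case ex: x lx' re => [|[|[|[|k]]]] // _ re.
- by apply: (F4_idx cP mP hL (x0 := 0%N) (x1 := 1%N) (x2 := 2%N) (x3 := 3%N) (x4 := 4%N) re PL); rewrite /= s4.
- by not_leaf r 0%N 2%N; rewrite s4 ex.
- by not_leaf r 1%N 3%N; rewrite s4 ex.
- by apply: (F4_idx cP mP hL (x0 := 0%N) (x1 := 4%N) (x2 := 3%N) (x3 := 2%N) (x4 := 1%N) re PL); rewrite /= s4.
Qed.

Lemma attach_I k : size p = 2%N -> (2 <= k)%N -> realizes (path_label [:: (2 * k)%N]) p -> attach_view s p.
Proof.
move=> s2 k2 r; have [k3|k3] := leqP 3 k; last first.
  have ek : k = 2%N by lia.
  apply: attach_B; rewrite s2 //; apply: eq_realizes r => a b lab; rewrite s2 ek.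
  by case: b lab => [|[|b]] //; case: a => [|a].
exfalso; have re := realizes_ext r sp hs.
have k6 : (5 < 2 * k)%N by lia.
have lx' := lx; rewrite s2 in lx'.
case ex: x lx' re => [|[|k']] // _ re.
- apply: (G2_idx cP mP hL (x0 := 0%N) (x1 := 1%N) (x2 := 2%N) re PL); rewrite /= s2 /edge_check /sym_label /path_label /=.
  by rewrite k6 andbT; case: eqP => //; lia.
- apply: (G2_idx cP mP hL (x0 := 0%N) (x1 := 2%N) (x2 := 1%N) re PL); rewrite /= s2 /edge_check /sym_label /path_label /=.
  by rewrite k6 andbT; case: eqP => //; lia.
Qed.

Lemma attach_H3 : size p = 3%N -> realizes (path_label [:: 3; 5]%N) p -> attach_view s p.
Proof.
move=> s3 r; have re := realizes_ext r sp hs.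
have lx' := lx; rewrite s3 in lx'.
case ex: x lx' re => [|[|[|k]]] // _ re.
- by apply: (@AttachH3 _ _ p) => //; rewrite -ex.
- by not_leaf r 0%N 2%N; rewrite s3 ex.
- by exfalso; apply: (H353_idx cP mP hL (x0 := 1%N) (x1 := 2%N) (x2 := 3%N) (x3 := 0%N) re PL); rewrite /= s3.
Qed.

Lemma attach_H4 : size p = 4%N -> realizes (path_label [:: 3; 3; 5]%N) p -> False.
Proof.
move=> s4 r; have re := realizes_ext r sp hs.
have lx' := lx; rewrite s4 in lx'.
case ex: x lx' re => [|[|[|[|k]]]] // _ re.
- by apply: (H5333_idx cP mP hL (x0 := 4%N) (x1 := 3%N) (x2 := 2%N) (x3 := 1%N) (x4 := 0%N) re PL); rewrite /= s4.
- by not_leaf r 0%N 2%N; rewrite s4 ex.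
- by not_leaf r 1%N 3%N; rewrite s4 ex.
- by apply: (H353_idx cP mP hL (x0 := 2%N) (x1 := 3%N) (x2 := 4%N) (x3 := 0%N) re PL); rewrite /= s4.
Qed.

Lemma attachP : listed_seq p -> (2 <= size p)%N -> attach_view s p.
Proof.
case=> [->|h r|h o r|h r|h r|h r|k h k2 r|h r|h r] // h2.
- exact: attach_B.
- exact: attach_D.
- exact: attach_E7.
- by case: attach_E8.
- by case: attach_F4.
- exact: attach_I h k2 r.
- exact: attach_H3.
- by case: attach_H4.
Qed.

End Case.

Lemma eq_mem_cons s p q : q =i p -> s :: q =i s :: p.
Proof. by move=> e x; rewrite !inE e. Qed.

Lemma attach1 s p : s \notin p -> attach_view s p ->
  (exists q, [/\ uniq q, listed_seq q & q =i s :: p]) \/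
  (exists q, [/\ q =i p, (2 <= size q)%N & realizes (D_label (size q).+1) (s :: q)]).
Proof.
move=> sp; have nq q : q =i p -> s \notin q by move=> ->.
case=> q e; have sq := nq q e; have ec := eq_mem_cons s e.
- move=> h2 r hs; have re := realizes_Bcons h2 (realizes_ext r sq hs).
  by left; exists (s :: q); split=> //; [case: re | apply: ListedB => //; exact: leqW].
- move=> h4 ev r hs; right; exists q; split=> //; first by lia.
  by apply: realizes_Dcons; [lia | apply: realizes_ext].
- move=> s3 r hs; have re := realizes_ext r sq hs; left.
  have ck : reindex_check (size (s :: q)) (ext_label 2 (B_label 3)) (path_label [:: 3; 4; 3]%N) [:: 1; 2; 3; 0]%N.
    by rewrite /= s3.
  have pe : perm_eq [:: 1; 2; 3; 0]%N (iota 0 (size (s :: q))) by rewrite /= s3.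
  have [r' u' s' e'] := reindex_listed mP re ck pe.
  by eexists; split; [exact: u' | apply: ListedF4 r'; rewrite s' /= s3 | move=> t; rewrite e' ec].
- move=> s6 r hs; have re := realizes_ext r sq hs; left.
  have ck : reindex_check (size (s :: q)) (ext_label 4 (D_label 6)) (branch_label 7 2) [:: 0; 5; 4; 3; 2; 1; 6]%N.
    by rewrite /= s6.
  have pe : perm_eq [:: 0; 5; 4; 3; 2; 1; 6]%N (iota 0 (size (s :: q))) by rewrite /= s6.
  have [r' u' s' e'] := reindex_listed mP re ck pe.
  by eexists; split; [exact: u' | apply: ListedE7 r'; rewrite s' /= s6 | move=> t; rewrite e' ec].
- move=> s7 r hs; have re := realizes_ext r sq hs; left.
  have ck : reindex_check (size (s :: q)) (ext_label 5 (branch_label 7 2)) (branch_label 8 2) [:: 1; 2; 3; 4; 5; 6; 0; 7]%N.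
    by rewrite /= s7.
  have pe : perm_eq [:: 1; 2; 3; 4; 5; 6; 0; 7]%N (iota 0 (size (s :: q))) by rewrite /= s7.
  have [r' u' s' e'] := reindex_listed mP re ck pe.
  by eexists; split; [exact: u' | apply: ListedE8 r'; rewrite s' /= s7 | move=> t; rewrite e' ec].
- move=> s3 r hs; have re := realizes_ext r sq hs; left.
  exists (s :: q); split=> //; first by case: re.
  apply: ListedH4; rewrite /= ?s3 //; apply: eq_realizes re => a b lab; rewrite /= s3.
  by case: b lab => [|[|[|[|b]]]] //; case: a => [|[|[|a]]].
Qed.

(** [t] and [p] hang on two sides of [s]. Types B and D grow by two vertices, which restores the
    parity of D; in the other cases affine F4, E7, E8 or the chain 5, 3, 3, 3 appears. *)
Lemma attach2 t s p : s \notin p -> t \notin s :: p -> {subset t :: s :: p <= L} ->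
  pendant t (s :: p) 0%N -> attach_view s p ->
  exists q, [/\ uniq q, listed_seq q & q =i t :: s :: p].
Proof.
move=> sp tsp PL ht; have nq q : q =i p -> s \notin q by move=> ->.
case=> q e; have sq := nq q e; have ec := eq_mem_cons s e; have ecc := eq_mem_cons t ec.
all: have tsq : t \notin s :: q by rewrite ec.
all: have QL : {subset t :: s :: q <= L} by move=> y; rewrite ecc => /PL.
all: have ht' : pendant t (s :: q) 0%N by
  [have mts : m t s = 3%N := ht 0%N isT; case=> [|j] //= lj; have := mem_nth z0 lj; rewrite e => yp;
   have := ht (index (nth z0 q j) p).+1; rewrite /= nth_index // ltnS index_mem; apply].
- move=> h2 r hs; have re := realizes_Bcons h2 (realizes_ext r sq hs).
  have re2 := realizes_Bcons (p := s :: q) (leqW h2) (realizes_ext re tsq ht').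
  by exists (t :: s :: q); split=> //; [case: re2 | apply: ListedB => //; exact/leqW/leqW].
- move=> h4 ev r hs.
  have re : realizes (D_label (size q).+1) (s :: q) by apply: realizes_Dcons; [lia | apply: realizes_ext].
  have re2 : realizes (D_label (size q).+2) (t :: s :: q).
    by apply: (@realizes_Dcons _ _ _ (s :: q)); [rewrite /=; lia | apply: realizes_ext].
  exists (t :: s :: q); split=> //; first by case: re2.
  by apply: ListedD; rewrite /= ?negbK //; lia.
- move=> s3 r hs; have re := realizes_ext (realizes_ext r sq hs) tsq ht'; exfalso.
  by apply: (F4_idx cP mP hL (x0 := 0%N) (x1 := 1%N) (x2 := 4%N) (x3 := 3%N) (x4 := 2%N) re QL); rewrite /= s3.
- move=> s6 r hs; have re := realizes_ext (realizes_ext r sq hs) tsq ht'; exfalso.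
  apply: (affine_idx cP mP hL (idx := [:: 5; 6; 1; 0; 4; 3; 2; 7]%N)
   (cs := [:: 4; 3; 2; 1; 3; 2; 1; 2]%N)
   (E := [:: (0,1); (1,2); (2,3); (0,4); (4,5); (5,6); (0,7)]%N) re QL).
  by rewrite /= s6.
- move=> s7 r hs; have re := realizes_ext (realizes_ext r sq hs) tsq ht'; exfalso.
  apply: (affine_idx cP mP hL (idx := [:: 4; 5; 6; 7; 1; 0; 3; 2; 8]%N)
   (cs := [:: 6; 5; 4; 3; 2; 1; 4; 2; 3]%N)
   (E := [:: (0,1); (1,2); (2,3); (3,4); (4,5); (0,6); (6,7); (0,8)]%N) re QL).
  by rewrite /= s7.
- move=> s3 r hs; have re := realizes_ext (realizes_ext r sq hs) tsq ht'; exfalso.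
  by apply: (H5333_idx cP mP hL (x0 := 4%N) (x1 := 3%N) (x2 := 2%N) (x3 := 1%N) (x4 := 0%N) re QL); rewrite /= s3.
Qed.

End AttachCases.

(** * Adding a vertex to a union of listed components *)

Section Component.
Variables (I : finType) (m : I -> I -> nat).
Hypothesis mP : coxeter_matrix m.
Implicit Types (x y z a b : I) (J K D : {set I}) (p q l : seq I).
Local Notation edge := (edge m).
Local Notation conn := (fun K => connect (full_subdiagram_edge m K)).

Lemma conn_sym K x y : conn K x y = conn K y x.
Proof.
apply: sym_connect_sym => {x y} x y; rewrite /full_subdiagram_edge -!/(edge _ _) (edgeC mP).
by rewrite !andbA [(x \in K) && _]andbC.
Qed.

Lemma conn_mem K x y : x \in K -> conn K x y -> y \in K.
Proof.
move=> xK /connectP[p px ->]; elim: p x px xK => //= z p IH x /andP[/and3P[_ zK _] pz] _.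
exact: IH pz zK.
Qed.

Lemma connS J K x y : J \subset K -> conn J x y -> conn K x y.
Proof.
move=> /fintype.subsetP JK; apply: connect_sub => a b /and3P[aJ bJ ab].
by apply: connect1; apply/and3P; split=> //; apply: JK.
Qed.

Lemma conn_edge K x y : x \in K -> y \in K -> edge x y -> conn K x y.
Proof. by move=> xK yK xy; apply: connect1; apply/and3P. Qed.

Lemma chain_conn K x l : chain m K (x :: l) -> conn K x (last x l).
Proof.
elim: l x => [|y l IH] x ch; first exact: connect0.
have cl := chain_behead ch; case: ch => /= /andP[xy _] _ sub.
apply: connect_trans (IH _ cl); apply: conn_edge => //; apply: sub;
  by rewrite !inE eqxx ?orbT.
Qed.

Lemma componentP K x y : (y \in subdiagram_component m K x) = conn K x y.
Proof. by rewrite inE. Qed.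

Lemma component_sub K x : x \in K -> subdiagram_component m K x \subset K.
Proof. by move=> xK; apply/fintype.subsetP => y; rewrite componentP; apply: conn_mem. Qed.

Lemma component_eq K x y : y \in subdiagram_component m K x ->
  subdiagram_component m K y = subdiagram_component m K x.
Proof.
rewrite componentP => xy; apply/setP => z; rewrite !componentP.
apply/idP/idP => h; first exact: connect_trans xy h.
by apply: connect_trans h; rewrite conn_sym.
Qed.

Lemma component_decomp K s x : x != s -> conn K s x ->
  exists a, [/\ a \in (K :\ s)%SET, edge s a & conn (K :\ s)%SET a x].
Proof.
rewrite eq_sym => neq /(chain_of_connect neq)[[|a l] ch el].
  by rewrite /= in el; rewrite el eqxx in neq.
have [/= /andP[sa pl] /andP[snl ul] sub] := ch.
have sub' : {subset a :: l <= (K :\ s)%SET}.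
  move=> z zl; rewrite !inE sub ?inE; last by rewrite -in_cons zl orbT.
  by rewrite andbT; apply: contraNneq snl => <-.
exists a; split=> //; first by apply: sub'; rewrite inE eqxx.
by rewrite -el /=; apply: (@chain_conn _ a l); split.
Qed.

Lemma component_off K s x : ~~ conn K s x -> x \in K ->
  subdiagram_component m (K :\ s)%SET x = subdiagram_component m K x.
Proof.
move=> nsx xK; apply/setP => y; rewrite !componentP.
apply/idP/idP; first by apply: connS; apply: finset.subD1set.
have [->|neq] := eqVneq x y; first by move=> _; apply: connect0.
move=> /(chain_of_connect neq)[l ch el]; rewrite -el; apply: chain_conn.
case: ch => sl ul sub; split=> // z zl; rewrite !inE sub // andbT.
apply: contraNneq nsx => <-; rewrite conn_sym.
have {}zl := zl; case/splitPl: zl el sl ul sub => l1 l2 ez _ sl ul sub.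
rewrite -ez; apply: chain_conn; split.
- by move: sl; rewrite /= cat_path => /andP[].
- by move: ul; rewrite -cat_cons cat_uniq => /andP[].
- by move=> t tl; apply: sub; rewrite -cat_cons mem_cat tl.
Qed.

End Component.

(** * Heavy edges and branch vertices *)

Section Key.
Variables (R : rcfType) (c : nat -> R) (cP : dcos_family c).
Variables (I : finType) (m : I -> I -> nat).
Hypothesis mP : coxeter_matrix m.
Variables (L : {set I}) (hL : posdef c m L).
Implicit Types (x y z a b : I) (J K D : {set I}) (p q l : seq I).
Local Notation edge := (edge m).
Local Notation heavy := (heavy m).
Local Notation conn := (fun K => connect (full_subdiagram_edge m K)).

Lemma branchS D K b : D \subset K -> branch m D b -> branch m K b.
Proof.
move=> /fintype.subsetP DK [a [d [e [u [aD dD eD] h]]]].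
by exists a, d, e; split=> //; split; apply: DK.
Qed.

Definition special_in D := (exists q r : I, [/\ q \in D, r \in D & heavy q r]) \/
  (exists2 b, b \in D & branch m D b).

Lemma special_contra D x : D \subset L -> special_in D -> x \in L -> x \notin D ->
  (exists2 y, y \in L & heavy x y) \/ branch m L x -> (forall y, y \in D -> conn L x y) -> False.
Proof.
move=> DL sD xL xD sx cx; have DL' := fintype.subsetP DL.
have neq y : y \in D -> (y == x) = false by move=> yD; apply: contraNF xD => /eqP <-.
case: sD => [[q [r [qD rD hqr]]]|[b bD hb]]; case: sx => [[y yL hxy]|hx].
- apply: (two_heavy_contra cP mP hL hxy hqr); rewrite ?neq //.
    by split=> //; apply: DL'.
    by rewrite andbF.
  exact: cx.
- apply: (heavy_branch_contra cP mP hL hqr _ _ hx xL); try exact: DL'.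
  by rewrite conn_sym //; apply: cx.
- by apply: (heavy_branch_contra cP mP hL hxy xL yL (branchS DL hb) (DL' _ bD)); apply: cx.
- apply: (two_branch_contra cP mP hL _ hx (branchS DL hb)); last exact: cx.
  by rewrite eq_sym neq.
Qed.

(** With [s] as a third neighbour, [a] would be a branch vertex competing with the feature of [D];
    if it is already the branch vertex of [D], it would have four neighbours. *)
Lemma special_leaf D s a : D \subset L -> special_in D -> s \in L -> s \notin D -> a \in D ->
  edge s a -> (forall y, y \in D -> conn L a y) ->
  forall y1 y2, y1 \in D -> y2 \in D -> y1 != y2 -> edge a y1 -> edge a y2 -> False.
Proof.
move=> DL sD sL snD aD sa ca y1 y2 y1D y2D neq ay1 ay2; have DL' := fintype.subsetP DL.
have sneq y : y \in D -> s == y = false by move=> yD; apply: contraNF snD => /eqP ->.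
have ba : branch m L a.
  exists s, y1, y2; split; last by split=> //; rewrite (edgeC mP).
    by rewrite /= !inE !sneq //= neq.
  by split=> //; apply: DL'.
case: sD => [[q [r [qD rD hqr]]]|[b bD hb]].
  apply: (heavy_branch_contra cP mP hL hqr _ _ ba); try exact: DL'.
  by rewrite conn_sym //; apply: ca.
have [eab|nab] := eqVneq a b.
  have [d [e [f [u [dD eD fD] [bd be bf]]]]] := hb.
  apply: (@star4_contra _ _ cP _ _ mP _ hL b s d e f); try exact: DL'.
  - by rewrite cons_uniq u andbT !inE !sneq.
  - by split=> //; apply: DL'.
  - by split=> //; rewrite -eab (edgeC mP).
exact: (two_branch_contra cP mP hL nab ba (branchS DL hb) (ca _ bD)).
Qed.

(** This is where the absence of A_n with n >= 2 from the list counts: each type exhibits its heavy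
    edge or branch vertex. *)
Lemma listed_special z0 p : uniq p -> listed_seq m z0 p -> (2 <= size p)%N ->
  special_in [set x in p]%SET.
Proof.
move=> up lp s2.
have inp i : (i < size p)%N -> nth z0 p i \in [set x in p]%SET.
  by move=> li; rewrite finset.in_set mem_nth.
have hv e i j : realizes m z0 e p -> i != j -> (i < size p)%N -> (j < size p)%N ->
    sym_label e i j != 2%N -> sym_label e i j != 3%N -> special_in [set x in p]%SET.
  move=> r neq li lj e2 e3; left; exists (nth z0 p i), (nth z0 p j); split; try exact: inp.
  by rewrite /heavy (realizes_edge mP r) // e2 (realizes_sym mP r).
have br e (b i j k : nat) : realizes m z0 e p -> [&& uniq [:: i; j; k], (b < size p)%N &
     all (edge_check (size p) e b) [:: i; j; k]] -> special_in [set x in p]%SET.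
  move=> r /and3P[u lb /= /and4P[h1 h2 h3 _]].
  have li (x : nat) : edge_check (size p) e b x -> (x < size p)%N by case/and4P.
  right; exists (nth z0 p b); first exact: inp.
  exists (nth z0 p i), (nth z0 p j), (nth z0 p k); split.
  - have := u; rewrite /= !inE !negb_or !andbT => /andP[/andP[ij ik] jk].
    by rewrite !nth_uniq ?li // ij ik jk.
  - by split; apply: inp; apply: li.
  - by split; apply: edge_checkP r _.
case: lp => [h|h r|h o r|h r|h r|h r|k h k2 r|h r|h r].
- by rewrite h in s2.
- apply: (hv _ (size p - 2)%N (size p).-1 r); rewrite ?sym_label_lt /B_label; try lia;
    by have -> : (size p).-1 = (size p - 2).+1 by [lia]; rewrite !eqxx.
- apply: (br _ (size p - 3)%N (size p - 4)%N (size p - 2)%N (size p).-1 r).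
  rewrite /= !inE /edge_check; apply/and3P; split; [lia | lia |].
  rewrite andbT; apply/and3P; split; apply/and4P; split; try lia.
  + rewrite sym_label_gt; last by lia.
    rewrite /D_label /branch_label ifF; last by lia.
    by have -> : (size p - 3 == (size p - 4).+1)%N by [lia].
  + rewrite sym_label_lt; last by lia.
    rewrite /D_label /branch_label ifF; last by lia.
    by have -> : (size p - 2 == (size p - 3).+1)%N by [lia].
  + by rewrite sym_label_lt; [rewrite /D_label /branch_label !eqxx | lia].
- by apply: (br _ 2%N 1%N 3%N 6%N r); rewrite h.
- by apply: (br _ 2%N 1%N 3%N 7%N r); rewrite h.
- by apply: (hv _ 1%N 2%N r); rewrite ?h.
- apply: (hv _ 0%N 1%N r); rewrite ?h // /sym_label /path_label /=; apply/eqP; lia.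
- by apply: (hv _ 1%N 2%N r); rewrite ?h.
- by apply: (hv _ 2%N 3%N r); rewrite ?h.
Qed.

End Key.

(** * The component of an added vertex *)

Section AddedVertex.
Variables (R : rcfType) (c : nat -> R) (cP : dcos_family c).
Variables (I : finType) (m : I -> I -> nat).
Hypothesis mP : coxeter_matrix m.
Variables (L : {set I}) (hL : posdef c m L).
Implicit Types (x y z a b : I) (J K D : {set I}) (p q l : seq I).
Local Notation edge := (edge m).
Local Notation heavy := (heavy m).
Local Notation conn := (fun K => connect (full_subdiagram_edge m K)).
Variable s : I.
Hypothesis sL : s \in L.
Local Notation J := (L :\ s)%SET.
Local Notation comp := (subdiagram_component m).
Hypothesis compJ : forall x, x \in J -> has_listed_type m (comp J x).
Local Notation nbrs := [set a in J | edge s a]%SET.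

(** [s] is the end of the tail. For [size q] = 2 this is D_3, that is A_3 with [s] in the middle.
    The rank is odd because the complement of [s] has listed components only. *)
Definition D_odd_component (C : {set I}) := exists q,
  [/\ C = [set x in s :: q]%SET, (2 <= size q)%N & realizes m s (D_label (size q).+1) (s :: q)].

Definition odd_dihedral_component (C : {set I}) := exists a,
  [/\ C = [set s; a]%SET, s != a & odd (m s a)].

Let JL : J \subset L. Proof. exact: finset.subD1set. Qed.

Let not_edge x y : x != y -> ~~ edge x y -> m x y = 2%N.
Proof. by move=> neq; rewrite /edge /diagram_edge neq /= negbK => /eqP. Qed.

Let nbrsP a : a \in nbrs -> [/\ a \in J, a \in L & edge s a].
Proof. by rewrite inE => /andP[aJ sa]; split=> //; apply: (fintype.subsetP JL). Qed.

Let nbrs_disconn a b : a \in nbrs -> b \in nbrs -> conn J a b -> a = b.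
Proof.
move=> /nbrsP[aJ aL sa] /nbrsP[bJ bL sb] ab; apply/eqP/negPn/negP => neq.
exact: (cycle_contra cP mP hL sL neq sa sb ab).
Qed.

Let conn_comp a x : a \in nbrs -> x \in comp J a -> conn L s x.
Proof.
move=> /nbrsP[aJ aL sa]; rewrite componentP => ax.
by apply: connect_trans (conn_edge sL aL sa) _; apply: connS ax.
Qed.

Let comp_memJ a x : a \in nbrs -> x \in comp J a -> x \in J.
Proof. by move=> /nbrsP[aJ _ _]; have := fintype.subsetP (component_sub m aJ); apply. Qed.

Let s_notin_comp a : a \in nbrs -> s \notin comp J a.
Proof. by move=> an; apply/negP => /(comp_memJ an); rewrite !inE eqxx. Qed.

Let mem_componentE y : (y \in comp L s) = (y == s) || [exists a in nbrs, y \in comp J a].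
Proof.
apply/idP/orP => [|[/eqP->|/exists_inP[a an ya]]]; last 2 first.
- by rewrite componentP connect0.
- by rewrite componentP; apply: conn_comp an ya.
rewrite componentP => sy; have [->|neq] := eqVneq y s; [by left | right].
have [a [aJ sa ay]] := component_decomp neq sy.
by apply/exists_inP; exists a; rewrite ?inE ?componentP // -in_setD1 aJ.
Qed.

Let comp_self a : a \in comp J a.
Proof. by rewrite componentP connect0. Qed.

(* A non-trivial component of [L :\ s] already contains a heavy edge or a branch vertex. *)
Lemma added_vertex_big_component a : a \in nbrs -> (1 < #|comp J a|)%N ->
  has_listed_type m (comp L s) \/ D_odd_component (comp L s).
Proof.
move=> an big; have [aJ aL sa] := nbrsP an.
have /(has_listed_typeP mP s)[p [up lp Dp]] := compJ aJ.
set D := comp J a in big Dp.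
have s2 : (1 < size p)%N.
  by move: big; rewrite Dp cardsE (card_uniqP up).
have sD : special_in m D by rewrite Dp; apply: (listed_special mP up lp s2).
have DL : D \subset L by exact: (fintype.subset_trans (component_sub m aJ) JL).
have memp y : (y \in p) = (y \in D) by rewrite Dp finset.in_set.
have snp : s \notin p by rewrite memp s_notin_comp.
have ap : a \in p by rewrite memp comp_self.
have contra x : x \in L -> x \notin D -> conn L s x ->
    (exists2 y, y \in L & heavy x y) \/ branch m L x -> False.
  move=> xL xD sx hx; apply: (special_contra cP mP hL DL sD xL xD hx) => y yD.
  by apply: connect_trans (conn_comp an yD); rewrite conn_sym.
(* A heavy edge at [s] would be a second feature besides that of [D]. For the same reason the other
   components adjacent to [s] are single points, and there is at most one of them. *)
have label3 b : b \in nbrs -> m s b = 3%N.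
  move=> /nbrsP[bJ bL sb]; apply/eqP/negPn/negP => h.
  apply: (contra s sL (s_notin_comp an) (connect0 _ _)); left; exists b => //.
  by rewrite /heavy sb.
have other b : b \in nbrs -> b != a -> comp J b = [set b]%SET.
  move=> bn ba; have [bJ bL sb] := nbrsP bn.
  have bD x : x \in comp J b -> x \notin D.
    rewrite componentP => bx; rewrite componentP; apply: contraNN ba => ax.
    apply/eqP; apply: nbrs_disconn bn an _; apply: connect_trans bx _.
    by rewrite conn_sym.
  have /(has_listed_typeP mP s)[q [uq lq Dq]] := compJ bJ.
  have memq x : (x \in q) = (x \in comp J b) by rewrite Dq finset.in_set.
  have bq : b \in q by rewrite memq comp_self.
  have qL x : x \in comp J b -> x \in L.
    by move=> h; apply: (fintype.subsetP JL); apply: comp_memJ bn h.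
  have [q1|q2] := leqP (size q) 1.
    move: q1 bq Dq; case: (q) => [|z [|]] // _; rewrite inE => /eqP <- ->.
    by apply/setP => x; rewrite !inE.
  have qsub : comp J b \subset L by apply/fintype.subsetP.
  have := listed_special mP uq lq q2; rewrite -Dq => -[[x [y [xq yq xy]]]|[x xq hx]].
    case: (contra x (qL _ xq) (bD _ xq) (conn_comp bn xq)); left; exists y => //.
    exact: qL.
  by case: (contra x (qL _ xq) (bD _ xq) (conn_comp bn xq)); right; apply: branchS hx.
have lx : (index a p < size p)%N by rewrite index_mem.
have na : nth s p (index a p) = a by rewrite nth_index.
have pL : {subset p <= L} by move=> y; rewrite memp => /(fintype.subsetP DL).
have PL : {subset s :: p <= L} by move=> y; rewrite inE => /orP[/eqP->|/pL].
have pend : pendant m s s p (index a p).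
  move=> j lj; have [->|nj] := eqVneq j (index a p); first by rewrite na label3.
  have jp : nth s p j \in p by rewrite mem_nth.
  have jD : nth s p j \in D by rewrite -memp.
  apply: not_edge; first by apply: contraNneq snp => ->.
  apply: contraNN nj => sj; rewrite -(nth_uniq s lj lx up) na; apply/eqP.
  have jn : nth s p j \in nbrs by rewrite inE sj (comp_memJ an jD).
  by apply/esym; apply: nbrs_disconn => //; rewrite -componentP.
have leaf : leaf_at m s p (index a p).
  move=> y1 y2 l1 l2 neq; rewrite na => a1 a2.
  have inD j : (j < size p)%N -> nth s p j \in D by move=> lj; rewrite -memp mem_nth.
  apply: (special_leaf cP mP hL DL sD sL (s_notin_comp an) (comp_self a) sa _
    (inD _ l1) (inD _ l2) _ a1 a2); last by rewrite nth_uniq.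
  by move=> y; rewrite componentP => ay; apply: connS ay.
have view : attach_view m s s p := attachP cP mP hL up snp lx pend PL leaf lp s2.
case: (pickP [pred b in nbrs | b != a]) => [b /andP[/= bn ba]|none]; last first.
  have memC y : (y \in comp L s) = (y \in s :: p).
    rewrite mem_componentE inE memp; congr (_ || _); apply/exists_inP/idP => [[b bn yb]|yD].
      have /eqP eba : b == a by have := none b; rewrite /= bn /= => /negbFE.
      by rewrite /D -eba.
    by exists a.
  have [[q [uq lq eq]]|[q [eq q2 rq]]] := attach1 mP snp view.
    left; apply/(has_listed_typeP mP s); exists q; split=> //.
    by apply/setP => y; rewrite finset.in_set eq memC.
  right; exists q; split=> //; apply/setP => y.
  by rewrite finset.in_set memC !inE eq.
have [bJ bL sb] := nbrsP bn; have Db := other b bn ba.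
have only d : d \in nbrs -> d != a -> d = b.
  move=> dn da; apply/eqP/negPn/negP => db; have [dJ dL sd] := nbrsP dn.
  apply: (contra s sL (s_notin_comp an) (connect0 _ _)); right.
  by exists a, b, d; split; rewrite //= !inE !negb_or (eq_sym a b) ba (eq_sym a d) da (eq_sym b d) db.
have bsp : b \notin s :: p.
  rewrite inE negb_or memp; apply/andP; split; first by rewrite eq_sym (edge_neq sb).
  rewrite componentP; apply: contraNN ba => ab.
  by apply/eqP/esym; apply: nbrs_disconn.
have PL2 : {subset b :: s :: p <= L} by move=> y; rewrite inE => /orP[/eqP->|/PL].
have pend2 : pendant m s b (s :: p) 0%N.
  move=> [|j] /= lj; first by rewrite (cox_matrixC mP) label3.
  rewrite ltnS in lj; have jp : nth s p j \in p by rewrite mem_nth.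
  apply: not_edge; first by apply: contraNneq bsp => ->; rewrite inE jp orbT.
  apply: contraNN ba => bj; apply/eqP; apply: nbrs_disconn => //.
  have jD : nth s p j \in D by rewrite -memp.
  apply: connect_trans (conn_edge bJ (comp_memJ an jD) bj) _.
  by rewrite conn_sym // -componentP.
have [q [uq lq eq]] := attach2 cP mP hL snp bsp PL2 pend2 view.
left; apply/(has_listed_typeP mP s); exists q; split=> //.
apply/setP => y; rewrite finset.in_set eq mem_componentE !inE memp.
rewrite orbCA; congr (_ || _); apply/exists_inP/orP => [[d dn yd]|[/eqP->|yD]].
- have [eda|da] := eqVneq d a; first by right; rewrite /D -eda.
  by left; move: yd; rewrite (only d dn da) Db inE.
- by exists b.
- by exists a.
Qed.

(** The component is the path a - s - b with first label 3. The second label gives A_3 = D_3, B_3 or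
    H_3 when it is 3, 4 or 5; otherwise the affine G2 test fails. *)
Let pair_case a b : a \in nbrs -> b \in nbrs -> a != b -> m a b = 2%N ->
  (forall y, (y \in comp L s) = [|| y == s, y == a | y == b]) -> m s a = 3%N ->
  [\/ has_listed_type m (comp L s), D_odd_component (comp L s)
    | odd_dihedral_component (comp L s)].
Proof.
move=> an bn nab mab memC m3; have [[aJ aL sa] [bJ bL sb]] := (nbrsP an, nbrsP bn).
have nsa := edge_neq sa; have nsb := edge_neq sb.
have us : uniq [:: s; a; b] by rewrite /= !inE negb_or nsa nsb nab.
have ua : uniq [:: a; s; b] by rewrite /= !inE negb_or eq_sym nsa nsb nab.
have mas : m a s = 3%N by rewrite (cox_matrixC mP).
have Ca : comp L s = [set x in [:: a; s; b]]%SET.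
  by apply/setP => y; rewrite memC !inE orbCA.
have [k3|k3] := eqVneq (m s b) 3%N.
  apply: Or32; exists [:: a; b]; split=> //; first by apply/setP => y; rewrite memC !inE.
  by split=> // -[|[|x]] [|[|[|y]]].
have [k4|k4] := eqVneq (m s b) 4%N.
  apply: Or31; apply/(has_listed_typeP mP s); exists [:: a; s; b]; split=> //.
  by apply: ListedB => //; split=> // -[|[|x]] [|[|[|y]]].
have [k5|k5] := eqVneq (m s b) 5%N.
  apply: Or31; apply/(has_listed_typeP mP s); exists [:: a; s; b]; split=> //.
  by apply: ListedH3 => //; split=> // -[|[|x]] [|[|[|y]]].
case: (forbidden_G2 cP mP hL ua _ _ sb k3 k4 k5); last by rewrite (edgeC mP).
by move=> y; rewrite !inE => /or3P[]/eqP ->.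
Qed.

(** The component is a star centred at [s], sorted by its number of rays: A_1, a dihedral diagram, a
    path of three vertices, D_4, and from four rays on a forbidden star. *)
Lemma added_vertex_isolated : (forall a, a \in nbrs -> (#|comp J a| <= 1)%N) ->
  [\/ has_listed_type m (comp L s), D_odd_component (comp L s)
    | odd_dihedral_component (comp L s)].
Proof.
move=> triv.
have compE a : a \in nbrs -> comp J a = [set a]%SET.
  move=> an; apply/eqP; rewrite eq_sym finset.eqEcard finset.sub1set comp_self cards1.
  exact: triv.
have memC y : (y \in comp L s) = (y \in s :: enum nbrs).
  rewrite mem_componentE inE mem_enum; congr (_ || _).
  apply/exists_inP/idP => [[a an]|yn]; first by rewrite compE // inE => /eqP ->.
  by exists y.
have disj a b : a \in nbrs -> b \in nbrs -> a != b -> m a b = 2%N.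
  move=> an bn neq; apply: not_edge => //; apply: contraNN neq => ab.
  have [[aJ _ _] [bJ _ _]] := (nbrsP an, nbrsP bn).
  by apply/eqP; apply: nbrs_disconn => //; apply: conn_edge.
have un : uniq (enum nbrs) by apply: enum_uniq.
have memn a : a \in enum nbrs -> a \in nbrs by rewrite mem_enum.
case E : (enum nbrs) => [|a [|b [|d [|e r]]]] in memC un memn.
- apply: Or31; apply/(has_listed_typeP mP s); exists [:: s]; split=> //; first exact: ListedA1.
  by apply/setP => y; rewrite finset.in_set memC.
- have [aJ aL sa] := nbrsP (memn a (mem_head _ _)).
  have neq := edge_neq sa.
  have CE : comp L s = [set s; a]%SET by apply/setP => y; rewrite memC !inE.
  have [odd_m|even_m] := boolP (odd (m s a)); first by apply: Or33; exists a.
  have [m0|m_gt0] := posnP (m s a); first by case: (forbidden_inf cP mP hL sL aL neq m0).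
  apply: Or31; apply/(has_listed_typeP mP s); exists [:: s; a]; split=> //.
  + by rewrite /= inE neq.
  + have m2 : m s a != 2%N by case/andP: sa.
    apply: (@ListedI _ _ _ _ (m s a)./2) => //; first by lia.
    split=> [|[|x] [|[|y]] //]; first by rewrite /= inE neq.
    by rewrite /path_label /=; lia.
  + by rewrite CE; apply/setP => y; rewrite !inE.
- have an : a \in nbrs by apply: memn; rewrite inE eqxx.
  have bn : b \in nbrs by apply: memn; rewrite !inE eqxx orbT.
  have nab : a != b by move: un; rewrite /= inE andbT.
  have mab := disj _ _ an bn nab.
  have memC' y : (y \in comp L s) = [|| y == s, y == a | y == b] by rewrite memC !inE.
  have [[aJ aL sa] [bJ bL sb]] := (nbrsP an, nbrsP bn).
  have [m3|m3] := eqVneq (m s a) 3%N; first exact: (pair_case an bn nab mab memC' m3).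
  have [m3'|m3'] := eqVneq (m s b) 3%N.
    apply: (pair_case bn an _ _ _ m3'); rewrite 1?eq_sym // 1?(cox_matrixC mP) //.
    by move=> y; rewrite memC' orbCA orbA orbC orbA [(y == s) || _]orbC.
  by case: (@heavy2_contra _ _ cP _ _ mP _ hL s a b); rewrite // /heavy ?sa ?sb.
- have an : a \in nbrs by apply: memn; rewrite inE eqxx.
  have bn : b \in nbrs by apply: memn; rewrite !inE eqxx orbT.
  have dn : d \in nbrs by apply: memn; rewrite !inE eqxx !orbT.
  have [[aJ aL sa] [bJ bL sb] [dJ dL sd]] := And3 (nbrsP an) (nbrsP bn) (nbrsP dn).
  have /and3P[/andP[nab nad] nbd _] : [&& (a != b) && (a != d), b != d & true].
    by move: un; rewrite /= !inE negb_or !andbT.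
  have l3 x y z : uniq [:: x; y; z] -> [/\ x \in nbrs, y \in nbrs & z \in nbrs] -> m s x = 3%N.
    move=> u [/nbrsP[_ xL sx] /nbrsP[_ yL sy] /nbrsP[_ zL sz]].
    apply/eqP/negPn/negP => h.
    apply: (@heavy_fork_contra _ _ cP _ _ mP _ hL s x y z) => //.
    by rewrite /heavy sx.
  have ma : m s a = 3%N by apply: (l3 a b d).
  have mb : m s b = 3%N.
    by apply: (l3 b a d); rewrite //= !inE negb_or eq_sym nab nbd nad.
  have md : m s d = 3%N.
    by apply: (l3 d a b); rewrite //= !inE negb_or !(eq_sym d) nab nbd nad.
  apply: Or31; apply/(has_listed_typeP mP s).
  have u4 : uniq [:: a; s; b; d].
    by rewrite /= !inE !negb_or nab nad nbd (eq_sym a s) (edge_neq sa) (edge_neq sb) (edge_neq sd).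
  exists [:: a; s; b; d]; split=> //.
    apply: ListedD => //; split=> // -[|[|[|x]]] [|[|[|[|y]]]] //= _ _;
      by rewrite ?ma ?mb ?md ?(disj a b) ?(disj a d) ?(disj b d) // (cox_matrixC mP) ma.
  apply/setP => y; rewrite finset.in_set memC !inE; by case: (y == a); rewrite ?orbT.
- have iL x : x \in [:: a, b, d, e & r] -> x \in L /\ edge s x.
    by move=> xr; have [_ xL sx] := nbrsP (memn x xr).
  have [[aL sa] [bL sb] [dL sd] [eL se]] : [/\ a \in L /\ edge s a, b \in L /\ edge s b,
      d \in L /\ edge s d & e \in L /\ edge s e].
    by split; apply: iL; rewrite !inE eqxx ?orbT.
  case: (@star4_contra _ _ cP _ _ mP _ hL s a b d e) => //.
  by move: un; rewrite -[_ :: _]/([:: a; b; d; e] ++ r) cat_uniq => /andP[].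
Qed.

Lemma added_vertex_component :
  [\/ has_listed_type m (comp L s), D_odd_component (comp L s)
    | odd_dihedral_component (comp L s)].
Proof.
case: (pickP [pred a in nbrs | (1 < #|comp J a|)%N]) => [a /andP[/= an big]|none].
  by case: (added_vertex_big_component an big) => h; [apply: Or31 | apply: Or32].
apply: added_vertex_isolated => a an; have := none a; rewrite /= an /= => /negbT.
by rewrite -leqNgt.
Qed.

End AddedVertex.

(** * Longest elements of the listed types *)

Section NegListed.
Variables (R : rcfType) (c : nat -> R) (cP : dcos_family c).
Variables (I : finType) (m : I -> I -> nat) (W : groupType) (s : I -> W).
Hypothesis hW : coxeter_system m s.
Local Notation V := {ffun I -> R^o}.
Local Notation sroot := (@sroot R I).
Local Notation pair := (@pair R I m c).
Local Notation cox := (@cox R I m c).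
Local Notation inW := (inW s).
Local Notation act := (act cP hW).
Local Notation mP := (coxeter_system_matrix hW).
Implicit Types (i j k l : I) (u v : V) (x y w g h : W) (J K L : {set I}).
Local Notation isneg := (isneg cP hW).
Local Notation neg := (neg cP hW).
Local Notation negs p := (neg [set x in p]%SET).
Local Notation realizes z0 := (realizes m z0).

Lemma pair_supp0 i J v : supp J v -> (forall j, j \in J -> m i j = 2%N) -> pair i v = 0.
Proof.
move=> hv hm; apply: big1 => k _; have [kJ|kJ] := boolP (k \in J).
  by rewrite (cox2 cP) ?hm // mul0r.
by rewrite hv // mulr0.
Qed.

Lemma cox3 i j : m i j = 3%N -> cox i j = -1.
Proof. by move=> e; have [_ _ hc] := cP; rewrite coxE e (dcos3 _ (hc 3%N isT)). Qed.

Lemma neg_intro J w : inW J w -> (forall v, supp J v -> act w v = - v) -> neg J.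
Proof. by move=> Jw hw; exists w; split=> // j jJ; apply: hw; apply: supp_sroot. Qed.

(* [s i * w'] acts on the plane of [sroot i] and [pi] as minus a rotation with
   trace [t], and as [-1] on its orthogonal; so its cube, resp. fifth power, is [-1]. *)
Lemma neg_add J i w' (pi : V) (t : R) : i \notin J -> isneg J w' -> supp (i |: J)%SET pi ->
  pi i = 1 :> R -> (forall j, j \in J -> pair j pi = 0) -> pair i pi = (2 - t) / 2 ->
  t = 1 \/ t * t = t + 1 -> neg (i |: J)%SET.
Proof.
move=> iJ hw' spi pii pij piq ht; have [Jw' _] := hw'.
pose x := (s i * w')%g.
have Lx : inW (i |: J)%SET x.
  apply: inWM; first by apply: inW_gen; rewrite !inE eqxx.
  by apply: inWS Jw'; apply: finset.subsetUr.
have xE v : supp (i |: J)%SET v ->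
    act x v = - v + (2 * v i) *: pi + (pair i v - (2 - t) * v i) *: sroot i.
  move=> sv; have e : act w' v = - v + (2 * v i) *: pi.
    have -> : v = (v - v i *: pi) + v i *: pi by rewrite subrK.
    rewrite actD actZ (inW_act_perp cP hW Jw' pij) (isneg_supp hw').
      by apply/ffunP => k; rewrite !vE pii; ring.
    move=> k kJ; have [->|ki] := eqVneq k i; first by rewrite !vE pii mulr1 subrr.
    by rewrite !vE sv ?spi ?mulr0 ?subr0 // !inE negb_or ki.
  rewrite actM e act_genE pairD pairN pairZ piq.
  by apply/ffunP => k; rewrite !vE; field.
clearbody x.
have iL : supp (i |: J)%SET (sroot i) by apply: supp_sroot; rewrite !inE eqxx.
(* The span of [v], [pi] and [sroot i] is stable under [x], which reduces the powers of [x] to three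
   coefficients. *)
have xiterE v (e A B : R) : supp (i |: J)%SET v ->
  act x (e *: v + (2 * A) *: pi + B *: sroot i) =
  (- e) *: v + (2 * (e * v i + A + B)) *: pi +
    (e * (pair i v + (t - 2) * v i) + A * (t - 2) + B * (t - 1)) *: sroot i.
  move=> sv; rewrite xE; last by apply: suppD; [apply: suppD; apply: suppZ | apply: suppZ].
  rewrite !pairD !pairZ piq pair_sroot (cox_diag cP mP).
  by apply/ffunP => k; rewrite !vE pii eqxx /=; field.
have start v : v = 1 *: v + (2 * 0) *: pi + 0 *: sroot i.
  by rewrite scale1r mulr0 !scale0r !addr0.
case: ht => ht.
  apply: (@neg_intro _ (x * (x * x))%g) => [|v sv]; first exact: inWM Lx (inWM Lx Lx).
  rewrite !actM {1}[v]start !xiterE //.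
  by apply/ffunP => k; rewrite !vE ht; ring.
apply: (@neg_intro _ (x * (x * (x * (x * x))))%g) => [|v sv].
  exact: inWM Lx (inWM Lx (inWM Lx (inWM Lx Lx))).
rewrite !actM {1}[v]start !xiterE //.
by apply/ffunP => k; rewrite !vE; ring: ht.
Qed.

Lemma neg_dihedral i j (k : nat) : i != j -> m i j = (2 * k)%N -> (0 < k)%N -> neg [set i; j]%SET.
Proof.
move=> neq mk k0; pose r := (s i * s j)%g.
have [_ _ hc] := cP; have m1 : (1 < m i j)%N by lia.
have dP := hc _ m1.
have rE n v : act (r ^+ n)%g v = iter n (refl m c i \o refl m c j) v.
  elim: n => [|n IH]; first by rewrite act1.
  by rewrite expgS actM IH iterS /= actM !act_gen.
have Lr n : inW [set i; j]%SET (r ^+ n)%g.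
  elim: n => [|n IH]; first exact: inW1.
  by rewrite expgS; apply: inWM => //; apply: inWM; apply: inW_gen; rewrite !inE eqxx ?orbT.
exists (r ^+ k)%g; split=> // l; rewrite !inE => /orP[]/eqP->; rewrite rE.
  rewrite (iter_rot_l cP mP); have -> : k.*2 = m i j by lia.
  rewrite -addn1 (dcosD m1 dP) (dcos_m dP) /chebU /=.
  by apply/ffunP => z; rewrite !vE; ring.
case: k => [|k] // in mk k0 *; rewrite (iter_rot_r cP mP).
have -> : k.*2.+2 = m i j by lia.
have -> : k.*2.+1 = (m i j).-1 by lia.
rewrite (dcos_m dP) (dcos_pred m1 dP).
by apply/ffunP => z; rewrite !vE; ring.
Qed.

(* [sroot b + sigma] is the projection of [sroot b] orthogonal to [q]. *)
Definition tail b (q : seq I) := exists2 sigma : V, supp [set x in q]%SET sigma &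
  (forall j, j \in q -> pair j (sroot b + sigma) = 0) /\ pair b sigma = -1.

(** Along a simple chain the correction for [b] is [sroot a] plus the correction for [a]; only the
    far end, the double edge of B or the fork of D, needs its own computation. *)
Lemma tail_cons b a (q : seq I) : m b a = 3%N -> (forall j, j \in q -> m b j = 2%N) ->
  tail a q -> tail b (a :: q).
Proof.
move=> mba mbq [sg ssg [h1 h2]]; exists (sroot a + sg).
  apply: suppD; first by apply: supp_sroot; rewrite !inE eqxx.
  by apply: suppS ssg; apply/fintype.subsetP => x; rewrite !inE => ->; rewrite orbT.
have bsg : pair b sg = 0 by apply: pair_supp0 ssg _ => j; rewrite inE; apply: mbq.
split; last by rewrite pairD pair_sroot cox3 // bsg addr0.
move=> j; rewrite inE pairD pair_sroot (coxC _ mP) => /orP[/eqP->|jq].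
  by rewrite pairD pair_sroot (cox_diag cP mP) cox3 // h2; lra.
by rewrite h1 // (cox2 cP) ?mbq // addr0.
Qed.

(** Deleting [b] leaves [a] orthogonal to [q], a case settled by [negU]; then [b] is put back with t
    = 1. Types B and D thus descend by two vertices. *)
Lemma neg_cons2 a b (q : seq I) : uniq [:: a, b & q] -> m a b = 3%N -> (forall j, j \in q -> m a j = 2%N) ->
  tail b q -> negs q -> negs [:: a, b & q].
Proof.
move=> u mab maq [sg ssg [h1 h2]] nq.
have /and3P[] := u; rewrite inE negb_or => /andP[ab aq] bq _.
have asg : pair a sg = 0 by apply: pair_supp0 ssg _ => j; rewrite inE; apply: maq.
have -> : [set x in [:: a, b & q]]%SET = (b |: ([set a] :|: [set x in q]))%SET.
  by apply/setP => x; rewrite !inE orbCA.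
have naq : neg ([set a] :|: [set x in q])%SET.
  apply: negU nq; last by exists (s a); apply: isneg_set1.
  by move=> j k; rewrite !inE => /eqP -> /maq.
have [w' hw'] := naq.
(* The projection of [sroot b] orthogonal to [a] and [q]; its pairing with [b] is 2 - 1/2 - 1 =
   1/2. *)
apply: (neg_add (pi := 2^-1 *: sroot a + sroot b + sg) (t := 1) _ hw'); last by left.
- by rewrite !inE negb_or eq_sym ab.
- apply: suppD; last by apply: suppS ssg; apply/fintype.subsetP => x; rewrite !inE => ->; rewrite !orbT.
  by apply: suppD; [apply: suppZ|]; apply: supp_sroot; rewrite !inE eqxx ?orbT.
- by rewrite !vE ssg ?inE // eqxx eq_sym (negbTE ab) /=; ring.
- move=> j; rewrite !inE -addrA pairD pairZ pair_sroot => /orP[/eqP->|jq].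
    by rewrite (cox_diag cP mP) pairD pair_sroot cox3 // asg; field.
  by rewrite h1 // (coxC _ mP) (cox2 cP) ?maq //; ring.
rewrite !pairD pairZ !pair_sroot (cox_diag cP mP) (coxC _ mP) cox3 // h2.
by field.
Qed.

Lemma realizes_behead z0 e e' a (q : seq I) : (forall x y : nat, (x < y)%N -> (y < size q)%N -> e x.+1 y.+1 = e' x y) ->
  realizes z0 e (a :: q) -> realizes z0 e' q.
Proof.
move=> ee [/= /andP[_ u] h]; split=> // x y lxy ly.
by rewrite -ee // -(h x.+1 y.+1).
Qed.

Lemma D_labelS n (x y : nat) : (3 <= n)%N -> (x < y)%N -> (y < n)%N ->
  D_label n.+1 x.+1 y.+1 = D_label n x y.
Proof.
move=> n3 lxy ly; have := @D_label_shift n.+1 1 x y n3 lxy.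
by rewrite subn1 !add1n; apply.
Qed.

Lemma realizes_head z0 e a (q : seq I) (y : nat) : realizes z0 e (a :: q) -> (y < size q)%N ->
  m a (nth z0 q y) = e 0%N y.+1.
Proof. by move=> [_ h] ly; apply: (h 0%N y.+1). Qed.

Lemma B_tail z0 b (q : seq I) : (0 < size q)%N -> realizes z0 (B_label (size q).+1) (b :: q) -> tail b q.
Proof.
elim: q b => // a q IH b _; case: q IH => [|d q] IH r.
  have mba : m b a = 4%N := realizes_head r (ltn0Sn 0).
  have [_ _ hc] := cP; have c4 := @dcos4 R 4 _ isT (hc 4%N isT) erefl.
  have cba : cox b a = - c 4%N by rewrite coxE mba.
  exists ((c 4%N / 2) *: sroot a).
    by apply: suppZ; apply: supp_sroot; rewrite !inE eqxx.
  split; last by rewrite pairZ pair_sroot cba; rewrite expr2 in c4; lra.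
  move=> j; rewrite inE => /eqP ->; rewrite pairD pairZ !pair_sroot (cox_diag cP mP) (coxC _ mP) cba.
  by field.
have r' : realizes z0 (B_label (size (d :: q)).+1) (a :: d :: q).
  apply: realizes_behead r => x y lxy ly; rewrite /B_label /= !eqSS.
  by [].
apply: tail_cons (IH a isT r'); first by have := realizes_head r (ltn0Sn _).
have r2 : forall y : nat, (y < size (d :: q))%N -> m b (nth z0 (d :: q) y) = 2%N.
  by move=> y ly; have := realizes_head r (y := y.+1) ly.
by move=> j jq; rewrite -(nth_index z0 jq) r2 // index_mem.
Qed.

Lemma D_tail z0 b (q : seq I) : (2 <= size q)%N -> realizes z0 (D_label (size q).+1) (b :: q) -> tail b q.
Proof.
elim: q b => // a q IH b; case: q IH => [|d q] // IH _; case: q IH => [|e q] IH r.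
  have mba : m b a = 3%N by have := realizes_head r (y := 0%N) isT.
  have mbd : m b d = 3%N by have := realizes_head r (y := 1%N) isT.
  have mad : m a d = 2%N by have [_ h] := r; apply: (h 1%N 2%N).
  exists (2^-1 *: sroot a + 2^-1 *: sroot d).
    by apply: suppD; apply: suppZ; apply: supp_sroot; rewrite !inE eqxx ?orbT.
  have [cba cbd cad] : [/\ cox b a = -1, cox b d = -1 & cox a d = 0].
    by split; [exact: cox3 | exact: cox3 | exact: cox2 cP _ _ mad].
  split; last by rewrite pairD !pairZ !pair_sroot cba cbd; field.
  move=> j; rewrite !inE => /orP[]/eqP ->; rewrite !pairD !pairZ !pair_sroot (cox_diag cP mP).
    by rewrite (coxC _ mP a b) cba cad; field.
  by rewrite (coxC _ mP d b) (coxC _ mP d a) cbd cad; field.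
have r' : realizes z0 (D_label (size [:: d, e & q]).+1) [:: a, d, e & q].
  apply: realizes_behead r => x y lxy ly; exact: D_labelS.
apply: tail_cons (IH a isT r').
  by have := realizes_head r (y := 0%N) isT.
have r2 : forall y : nat, (y < size [:: d, e & q])%N -> m b (nth z0 [:: d, e & q] y) = 2%N.
  move=> y ly; have := realizes_head r (y := y.+1) ly => /= ->.
  by rewrite /D_label /branch_label /=; case: ifP => // _; rewrite ifF //; lia.
by move=> j jq; rewrite -(nth_index z0 jq) r2 // index_mem.
Qed.

Lemma negs1 a : negs [:: a].
Proof.
by have -> : [set x in [:: a]]%SET = [set a]%SET by [apply/setP => x; rewrite !inE];
  exists (s a); apply: isneg_set1.
Qed.

Lemma neg_B z0 (p : seq I) : (0 < size p)%N -> realizes z0 (B_label (size p)) p -> negs p.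
Proof.
have [n] := ubnP (size p); elim: n p => // n IHn p lt_n.
case: p lt_n => [|a [|b [|d q]]] // lt_n _ r; first exact: negs1.
  have -> : [set x in [:: a; b]]%SET = [set a; b]%SET by apply/setP => x; rewrite !inE.
  have [u h] := r; apply: (@neg_dihedral a b 2) => //; last exact: (h 0%N 1%N).
  by move: u; rewrite /= inE andbT.
have r1 : realizes z0 (B_label (size [:: d & q]).+1) [:: b, d & q].
  by apply: realizes_behead r => x y lxy ly; rewrite /B_label /= !eqSS.
have r2 : realizes z0 (B_label (size [:: d & q])) [:: d & q].
  by apply: realizes_behead r1 => x y lxy ly; rewrite /B_label /= !eqSS.
have [u _] := r; apply: neg_cons2 u _ _ (B_tail _ r1) _ => //.
- by have := realizes_head r (y := 0%N) isT.
- have rr : forall y : nat, (y < size (d :: q))%N -> m a (nth z0 (d :: q) y) = 2%N.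
    by move=> y ly; have := realizes_head r (y := y.+1) ly.
  by move=> j jq; rewrite -(nth_index z0 jq) rr // index_mem.
by apply: IHn => //; move: lt_n => /=; lia.
Qed.

Lemma neg_D z0 (p : seq I) : (4 <= size p)%N -> ~~ odd (size p) -> realizes z0 (D_label (size p)) p -> negs p.
Proof.
have [n] := ubnP (size p); elim: n p => // n IHn p lt_n.
case: p lt_n => [|a [|b [|d [|e q]]]] // lt_n _ ev r.
have r1 : realizes z0 (D_label (size [:: d, e & q]).+1) [:: b, d, e & q].
  apply: realizes_behead r => x y lxy ly; exact: D_labelS.
have [u hr] := r; apply: neg_cons2 u _ _ (D_tail _ r1) _ => //.
- by have := realizes_head r (y := 0%N) isT.
- have rr : forall y : nat, (y < size [:: d, e & q])%N -> m a (nth z0 [:: d, e & q] y) = 2%N.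
    move=> y ly; have := realizes_head r (y := y.+1) ly => /= ->.
    by rewrite /D_label /branch_label /=; case: ifP => // _; rewrite ifF //; lia.
  by move=> j jq; rewrite -(nth_index z0 jq) rr // index_mem.
case: q => [|f q] in lt_n ev r r1 hr *.
  have -> : [set x in [:: d; e]]%SET = ([set d] :|: [set e])%SET by apply/setP => x; rewrite !inE.
  apply: negU; [|by exists (s d); apply: isneg_set1 | by exists (s e); apply: isneg_set1].
  by move=> j k; rewrite !inE => /eqP -> /eqP ->; apply: (hr 2%N 3%N).
case: q => [|g q] // in lt_n ev r r1 hr *.
apply: IHn; rewrite //=; first by move: lt_n => /=; lia.
  by move: ev; rewrite /= !negbK.
apply: realizes_behead r1 => x y lxy ly; exact: D_labelS.
Qed.

End NegListed.

(** * Exceptional types *)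

Section NegExceptional.
Variables (R : rcfType) (c : nat -> R) (cP : dcos_family c).
Variables (I : finType) (m : I -> I -> nat) (W : groupType) (s : I -> W).
Hypothesis hW : coxeter_system m s.
Local Notation V := {ffun I -> R^o}.
Local Notation sroot := (@sroot R I).
Local Notation pair := (@pair R I m c).
Local Notation mP := (coxeter_system_matrix hW).
Implicit Types (i j k l : I) (u v : V) (x y w g h : W) (J K L : {set I}).
Local Notation neg := (neg cP hW).
Local Notation negs p := (neg [set x in p]%SET).
Local Notation realizes z0 := (realizes m z0).
Local Notation listed_seq z0 := (listed_seq m z0).

Lemma pair_sum i (T : Type) (r : seq T) (F : T -> V) :
  pair i (\sum_(t <- r) F t) = \sum_(t <- r) pair i (F t).
Proof. exact: (big_morph (pair i) (pairD m c i) (pair0 m c i)). Qed.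

(** [neg_add] in coordinates: [cs] is the projection of the root of [i0] orthogonal to the other
    roots, that is, a column of the inverse Gram matrix scaled to 1 at [i0]. *)
Lemma neg_vec z0 e (p : seq I) (i0 : nat) (idx : seq nat) (cs : seq R) (t : R) :
  realizes z0 e p -> negs [seq nth z0 p a | a <- idx] -> perm_eq (i0 :: idx) (iota 0 (size p)) ->
  nth 0 cs i0 = 1 -> t = 1 \/ t * t = t + 1 ->
  (forall j : nat, (j < size p)%N ->
    \sum_(k <- iota 0 (size p)) (- c (matrix_of_labels e j k)) * nth 0 cs k =
    if j == i0 then (2 - t) / 2 else 0) -> negs p.
Proof.
move=> r nq pe cs0 ht hcs; have [u _] := r; set q := [seq _ | _ <- _] in nq.
have eqp : [seq nth z0 p a | a <- i0 :: idx] =i p := reindex_mem z0 pe.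
have uq : uniq [seq nth z0 p a | a <- i0 :: idx].
  by rewrite (perm_uniq (perm_map _ pe)) map_nth_iota0 // take_size.
have l0 : (i0 < size p)%N by have := mem_head i0 idx; rewrite (perm_mem pe) mem_iota.
pose i := nth z0 p i0.
have iq : i \notin q by move: uq => /= /andP[].
have -> : [set x in p]%SET = (i |: [set x in q])%SET.
  by apply/setP => x; rewrite !finset.in_set -eqp !inE.
have [w' hw'] := nq.
pose pi : V := \sum_(k <- iota 0 (size p)) nth 0 cs k *: sroot (nth z0 p k).
have ppi (j : nat) : (j < size p)%N -> pair (nth z0 p j) pi = if j == i0 then (2 - t) / 2 else 0.
  move=> lj; rewrite -hcs // pair_sum big_seq [RHS]big_seq; apply: eq_bigr => k.
  rewrite mem_iota add0n => /= lk.
  by rewrite pairZ pair_sroot coxE (realizes_matrix mP r) // mulrC.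
apply: (neg_add (pi := pi) _ hw' _ _ _ _ ht).
- by rewrite finset.in_set.
- move=> x; rewrite !inE => xn; rewrite sum_ffunE big_seq big1 // => k.
  rewrite mem_iota add0n => /= lk; rewrite !vE; case: eqP => [ex|]; last by rewrite mulr0.
  by move: xn; rewrite -in_cons -[i :: q]/[seq nth z0 p a | a <- i0 :: idx] eqp ex mem_nth.
- rewrite sum_ffunE (bigD1_seq i0) ?iota_uniq ?mem_iota //= !vE eqxx cs0 mul1r.
  rewrite big_seq_cond big1 ?addr0 // => k; rewrite mem_iota add0n => /= /andP[lk ki].
  by rewrite !vE nth_uniq // eq_sym (negbTE ki) mulr0.
- move=> j; rewrite finset.in_set => /mapP[k kidx ->].
  have lk : (k < size p)%N.
    by have : k \in i0 :: idx by [rewrite inE kidx orbT]; rewrite (perm_mem pe) mem_iota.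
  rewrite ppi // ifF //; apply: contraNF iq => /eqP ek; rewrite /i -ek; exact: map_f.
- by rewrite ppi // eqxx.
Qed.

Let c1 : c 1%N = -2. Proof. by case: cP. Qed.
Let c2 : c 2%N = 0. Proof. by have [_ _ hc] := cP; rewrite (dcos2 (hc 2%N isT) erefl). Qed.
Let c3 : c 3%N = 1. Proof. by have [_ _ hc] := cP; rewrite (dcos3 _ (hc 3%N isT)). Qed.
Let c4 : c 4%N * c 4%N = 2.
Proof. by have [_ _ hc] := cP; rewrite -expr2 (dcos4 _ (hc 4%N isT)). Qed.
Let c5 : c 5%N * c 5%N = c 5%N + 1.
Proof. by have [_ _ hc] := cP; rewrite -expr2 (dcos5 _ (hc 5%N isT)). Qed.

(** Deleting the end of the arm of length 2 leaves D_6. In the same way E8 is reduced to E7, F4 to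
    B_3 and H4 to H3 by deleting an end vertex. *)
Lemma neg_E7 z0 p : size p = 7%N -> realizes z0 (branch_label 7 2) p -> negs p.
Proof.
move=> sp r; have r' : realizes z0 (D_label 6) [seq nth z0 p a | a <- [:: 5; 4; 3; 2; 1; 6]%N].
  by apply: (realizes_reindex mP r); rewrite sp.
apply: (neg_vec (i0 := 0) (idx := [:: 5; 4; 3; 2; 1; 6]%N) (t := 1)
  (cs := [:: 1; 3 / 2; 2; 3 / 2; 1; 1 / 2; 1]) r); rewrite ?sp //.
- exact: neg_D r'.
- by left.
case=> [|[|[|[|[|[|[|j]]]]]]] //= _; rewrite !big_cons big_nil /matrix_of_labels /branch_label /= ?c1 ?c2 ?c3; by field.
Qed.

Lemma neg_E8 z0 p : size p = 8%N -> realizes z0 (branch_label 8 2) p -> negs p.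
Proof.
move=> sp r; have r' : realizes z0 (branch_label 7 2) [seq nth z0 p a | a <- [:: 0; 1; 2; 3; 4; 5; 7]%N].
  by apply: (realizes_reindex mP r); rewrite sp.
apply: (neg_vec (i0 := 6) (idx := [:: 0; 1; 2; 3; 4; 5; 7]%N) (t := 1)
  (cs := [:: 1; 2; 3; 5 / 2; 2; 3 / 2; 1; 3 / 2]) r); rewrite ?sp //.
- exact: neg_E7 r'.
- by left.
case=> [|[|[|[|[|[|[|[|j]]]]]]]] //= _; rewrite !big_cons big_nil /matrix_of_labels /branch_label /= ?c1 ?c2 ?c3; by field.
Qed.

Lemma neg_F4 z0 p : size p = 4%N -> realizes z0 (path_label [:: 3; 4; 3]%N) p -> negs p.
Proof.
move=> sp r; have r' : realizes z0 (B_label 3) [seq nth z0 p a | a <- [:: 3; 2; 1]%N].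
  by apply: (realizes_reindex mP r); rewrite sp.
apply: (neg_vec (i0 := 0) (idx := [:: 3; 2; 1]%N) (t := 1)
  (cs := [:: 1; 3 / 2; c 4%N; c 4%N / 2]) r); rewrite ?sp //.
- exact: neg_B r'.
- by left.
by case=> [|[|[|[|j]]]] //= _; rewrite !big_cons big_nil /matrix_of_labels /path_label /= ?c1 ?c2 ?c3; move: c4 => h; lra.
Qed.

(** The middle vertex is deleted, leaving two orthogonal roots; [t] is the golden ratio, hence a
    fifth power in [neg_add]. *)
Lemma neg_H3 z0 p : size p = 3%N -> realizes z0 (path_label [:: 3; 5]%N) p -> negs p.
Proof.
move=> sp r.
apply: (neg_vec (i0 := 1) (idx := [:: 0; 2]%N) (t := c 5%N)
  (cs := [:: 1 / 2; 1; c 5%N / 2]) r); rewrite ?sp //.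
- rewrite /=; set a := nth _ _ 0; set b := nth _ _ 2.
  have -> : [set x in [:: a; b]]%SET = ([set a] :|: [set b])%SET by apply/setP => x; rewrite !inE.
  apply: negU; [|by exists (s a); apply: isneg_set1 | by exists (s b); apply: isneg_set1].
  move=> j k; rewrite !inE => /eqP -> /eqP ->; have [_ h] := r; apply: (h 0%N 2%N) => //.
  by rewrite sp.
- by right.
by case=> [|[|[|j]]] //= _; rewrite !big_cons big_nil /matrix_of_labels /path_label /= ?c1 ?c2 ?c3; move: c5 => h; lra.
Qed.

Lemma neg_H4 z0 p : size p = 4%N -> realizes z0 (path_label [:: 3; 3; 5]%N) p -> negs p.
Proof.
move=> sp r; have r' : realizes z0 (path_label [:: 3; 5]%N) [seq nth z0 p a | a <- [:: 1; 2; 3]%N].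
  by apply: (realizes_reindex mP r); rewrite sp.
apply: (neg_vec (i0 := 0) (idx := [:: 1; 2; 3]%N) (t := c 5%N)
  (cs := [:: 1; (2 + c 5%N) / 2; c 5%N + 1; (2 * c 5%N + 1) / 2]) r); rewrite ?sp //.
- exact: neg_H3 r'.
- by right.
by case=> [|[|[|[|j]]]] //= _; rewrite !big_cons big_nil /matrix_of_labels /path_label /= ?c1 ?c2 ?c3; move: c5 => h; lra.
Qed.

Lemma neg_listed z0 p : listed_seq z0 p -> uniq p -> negs p.
Proof.
case=> [h|h r|h o r|h r|h r|h r|k h k2 r|h r|h r] u.
- by case: p h u => [|a [|]] // _ _; apply: negs1.
- exact: neg_B (ltnW h) r.
- exact: neg_D r.
- exact: neg_E7 r.
- exact: neg_E8 r.
- exact: neg_F4 r.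
- case: p h u r => [|a [|b [|]]] // _ u [_ r].
  have -> : [set x in [:: a; b]]%SET = [set a; b]%SET by apply/setP => x; rewrite !inE.
  apply: (@neg_dihedral _ _ cP _ _ _ _ hW a b k); last by lia.
    by move: u; rewrite /= inE andbT.
  exact: (r 0%N 1%N).
- exact: neg_H3 r.
- exact: neg_H4 r.
Qed.

Lemma neg_has_listed_type C : has_listed_type m C -> neg C.
Proof.
have [z0 _|none] := pickP (predT : pred I).
  by move=> /(has_listed_typeP mP z0)[p [u lp ->]]; apply: neg_listed lp u.
by case=> n [M [f [_ _ -> _]]]; exists 1%g; split; [exact: inW1 | move=> j; have := none j].
Qed.

Lemma component_setD K (x y : I) : x \in K -> y \in (K :\: subdiagram_component m K x)%SET ->
  subdiagram_component m (K :\: subdiagram_component m K x)%SET y = subdiagram_component m K y.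
Proof.
move=> xK; set D := subdiagram_component m K x; rewrite inE => /andP[yD yK].
apply/setP => z; rewrite !componentP; apply/idP/idP; first by apply: connS; apply: finset.subsetDl.
case/connectP => p py ->; elim: p y py yD yK => [|t p IH] y; first by rewrite /= connect0.
move=> /= /andP[/and3P[_ tK yt] pt] yD yK.
have tD : t \notin D.
  rewrite componentP; apply: contra yD => xt; rewrite componentP.
  by apply: connect_trans xt _; apply: conn_edge => //; rewrite (edgeC mP).
by apply: connect_trans (IH t pt tD tK); apply: conn_edge; rewrite ?finset.in_setD ?yD ?yK ?tD ?tK.
Qed.

Lemma neg_of_components J :
  (forall x : I, x \in J -> has_listed_type m (subdiagram_component m J x)) -> neg J.
Proof.
have [n] := ubnP #|J|; elim: n J => // n IHn J lt_n hJ.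
have [x xJ|J0] := pickP (mem J); last first.
  by exists 1%g; split; [exact: inW1 | move=> j jJ; have := J0 j; rewrite /= jJ].
pose D := subdiagram_component m J x.
have DJ : D \subset J := component_sub m xJ.
have xD : x \in D by rewrite componentP connect0.
have -> : J = (D :|: (J :\: D))%SET by rewrite -{1}(finset.setID J D) (finset.setIidPr DJ).
apply: negU.
- move=> j k jD; rewrite inE => /andP[kD kJ]; apply/eqP.
  have jJ := fintype.subsetP DJ _ jD.
  have neq : j != k by apply: contraNneq kD => <-.
  rewrite -[_ == _]negbK; apply: contra kD => h.
  rewrite componentP; rewrite componentP in jD; apply: connect_trans jD _.
  by apply: conn_edge => //; rewrite /edge /diagram_edge neq.
- exact/neg_has_listed_type/hJ.
apply: IHn => [|y yD].
  rewrite ltnS in lt_n; apply: leq_trans lt_n; apply: proper_card; apply/fintype.properP.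
  by split; [apply: finset.subsetDl | exists x; rewrite // inE xD].
by rewrite component_setD //; apply: hJ; move: yD; rewrite inE => /andP[].
Qed.

End NegExceptional.

(** * Longest elements acting by a diagram automorphism *)

Section Twist.
Variables (R : rcfType) (c : nat -> R) (cP : dcos_family c).
Variables (I : finType) (m : I -> I -> nat) (W : groupType) (s : I -> W).
Hypothesis hW : coxeter_system m s.
Local Notation V := {ffun I -> R^o}.
Local Notation sroot := (@sroot R I).
Local Notation pair := (@pair R I m c).
Local Notation form := (@form R I m c).
Local Notation cox := (@cox R I m c).
Local Notation wprod := (wprod s).
Local Notation inW := (inW s).
Local Notation act := (act cP hW).
Local Notation mP := (coxeter_system_matrix hW).
Implicit Types (i j k l : I) (u v : V) (x y w g h : W) (J K L : {set I}).
Local Notation neg := (neg cP hW).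
Local Notation realizes z0 := (realizes m z0).
Local Notation comp := (subdiagram_component m).

(** [w * s a] negates the other roots and fixes [sroot a]. Its minimal representative modulo the
    smaller parabolic is nonnegative on all of [J], hence trivial. *)
Lemma neg_drop J a : neg J -> a \in J -> (forall j, j \in (J :\ a)%SET -> m a j = 2%N) ->
  neg (J :\ a)%SET.
Proof.
move=> [w hw] aJ ha; have [Jw hwJ] := hw.
have Ja : inW J (s a) by apply: inW_gen.
have pa j : j \in (J :\ a)%SET -> pair a (sroot j) = 0.
  by move=> jJ; rewrite pair_sroot (cox2 cP) // ha.
pose z := (w * s a)%g; have Jz : inW J z by apply: inWM.
have zj j : j \in (J :\ a)%SET -> act z (sroot j) = - sroot j.
  move=> jJ; rewrite actM act_genE pa // scale0r subr0 hwJ //.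
  by move: jJ; rewrite inE => /andP[].
have za : act z (sroot a) = sroot a by rewrite actM act_gen_sroot actN hwJ // opprK.
have [y [u [ezyu Xu hy _]]] := coset_min cP hW z (J :\ a)%SET.
have Ju : inW J u by apply: inWS Xu; apply: finset.subD1set.
have ey : y = (z * u^-1)%g by rewrite ezyu mulgK.
suff y1 : y = 1%g by exists z; split=> //; rewrite ezyu y1 mul1g.
apply: (@inW_eq1 _ _ cP _ _ _ _ hW J).
  by rewrite ey; apply: inWM => //; apply: (inWV hW).
move=> j jJ; have [->|ja] := eqVneq j a; last by apply: hy; rewrite !inE ja.
rewrite ey actM (inW_act_perp cP hW (inWV hW Xu)) ?za; first exact: ge0_sroot.
by move=> k kJ; rewrite pair_sroot (coxC _ mP) (cox2 cP) // ha.
Qed.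

Lemma odd_rotation i j : i != j -> odd (m i j) -> exists2 r, inW [set i; j]%SET r &
  act r (sroot i) = sroot j /\ act r (sroot j) = - (sroot i + c (m i j) *: sroot j).
Proof.
move=> neq om; have m1 := cox_matrix_neq1 mP neq.
have m3 : (2 < m i j)%N by case: (m i j) om m1 => [|[|[|n]]].
have [_ _ hc] := cP; have m2 : (1 < m i j)%N by lia.
have dP := hc _ m2.
pose k := (m i j)./2; pose r := (s i * s j)%g.
have rE n v : act (r ^+ n)%g v = iter n (refl m c i \o refl m c j) v.
  elim: n => [|n IH]; first by rewrite act1.
  by rewrite expgS actM IH iterS /= actM !act_gen.
have Lr n : inW [set i; j]%SET (r ^+ n)%g.
  elim: n => [|n IH]; first exact: inW1.
  by rewrite expgS; apply: inWM => //; apply: inWM; apply: inW_gen; rewrite !inE eqxx ?orbT.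
exists (r ^+ k)%g => //; rewrite !rE; split.
  rewrite (iter_rot_l cP mP); have -> : k.*2.+1 = m i j by rewrite /k; lia.
  have -> : k.*2 = (m i j).-1 by rewrite /k; lia.
  by rewrite (dcos_m dP) (dcos_pred m2 dP) scale0r add0r scale1r.
have ek : k = k.-1.+1 by rewrite /k; lia.
rewrite ek (iter_rot_r cP mP); have -> : k.-1.*2.+2 = (m i j).-1 by rewrite /k; lia.
have -> : k.-1.*2.+1 = (m i j - 2)%N by rewrite /k; lia.
rewrite (dcos_pred m2 dP) scale1r; congr (- (_ + _ *: _)).
have := chebUSS (c (m i j)) (m i j - 2); have -> : (m i j - 2).+2 = m i j by lia.
have -> : (m i j - 2).+1 = (m i j).-1 by lia.
by rewrite (dcos_m dP) (dcos_pred m2 dP); lra.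
Qed.

Lemma odd_dihedral_longest i j : i != j -> odd (m i j) -> exists2 y, inW [set i; j]%SET y &
  act y (sroot i) = - sroot j /\ act y (sroot j) = - sroot i.
Proof.
move=> neq om; have [r Lr [ri rj]] := odd_rotation neq om.
exists (s j * r)%g; first by apply: inWM => //; apply: inW_gen; rewrite !inE eqxx orbT.
rewrite !actM ri rj act_gen_sroot; split=> //.
rewrite actN actD actZ act_gen_sroot act_genE pair_sroot (coxC _ mP) coxE.
by apply/ffunP => k; rewrite !vE; ring.
Qed.

Definition path3_label (i j : nat) : nat := if j == i.+1 then 3%N else 2%N.
Local Notation rsum p := (\sum_(z <- p) sroot z).

Lemma rsum_pair0 i (p : seq I) : (forall z, z \in p -> m i z = 2%N) -> pair i (rsum p) = 0.
Proof.
move=> h; rewrite pair_sum big_seq big1 // => z zp.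
by rewrite pair_sroot (cox2 cP) // h.
Qed.

Lemma rsum_off (p : seq I) k : k \notin p -> rsum p k = 0 :> R.
Proof.
move=> kp; rewrite sum_ffunE big_seq big1 // => z zp; rewrite vE.
by case: eqP kp => // ->; rewrite zp.
Qed.

Lemma path3_behead z0 a q : realizes z0 path3_label (a :: q) -> realizes z0 path3_label q.
Proof. by apply: realizes_behead => x y _ _; rewrite /path3_label eqSS. Qed.

Lemma path3_head z0 b d q : realizes z0 path3_label [:: b, d & q] -> pair b (rsum (d :: q)) = -1.
Proof.
move=> r; rewrite big_cons pairD pair_sroot (cox3 cP); last by have := realizes_head r (y := 0%N) isT.
rewrite rsum_pair0 ?addr0 // => z zq.
by rewrite -(nth_index z0 zq); have := realizes_head r (y := (index z q).+1); rewrite /= ltnS index_mem; apply.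
Qed.

Lemma path3_pair z0 (r : seq I) (i : nat) : realizes z0 path3_label r -> (i < size r)%N ->
  pair (nth z0 r i) (rsum r) = (i == 0%N)%:R + (i == (size r).-1)%:R.
Proof.
elim: r i => [|b r IH] [|i] hr // li; rewrite big_cons pairD pair_sroot.
  rewrite /= (cox_diag cP mP); case: r hr {IH li} => [|d r] hr.
    by rewrite big_nil pair0 addr0.
  by rewrite (path3_head hr) /=; lra.
rewrite /= ltnS in li *; rewrite (IH _ (path3_behead hr) li).
have mb : m b (nth z0 r i) = path3_label 0 i.+1 := realizes_head hr li.
rewrite (coxC _ mP); case: i li mb => [|i] li mb.
  by rewrite (cox3 cP) //= ; case: r li {IH hr mb} => //= d r _; lra.
by rewrite (cox2 cP) //=; case: r li {IH hr mb} => //= d r _; rewrite eqSS; lra.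
Qed.

Lemma path3_root z0 t (x : I) : realizes z0 path3_label (rcons t x) ->
  act (wprod t) (sroot x) = rsum (rcons t x).
Proof.
elim: t => [|b t IH] hr; first by rewrite /= act1 big_seq1.
rewrite /= actM (IH (path3_behead hr)) act_genE big_cons.
have -> : pair b (rsum (rcons t x)) = -1.
  by case: t hr {IH} => [|d t] hr; apply: (path3_head hr).
by rewrite scaleN1r opprK addrC.
Qed.

Definition twist L y (f : I -> I) :=
  inW L y /\ forall l, l \in L -> f l \in L /\ act y (sroot l) = - sroot (f l).

(** In the usual coordinates of D_n, with [a] = e_1 - e_2, [x] = e_(n-1) - e_n and [y] = e_(n-1) +
    e_n, one has b1 = e_1 - e_n and b2 = e_1 + e_n. The product [g] of their reflections negates e_1
    and e_n, while [w] negates e_2, ..., e_n. So [g * w] is minus the sign change of e_n, which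
    swaps [x] and [y]. *)
Lemma D_twist L a q : a \in L -> comp L a = [set x in a :: q]%SET -> (2 <= size q)%N ->
  realizes a (D_label (size q).+1) (a :: q) -> neg (L :\ a)%SET ->
  exists y f, [/\ twist L y f, forall l, f (f l) = l, exists2 l, l \in L & f l != l & f a = a].
Proof.
move=> aL Ca s2 hr [w hw]; have [Jw hwJ] := hw.
have CL : comp L a \subset L := component_sub m aL.
have [t [x [y et]]] : exists t (x y : I), a :: q = rcons (rcons (a :: t) x) y.
  case/lastP: q s2 {Ca hr} => [|q y] //; rewrite size_rcons.
  by case/lastP: q => [|q x] // _; exists q, x, y.
have memC z : (z \in comp L a) = (z \in a :: q) by rewrite Ca finset.in_set.
have sq : (size q).+1 = (size t).+3 by have := congr1 size et; rewrite /= !size_rcons.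
rewrite sq et in hr.
have r1 : realizes a path3_label (rcons (a :: t) x).
  have [u h] := hr; split; first by move: u; rewrite rcons_uniq => /andP[].
  move=> i j lij; rewrite size_rcons => lj; have := h i j lij.
  rewrite !size_rcons leqW // => /(_ isT).
  rewrite !(nth_rcons _ (rcons _ _)) size_rcons lj (ltn_trans lij lj) => ->.
  by rewrite /D_label /branch_label /path3_label /= ifF //; move: lj => /=; lia.
have r2 : realizes a path3_label (rcons (a :: t) y).
  have [u h] := hr; split.
    by move: u; rewrite !rcons_uniq !(mem_rcons, inE) !negb_or => /andP[/andP[_ ->] /andP[_ ->]].
  move=> i j lij; rewrite size_rcons ltnS leq_eqVlt => /orP[/eqP ej|lj].
    have := h i j.+1 (leqW lij); rewrite ej !size_rcons ltnSn => /(_ isT).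
    have li : (i < size (a :: t))%N by rewrite -ej.
    rewrite !nth_rcons !size_rcons ltnn eqxx ltnn eqxx !li (ltn_trans li (ltnSn _)) => ->.
    rewrite /D_label /branch_label /path3_label /= eqxx.
    by have -> : (i == ((size t).+3 - 3)%N) = ((size t).+1 == i.+1) by lia.
  have li := ltn_trans lij lj.
  have := h i j lij; rewrite !size_rcons (leqW (leqW lj)) => /(_ isT).
  rewrite !nth_rcons !size_rcons lj li (leqW lj) (leqW li) => ->.
  by rewrite /D_label /branch_label /path3_label /= ifF //; move: lj => /=; lia.
have mxy : m x y = 2%N.
  have [_ h] := hr; have := h (size t).+1 (size t).+2 (ltnSn _).
  rewrite !size_rcons /= => /(_ (ltnSn _)).
  rewrite !nth_rcons !size_rcons ltnSn !ltnn !eqxx => ->.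
  by rewrite /D_label /branch_label /= eqxx ifF //; lia.
have inC z : z \in comp L a -> z \in L by apply: (fintype.subsetP CL).
have pL z : z \in rcons (rcons (a :: t) x) y -> z \in L by rewrite -et -memC; apply: inC.
have xL : x \in L by apply: pL; rewrite !(mem_rcons, inE) eqxx !orbT.
have yL : y \in L by apply: pL; rewrite !(mem_rcons, inE) eqxx.
have tL : {subset a :: t <= L} by move=> z zt; apply: pL; rewrite !(mem_rcons, inE) -in_cons zt !orbT.
have [u _] := hr.
have [nay nax nxy] : [/\ a != y, a != x & x != y].
  move: u; rewrite !rcons_uniq !(mem_rcons, inE) !negb_or.
  by case/andP=> /and3P[h1 h2 _] /andP[/andP[h3 _] _]; rewrite !(eq_sym _ y) h1 h2 eq_sym h3.
set b1 := rsum (rcons (a :: t) x); set b2 := rsum (rcons (a :: t) y).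
have b1E : b1 = rsum (a :: t) + sroot x by rewrite /b1 -cats1 big_cat big_seq1.
have b2E : b2 = rsum (a :: t) + sroot y by rewrite /b2 -cats1 big_cat big_seq1.
have hx := path3_root r1; have hy := path3_root r2; rewrite -/b1 -/b2 in hx hy.
have xb1 : pair x b1 = 1.
  have := path3_pair (i := (size t).+1) r1; rewrite size_rcons nth_rcons ltnn eqxx => /(_ (ltnSn _)) ->.
  by rewrite add0r.
have yb2 : pair y b2 = 1.
  have := path3_pair (i := (size t).+1) r2; rewrite size_rcons nth_rcons ltnn eqxx => /(_ (ltnSn _)) ->.
  by rewrite add0r.
have cxy : cox x y = 0 by rewrite (cox2 cP).
have cyx : cox y x = 0 by rewrite (coxC _ mP).
have xb2 : pair x b2 = -1.
  by move: xb1; rewrite b1E b2E !pairD !pair_sroot (cox_diag cP mP) cxy; lra.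
have yb1 : pair y b1 = -1.
  by move: yb2; rewrite b1E b2E !pairD !pair_sroot (cox_diag cP mP) cyx; lra.
have ab : pair a b1 = 1 /\ pair a b2 = 1.
  have := path3_pair (i := 0) r1; have := path3_pair (i := 0) r2; rewrite !size_rcons /= => -> // -> //.
  by rewrite addr0.
have tb j : j \in L -> j != a -> j != x -> j != y -> pair j b1 = 0 /\ pair j b2 = 0.
  move=> jL ja jx jy; have [jt|jt] := boolP (j \in a :: t); last first.
    have jC : j \notin comp L a.
      by rewrite memC et !(mem_rcons, inE) !negb_or jx jy -negb_or -in_cons.
    have jz z : z \in comp L a -> m j z = 2%N.
      move=> zC; apply/eqP; rewrite -[_ == _]negbK; apply: contra jC => h.
      rewrite componentP; have := zC; rewrite componentP => az; apply: connect_trans az _.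
      apply: conn_edge => //; first exact: inC.
      rewrite (edgeC mP) /edge /diagram_edge h andbT; apply: contraNneq jt => ejz.
      by move: zC; rewrite -ejz memC et !(mem_rcons, inE) (negbTE jx) (negbTE jy).
    by split; apply: rsum_pair0 => z; rewrite mem_rcons => zr; apply: jz; rewrite memC et;
      move: zr; rewrite !(mem_rcons, inE) => /orP[->|->]; rewrite ?orbT.
  have lj : (index j (a :: t) < size (a :: t))%N by rewrite index_mem.
  have nj (v : I) : nth a (rcons (a :: t) v) (index j (a :: t)) = j by rewrite nth_rcons lj nth_index.
  have j0 : (index j (a :: t) == 0%N) = false by rewrite /= (eq_sym a) (negbTE ja).
  have := path3_pair (i := index j (a :: t)) r1; have := path3_pair (i := index j (a :: t)) r2.
  rewrite !nj !size_rcons j0 (ltn_eqF lj) addr0 => h2 h1.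
  by split; [apply: h1 | apply: h2]; rewrite ltnW.
pose h := wprod (a :: t); have Lh : inW L h by exists (a :: t).
(* [h] takes [sroot x] and [sroot y] to b1 and b2, so [g] is the product of the reflections in b1
   and b2. *)
rewrite -/h in hx hy; clearbody h; pose g := (h * (s x * s y) * h^-1)%g.
have gE v : act g v = v - form v b1 *: b1 - form v b2 *: b2.
  rewrite !actM !act_genE pairB pairZ pair_sroot cxy mulr0 subr0 !actB !actZ actKV.
  rewrite hx hy -!(form_sroot m c) -[form (sroot x) _](act_form cP hW h).
  rewrite -[form (sroot y) _](act_form cP hW h) actKV hx hy !(formC _ mP v).
  by rewrite addrAC.
have Lg : inW L g.
  by apply: inWM; [apply: inWM => //; apply: inWM; apply: inW_gen | apply: (inWV hW)].
have gb1 : act g b1 = - b1.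
  rewrite -hx !actM actK [act (s y) _]act_genE pair_sroot cyx scale0r subr0 act_gen_sroot.
  by rewrite actN hx.
have gb2 : act g b2 = - b2.
  by rewrite -hy !actM actK act_gen_sroot actN act_genE pair_sroot cxy scale0r subr0 actN hy.
have gj j : act g (sroot j) = sroot j - pair j b1 *: b1 - pair j b2 *: b2.
  by rewrite gE !form_sroot.
have LJ : inW L w by apply: inWS Jw; apply: finset.subD1set.
(* b1 + b2 is orthogonal to every root of [L] but [a], and differs from twice [sroot a] by a vector
   in the span of the others; this determines [w] on [sroot a]. *)
have wb : act w (b1 + b2) = b1 + b2.
  apply: (inW_act_perp cP hW Jw) => j; rewrite !inE pairD => /andP[ja jL].
  have [->|jx] := eqVneq j x; first by rewrite xb1 xb2 addrN.
  have [->|jy] := eqVneq j y; first by rewrite yb1 yb2 addNr.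
  by have [-> ->] := tb j jL ja jx jy; rewrite addr0.
have wa : act w (sroot a) = - sroot a + (b1 + b2).
  have sv : supp (L :\ a)%SET (b1 + b2 - 2 *: sroot a).
    move=> k; rewrite !inE negb_and negbK => kn; rewrite !vE !b1E !b2E !vE.
    have at0 : a \notin t by move: u; rewrite !rcons_uniq => /and3P[_ _ /andP[]].
    have [->|ka] := eqVneq k a.
      by rewrite big_cons vE (rsum_off at0) !vE eqxx (negbTE nax) (negbTE nay) /=; lra.
    rewrite (negbTE ka) /= in kn.
    have kz z : z \in L -> (k == z) = false by move=> zL; apply: contraNF kn => /eqP ->.
    by rewrite rsum_off ?(kz x) ?(kz y) //=; [lra | apply: contra kn => /tL].
  have := isneg_supp hw sv; rewrite actB wb actZ => e.
  by apply/ffunP => k; have /ffunP/(_ k) := e; rewrite !vE; lra.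
pose f l := if l == x then y else if l == y then x else l.
exists (g * w)%g, f; split.
- split; first exact: inWM.
  move=> l lL; rewrite actM /f; have [->|lx] := eqVneq l x.
    split=> //; rewrite hwJ ?inE ?xL ?(eq_sym x) ?nax // actN gj xb1 xb2 b1E b2E.
    by apply/ffunP => k; rewrite !vE; ring.
  have [->|ly] := eqVneq l y.
    split=> //; rewrite hwJ ?inE ?yL ?(eq_sym y) ?nay // actN gj yb1 yb2 b1E b2E.
    by apply/ffunP => k; rewrite !vE; ring.
  split=> //; have [->|la] := eqVneq l a.
    rewrite wa !actD actN gj gb1 gb2; have [-> ->] := ab.
    by apply/ffunP => k; rewrite !vE; ring.
  rewrite hwJ ?inE ?lL ?la // actN gj; have [-> ->] := tb l lL la lx ly.
  by rewrite !scale0r !subr0.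
- move=> l; rewrite /f; have [->|lx] := eqVneq l x; first by rewrite eqxx eq_sym (negbTE nxy).
  by have [->|ly] := eqVneq l y; rewrite ?eqxx // (negbTE lx) (negbTE ly).
- by exists x => //; rewrite /f eqxx eq_sym.
by rewrite /f (negbTE nax) (negbTE nay).
Qed.

Lemma dihedral_twist L k a : k \in L -> comp L k = [set k; a]%SET -> k != a -> odd (m k a) ->
  neg (L :\ k)%SET ->
  (forall l, l \in L -> l != k -> l != a -> m k l = 2%N /\ m a l = 2%N) /\
  exists y f, [/\ twist L y f, forall l, f (f l) = l, f k = a
    & forall l, l != k -> l != a -> f l = l].
Proof.
move=> kL Ck ka om nJ; have CL : comp L k \subset L := component_sub m kL.
have aL : a \in L by apply: (fintype.subsetP CL); rewrite Ck !inE eqxx orbT.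
have kC : k \in comp L k by rewrite Ck !inE eqxx.
have aC : a \in comp L k by rewrite Ck !inE eqxx orbT.
have far z l : z \in comp L k -> l \in L -> l != k -> l != a -> m z l = 2%N.
  move=> zC lL lk la; have lC : l \notin comp L k by rewrite Ck !inE negb_or lk la.
  apply/eqP; rewrite -[_ == _]negbK; apply: contra lC => h.
  have := zC; rewrite !componentP => kz; apply: connect_trans kz _.
  apply: conn_edge => //; first exact: (fintype.subsetP CL).
  rewrite /edge /diagram_edge h andbT; apply: contraNneq lk => ezl.
  by move: zC; rewrite ezl Ck !inE (negbTE la) orbF.
split; first by move=> l lL lk la; split; apply: far.
have [w [Xw hw]] : neg ((L :\ k) :\ a)%SET.
  apply: neg_drop nJ _ _; first by rewrite !inE eq_sym ka.
  by move=> j; rewrite !inE => /and3P[ja jk jL]; apply: far.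
have [y Cy [yk ya]] := odd_dihedral_longest ka om.
pose f l := if l == k then a else if l == a then k else l.
exists (y * w)%g, f; split.
- split.
    apply: inWM.
      by apply: inWS Cy; apply/fintype.subsetP => z; rewrite !inE => /orP[]/eqP ->.
    by apply: inWS Xw; apply/fintype.subsetP => z; rewrite !inE => /and3P[].
  have wperp z : z \in comp L k -> act w (sroot z) = sroot z.
    move=> zC; apply: (inW_act_perp cP hW Xw) => j; rewrite !inE => /and3P[ja jk jL].
    by rewrite pair_sroot (coxC _ mP) (cox2 cP) // far.
  move=> l lL; rewrite actM /f; have [->|lk] := eqVneq l k; first by rewrite wperp.
  have [->|la] := eqVneq l a; first by rewrite wperp.
  split=> //; rewrite hw ?inE ?la ?lk // actN (inW_act_perp cP hW Cy) // => j.
  by rewrite -Ck => jC; rewrite pair_sroot (cox2 cP) // far.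
- move=> l; rewrite /f; have [->|lk] := eqVneq l k; first by rewrite eq_sym (negbTE ka) eqxx.
  by have [->|la] := eqVneq l a; rewrite ?eqxx // (negbTE lk) (negbTE la).
- by rewrite /f eqxx.
by move=> l lk la; rewrite /f (negbTE lk) (negbTE la).
Qed.

Lemma neg_components J : neg J -> forall x : I, x \in J -> has_listed_type m (comp J x).
Proof.
have [n] := ubnP #|J|; elim: n J => // n IHn J lt_n nJ x xJ.
have [k kJ nJk] := neg_remove nJ xJ.
have compJk z : z \in (J :\ k)%SET -> has_listed_type m (comp (J :\ k)%SET z).
  by apply: IHn => //; move: lt_n; rewrite (cardsD1 k J) kJ add1n ltnS.
(* By uniqueness of the longest element, its diagram automorphism is trivial when w_J exists; this
   rules out both unlisted components. *)
have untwisted y f : twist J y f -> forall l, l \in J -> f l = l.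
  move=> [Jy hy] l lJ; have [w hw] := nJ; have [Jw hwJ] := hw.
  have e := le0_longest Jw Jy (isneg_le0 hw) hy; have [flJ yl] := hy l lJ.
  have : act (w * y)%g (sroot l) = sroot (f l) by rewrite actM yl actN hwJ // opprK.
  by rewrite e mulVg act1 => /sroot_inj.
suff hk : has_listed_type m (comp J k).
  have [kx|kx] := boolP (connect (full_subdiagram_edge m J) k x).
    by rewrite (@component_eq _ _ mP J k x) // componentP.
  rewrite -(component_off mP kx xJ); apply: compJk; rewrite !inE xJ andbT.
  by apply: contraNneq kx => ->; apply: connect0.
case: (added_vertex_component cP mP (neg_posdef nJ) kJ compJk) => // [[q [Ck s2 hr]]|[a [Ck ka om]]].
  have [y [f [tw _ [l lJ fl] _]]] := D_twist kJ Ck s2 hr nJk.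
  by rewrite (untwisted _ _ tw l lJ) eqxx in fl.
have [_ [y [f [tw _ fk _]]]] := dihedral_twist kJ Ck ka om nJk.
by move: ka; rewrite -fk (untwisted _ _ tw k kJ) eqxx.
Qed.

Lemma neg_componentsP J :
  neg J <-> forall x : I, x \in J -> has_listed_type m (comp J x).
Proof. by split; [exact: neg_components | exact: neg_of_components]. Qed.

(* The two ways in which the longest element of [L] may act on its simple roots when
   [L :\ k] has longest element [-1]. *)
Lemma longest_twist L k : posdef c m L -> k \in L -> neg (L :\ k)%SET ->
  exists y f, [/\ twist L y f, forall l, f (f l) = l &
    f k = k \/ [/\ odd_edge m k (f k),
      forall l, l \in L -> l != k -> l != f k -> m k l = 2%N /\ m (f k) l = 2%N &
      forall l, l != k -> l != f k -> f l = l]].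
Proof.
move=> pL kL nJ; have compJ := neg_components nJ.
case: (added_vertex_component cP mP pL kL compJ) => [hk|[q [Ck s2 hr]]|[a [Ck ka om]]].
- have [w [Lw hw]] : neg L.
    apply: neg_of_components => x xL.
    have [kx|kx] := boolP (connect (full_subdiagram_edge m L) k x).
      by rewrite (@component_eq _ _ mP L k x) // componentP.
    rewrite -(component_off mP kx xL); apply: compJ; rewrite !inE xL andbT.
    by apply: contraNneq kx => ->; apply: connect0.
  exists w, id; split=> //; last by left.
  by split=> // l lL; rewrite hw.
- have [y [f [tw ff _ fk]]] := D_twist kL Ck s2 hr nJ.
  by exists y, f; split=> //; left.
have [h [y [f [tw ff fk fl]]]] := dihedral_twist kL Ck ka om nJ.
by exists y, f; split=> //; right; rewrite fk /odd_edge ka om.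
Qed.

End Twist.

(** * Conjugacy *)

Section Conjugacy.
Variables (R : rcfType) (c : nat -> R) (cP : dcos_family c).
Variables (I : finType) (m : I -> I -> nat) (W : groupType) (s : I -> W).
Hypothesis hW : coxeter_system m s.
Local Notation V := {ffun I -> R^o}.
Local Notation sroot := (@sroot R I).
Local Notation inW := (inW s).
Local Notation len := (len hW).
Local Notation act := (act cP hW).
Local Notation mP := (coxeter_system_matrix hW).
Implicit Types (i j k l : I) (u v : V) (x y w g h : W) (J K L : {set I}).
Local Notation isneg := (isneg cP hW).
Local Notation neg := (neg cP hW).

Definition carries g J K :=
  (forall j, j \in J -> exists2 k, k \in K & act g (sroot j) = sroot k) /\
  (forall k, k \in K -> exists2 j, j \in J & act g (sroot j) = sroot k).

Lemma conj_gen g j k : act g (sroot j) = sroot k -> (g * s j * g^-1 = s k)%g.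
Proof.
move=> e; apply: (@act_faithful _ _ cP _ _ _ _ hW) => i.
rewrite !actM !act_genE actB actZ actKV e; congr (_ - _ *: _).
by rewrite -form_sroot -(act_form cP hW g) e actKV form_sroot.
Qed.

Lemma carries_inW g J K w : carries g J K -> inW J w -> inW K (g * w * g^-1)%g.
Proof.
move=> [gJ _]; elim/inW_ind => [|j {}w jJ _ IH]; first by rewrite mulg1 mulgV; apply: inW1.
have -> : (g * (s j * w) * g^-1 = (g * s j * g^-1) * (g * w * g^-1))%g.
  by rewrite !mulgA mulgVK.
by have [k kK e] := gJ j jJ; rewrite (conj_gen e); apply: inWM => //; apply: inW_gen.
Qed.

Lemma carries_isneg g J K w : carries g J K -> isneg J w -> isneg K (g * w * g^-1)%g.
Proof.
move=> cg [Jw hw]; split; first exact: carries_inW cg Jw.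
move=> k kK; have [j jJ e] := cg.2 k kK.
by rewrite !actM -e actK hw // actN.
Qed.

Lemma carries_neg g J K : carries g J K -> neg J -> neg K.
Proof. by move=> cg [w hw]; exists (g * w * g^-1)%g; apply: carries_isneg cg hw. Qed.

(** Odd-adjacency read off the diagram, with orthogonality in place of direct products. *)
Definition odd_move J K := exists a b X,
  [/\ J = (a |: X)%SET, K = (b |: X)%SET, a \notin X, b \notin X
    & odd_edge m a b /\ forall x : I, x \in X -> m a x = 2%N /\ m b x = 2%N].

Definition move_rel : rel {set I} := fun J K => `[< [/\ neg J, neg K & odd_move J K] >].

Lemma ge0_comb J g v : supp J v -> ge0 v -> (forall j, j \in J -> ge0 (act g (sroot j))) ->
  ge0 (act g v).
Proof.
move=> sv v0 hg; apply: ge0_act => // i vi; apply: hg.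
by apply: contraNT vi => /sv ->.
Qed.

(** A simple root [t] made negative by [g] lies outside [J]. Adding it gives [L]; write g = x u with
    u in W_L and x minimal. Then [u] carries [J] to some [K1] inside [L], the shorter [x] carries
    [K1] to [K], and [u] is w_J followed by the longest element of W_L, so that [K1] is the image of
    [J] under a diagram automorphism of [L]. *)
Lemma carry_connect g J K : neg J -> carries g J K -> connect move_rel J K.
Proof.
have [n] := ubnP (len g); elim: n g J => // n IHn g J lt_n nJ cg.
have [g0|] := pselect (forall i, ge0 (act g (sroot i))).
  have g1 : g = 1%g by apply: (@act_eq1 _ _ cP _ _ _ _ hW).
  have -> : K = J; last exact: connect0.
  apply/setP => k; apply/idP/idP => [kK|kJ].
    by have [j jJ] := cg.2 k kK; rewrite g1 act1 => /sroot_inj <-.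
  by have [j jJ] := cg.1 k kJ; rewrite g1 act1 => /sroot_inj ->.
move=> /existsNP[t ngt]; have gt0 : le0 (act g (sroot t)).
  by case: (act_sroot_sign cP hW g t).
have tJ : t \notin J.
  by apply/negP => /(cg.1)[k _ e]; apply: ngt; rewrite e; apply: ge0_sroot.
pose L := (t |: J)%SET; have tL : t \in L by rewrite !inE eqxx.
have JL : J \subset L by apply: finset.subsetUr.
have LJ : (L :\ t)%SET = J by rewrite /L finset.setU1K.
have [x [u [egxu Lu hx hxg]]] := coset_min cP hW g L.
have lt_x : (len x < len g)%N.
  by case: hxg => // exg; case: ngt; rewrite -exg; apply: hx.
have uL j : j \in L -> supp L (act u (sroot j)).
  by move=> jL; apply: inW_supp Lu (supp_sroot _ jL).
have usimple j : j \in J -> exists2 k, k \in L & act u (sroot j) = sroot k /\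
    exists2 k', k' \in K & act x (sroot k) = sroot k'.
  move=> jJ; have jL := fintype.subsetP JL j jJ; have [k' k'K e] := cg.1 j jJ.
  rewrite egxu actM in e.
  have upos : ge0 (act u (sroot j)).
    case: (act_sroot_sign cP hW u j) => // uneg.
    have : ge0 (act x (- act u (sroot j))).
      apply: ge0_comb hx; last by apply/le0N.
      by move=> i iL; rewrite vE (uL j jL) // oppr0.
    rewrite actN e => h; have := h k'; rewrite !vE eqxx oppr_ge0 => h1.
    by have := @ltr01 R; rewrite ltNge h1.
  have [k kL [ek ek']] := simple_of_act_simple hx upos (uL j jL) e.
  by exists k => //; split=> //; exists k'.
pose K1 := [set k in L | `[< exists2 j, j \in J & act u (sroot j) = sroot k >]]%SET.
have cu : carries u J K1.
  split=> [j jJ|k]; last by rewrite inE => /andP[_ /asboolP].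
  have [k kL [ek _]] := usimple j jJ; exists k => //; rewrite inE kL.
  by apply/asboolP; exists j.
have cx : carries x K1 K.
  split=> [k|k' k'K].
    rewrite inE => /andP[_ /asboolP[j jJ ej]].
    have [k2 _ [ek2 h]] := usimple j jJ; move: ek2 h; rewrite ej => /sroot_inj <-.
    by [].
  have [j jJ e] := cg.2 k' k'K; have [k kL [ek _]] := usimple j jJ.
  exists k; last by rewrite -ek -actM -egxu.
  by rewrite inE kL; apply/asboolP; exists j.
have nK1 : neg K1 := carries_neg cu nJ.
apply: connect_trans (IHn x K1 _ nK1 cx); last by rewrite ltnS in lt_n; apply: leq_trans lt_x lt_n.
have [w hw] := nJ; have [Jw hwJ] := hw; have ww := isneg_sq hw.
have LwJ : inW L w by apply: inWS Jw.
(* [y] will be shown to make all simple roots of [L] negative, which both yields [posdef] for [L]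
   and identifies [y]. *)
pose y := (u * w)%g; have Ly : inW L y by apply: inWM.
have eu : u = (y * w)%g by rewrite /y -mulgA ww mulg1.
have y0 l : l \in L -> le0 (act y (sroot l)).
  rewrite in_setU1 => /orP[/eqP->|lJ]; last first.
    have [k kL [ek _]] := usimple l lJ.
    by rewrite actM hwJ // actN ek; apply/le0N; rewrite opprK; apply: ge0_sroot.
  have ut0 : le0 (act u (sroot t)).
    case: (act_sroot_sign cP hW u t) => // h; case: ngt; rewrite egxu actM.
    by apply: ge0_comb hx => //; apply: uL.
  (* [u] maps the span of [J] onto that of [K1], so the image of [sroot t] has a nonzero coordinate
     outside [K1]. Replacing [u] by [u * w] only adds a vector in the span of [K1], so that
     coordinate stays negative. *)
  have [d /andP[dK1 utd]] : exists d, (d \notin K1) && (act u (sroot t) d != 0).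
    apply/existsP; apply: contraT => /existsPn h.
    have hs : supp K1 (act u (sroot t)).
      by move=> i iK; apply/eqP; have := h i; rewrite iK /= negbK.
    have : supp J (act u^-1 (act u (sroot t))).
      move=> i iJ; rewrite act_decomp sum_ffunE big1 // => k _; rewrite vE.
      have [kK1|kK1] := boolP (k \in K1); last by rewrite hs // mul0r.
      have [j jJ <-] := cu.2 k kK1; rewrite actK srootE.
      by case: eqP iJ => [->|]; rewrite ?jJ ?mulr0.
    by rewrite actK => /(_ t tJ); rewrite srootE eqxx => /eqP; rewrite oner_eq0.
  apply: (@le0_of_neg _ _ _ _ _ _ _ _ _ _ d).
  have er : act w (sroot t) = sroot t + (act w (sroot t) - sroot t) by rewrite addrC subrK.
  rewrite actM er; set r := act w (sroot t) - sroot t.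
  have sr : supp J r by move=> i iJ; rewrite !vE (inW_act_off cP hW _ Jw iJ) srootE subrr.
  rewrite actD vE; have -> : act u r d = 0 :> R.
    rewrite act_decomp sum_ffunE big1 // => j _; rewrite vE.
    have [jJ|jJ] := boolP (j \in J); last by rewrite sr // mul0r.
    have [k kK1 ->] := cu.1 j jJ; rewrite srootE.
    by case: eqP dK1 => [->|]; rewrite ?kK1 ?mulr0.
  by rewrite addr0 lt_neqAle utd ut0.
have pL := le0_posdef y0.
have nLt : neg (L :\ t)%SET by rewrite LJ.
have [z [f [tw ff ft]]] := longest_twist pL tL nLt.
have [Lz hz] := tw.
have eyz := le0_longest Ly Lz y0 hz.
have uf j : j \in J -> act u (sroot j) = sroot (f j).
  move=> jJ; have jL := fintype.subsetP JL j jJ; have [fjL _] := hz j jL.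
  rewrite eu actM hwJ // actN eyz; have [_ e] := hz (f j) fjL; rewrite ff in e.
  have -> : sroot j = - act z (sroot (f j)) by rewrite e opprK.
  by rewrite actN actK opprK.
have memK1 k : (k \in K1) = (f k \in J).
  rewrite inE; apply/andP/idP => [[kL /asboolP[j jJ]]|fkJ].
    by rewrite uf // => /sroot_inj <-; rewrite ff.
  have [kL _] := hz _ (fintype.subsetP JL _ fkJ); rewrite ff in kL; split=> //.
  by apply/asboolP; exists (f k) => //; rewrite uf // ff.
(* If [f] fixes [t] then it preserves [J] and [K1] is [J]; otherwise [f t] is replaced by [t] along
   an odd edge. *)
case: ft => [ft|[odd_t perp_t fix_t]].
  have -> : K1 = J; last exact: connect0.
  apply/setP => k; rewrite memK1; apply/idP/idP => [fkJ|kJ].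
    have [] := hz _ (fintype.subsetP JL _ fkJ); rewrite ff in_setU1 => /orP[/eqP ekt|//].
    by move: tJ; rewrite -ft -ekt fkJ.
  have [] := hz _ (fintype.subsetP JL _ kJ); rewrite in_setU1 => /orP[/eqP ekt|//].
  by move: tJ; rewrite -ft -ekt ff kJ.
apply: connect1; apply/asboolP; split=> //.
have tft : f t != t by case/andP: odd_t; rewrite eq_sym.
have ftJ : f t \in J by have [] := hz t tL; rewrite in_setU1 (negbTE tft).
exists (f t), t, (J :\ f t)%SET; split.
- by rewrite finset.setD1K.
- apply/setP => k; rewrite memK1 !inE.
  have [->|kt] := eqVneq k t; first by rewrite ftJ.
  have [->|kft] := eqVneq k (f t); first by rewrite ff (negbTE tJ).
  by rewrite fix_t.
- by rewrite !inE eqxx.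
- by rewrite !inE (negbTE tJ) andbF.
split; first by move: odd_t; rewrite /odd_edge eq_sym (cox_matrixC mP).
move=> i; rewrite !inE => /andP[ift iJ].
have [] := perp_t i (fintype.subsetP JL _ iJ) _ ift; last by split.
by apply: contraNneq tJ => <-.
Qed.

(** Modulo W_J, [g] becomes nonnegative on [J]; the span conditions then make the inverse
    nonnegative on [K], and mutually inverse nonnegative maps match simple roots. *)
Lemma span_carries g J K : (forall v, supp J v -> supp K (act g v)) ->
  (forall v, supp K v -> supp J (act g^-1 v)) -> exists x, carries x J K.
Proof.
move=> gJ gK; have [x [u [egxu Ju hx _]]] := coset_min cP hW g J.
have ex : x = (g * u^-1)%g by rewrite egxu mulgK.
have xJ v : supp J v -> supp K (act x v).
  by move=> sv; rewrite ex actM; apply: gJ; apply: inW_supp sv; apply: (inWV hW).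
have xK v : supp K v -> supp J (act x^-1 v).
  move=> sv; rewrite ex invgM invgK actM; apply: inW_supp Ju _; exact: gK.
have xKpos k : k \in K -> ge0 (act x^-1 (sroot k)).
  move=> kK; case: (act_sroot_sign cP hW x^-1 k) => // h.
  have : ge0 (act x (- act x^-1 (sroot k))).
    apply: ge0_comb hx; last by apply/le0N.
    by move=> i iJ; rewrite vE (xK _ (supp_sroot _ kK)) // oppr0.
  rewrite actN actKV => h'; have := h' k; rewrite !vE eqxx oppr_ge0 => h1.
  by have := @ltr01 R; rewrite ltNge h1.
exists x; split.
  move=> j jJ; have e : act x^-1 (act x (sroot j)) = sroot j by rewrite actK.
  have [k kK [ek _]] := simple_of_act_simple xKpos (hx j jJ) (xJ _ (supp_sroot _ jJ)) e.
  by exists k.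
move=> k kK; have e : act x (act x^-1 (sroot k)) = sroot k by rewrite actKV.
have [j jJ [_ ej]] := simple_of_act_simple hx (xKpos k kK) (xK _ (supp_sroot _ kK)) e.
by exists j.
Qed.

Lemma isneg_conj_connect g J K w w' : isneg J w -> isneg K w' -> (g * w * g^-1 = w')%g ->
  connect move_rel J K.
Proof.
move=> hw hw' eg; have nJ : neg J by exists w.
have [Jw hwJ] := hw; have [Kw hwK] := hw'.
suff [x cx] : exists x, carries x J K by apply: carry_connect cx.
apply: (@span_carries g) => v sv.
  apply: (inW_eigenN1 (cP := cP) (hW := hW) Kw); rewrite -eg !actM actK (isneg_supp hw sv).
  by rewrite actN.
apply: (inW_eigenN1 (cP := cP) (hW := hW) Jw).
have ew : (w * g^-1 = g^-1 * w')%g by rewrite -eg !mulgA mulVg mul1g.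
by rewrite -actM ew actM (isneg_supp hw' sv) actN.
Qed.

Lemma odd_move_carries J K : odd_move J K -> exists g, carries g J K.
Proof.
move=> [a [b [X [-> -> aX bX [/andP[nab om] hX]]]]].
have [r Lr [ra _]] := odd_rotation cP hW nab om.
have rX (x : I) : x \in X -> act r (sroot x) = sroot x.
  move=> xX; have [ax bx] := hX x xX; apply: (inW_act_perp cP hW Lr) => j.
  by rewrite !inE pair_sroot => /orP[]/eqP ->; rewrite (cox2 cP).
exists r; split=> j; rewrite !inE => /orP[/eqP->|jX].
- by exists b; rewrite ?inE ?eqxx.
- by exists j; rewrite ?inE ?jX ?orbT ?rX.
- by exists a; rewrite ?inE ?eqxx.
- by exists j; rewrite ?inE ?jX ?orbT ?rX.
Qed.

Lemma connect_carries J K : connect move_rel J K -> exists g, carries g J K.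
Proof.
case/connectP => p pJ ->; elim: p J pJ => [|L p IH] J /=.
  by exists 1%g; split=> j jJ; exists j; rewrite // act1.
move=> /andP[/asboolP[_ _ /odd_move_carries[g cg]] /IH[h ch]].
exists (h * g)%g; split=> [j jJ|k kK].
  have [l lL e] := cg.1 j jJ; have [k kK e'] := ch.1 l lL.
  by exists k; rewrite // actM e.
have [l lL e] := ch.2 k kK; have [j jJ e'] := cg.2 l lL.
by exists j; rewrite // actM e'.
Qed.

Lemma card_carries g J K : carries g J K -> (#|J| <= #|K|)%N.
Proof.
move=> [h _]; pose f j := odflt j [pick k in K | `[< act g (sroot j) = sroot k >]].
have fP j : j \in J -> f j \in K /\ act g (sroot j) = sroot (f j).
  move=> jJ; rewrite /f; case: pickP => [k /andP[kK /asboolP e] //|none].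
  by have [k kK e] := h j jJ; have := none k; rewrite /= kK => /asboolP[].
have inj : {in J &, injective f}.
  move=> i j iJ jJ e; have [_ ei] := fP i iJ; have [_ ej] := fP j jJ.
  by apply: (@sroot_inj R); apply: (@act_inj _ _ cP _ _ _ _ hW g); rewrite ei ej e.
rewrite -(card_in_imset inj); apply: subset_leq_card; apply/fintype.subsetP => _ /imsetP[j jJ ->].
by have [] := fP j jJ.
Qed.

Lemma carriesV g J K : carries g J K -> carries g^-1 K J.
Proof.
move=> [h1 h2]; split=> [k kK|j jJ].
  by have [j jJ e] := h2 k kK; exists j; rewrite // -e actK.
by have [k kK e] := h1 j jJ; exists k; rewrite // -e actK.
Qed.

Lemma eq_card_carries g J K : carries g J K -> #|J| = #|K|.
Proof.
by move=> cg; apply/eqP; rewrite eqn_leq (card_carries cg) (card_carries (carriesV cg)).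
Qed.

(** The minimal representative of [g^-1] modulo W_K shows that the root is the image of a simple
    root of [K] under W_K. *)
Lemma reflection_inW g j K : supp K (act g (sroot j)) -> inW K (g * s j * g^-1)%g.
Proof.
move=> sg; have [x [u [egxu Ku hx _]]] := coset_min cP hW g^-1 K.
have eg : g = (u^-1 * x^-1)%g by rewrite -[g]invgK egxu invgM.
have sx : supp K (act x^-1 (sroot j)).
  have -> : (x^-1 = u * g)%g by rewrite eg mulVKg.
  by rewrite actM; apply: inW_supp Ku sg.
have xx : act x (act x^-1 (sroot j)) = sroot j by rewrite actKV.
have xpos : ge0 (act x^-1 (sroot j)).
  case: (act_sroot_sign cP hW x^-1 j) => // h.
  have : ge0 (act x (- act x^-1 (sroot j))).
    apply: ge0_comb hx; last by apply/le0N.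
    by move=> i iJ; rewrite vE sx // oppr0.
  rewrite actN xx => h'; have := h' j; rewrite !vE eqxx oppr_ge0 => h1.
  by have := @ltr01 R; rewrite ltNge h1.
have [k kK [ek _]] := simple_of_act_simple hx xpos sx xx.
have -> : (g * s j * g^-1 = u^-1 * s k * u)%g.
  by rewrite -(conj_gen ek) eg !invgM !invgK !mulgA.
by apply: inWM => //; apply: inWM; [apply: (inWV hW) | apply: inW_gen].
Qed.

End Conjugacy.

(** * Counting classes *)

Section Classes.
Variable W : groupType.
Implicit Types (x y g : W).
Local Open Scope group_scope.

Lemma conjgE x g : (x ^ g = g^-1 * x * g)%g.
Proof. by rewrite /conjg mulgA. Qed.

Lemma conj_classJ x g : conj_class (x ^ g)%g = conj_class x.
Proof.
apply/seteqP; split=> _ [h _ <-].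
  by exists (g * h)%g => //; rewrite conjgM.
by exists (g^-1 * h)%g => //; rewrite -conjgM mulgA mulgV mul1g.
Qed.

Lemma conj_class_refl x : conj_class x x.
Proof. by exists 1%g => //; rewrite conjg1. Qed.

End Classes.

Lemma card_image_pred (T : finType) (U : Type) (P : {pred T}) (F : T -> U) :
  {in P &, injective F} -> ([set F x | x in [set x | x \in P]] #= `I_#|P|)%classic%card.
Proof.
move=> inj; have -> : [set F x | x in [set x | x \in P]]%classic =
    [set F (enum_val i) | i in [set: 'I_#|P|]]%classic.
  apply/seteqP; split=> [_ [x xP <-]|_ [i _ <-]]; last by exists (enum_val i) => //; apply: enum_valP.
  by exists (enum_rank_in xP x) => //; rewrite enum_rankK_in.
rewrite (card_eqr card_II); apply: (@inj_card_eq _ _ _ (fun i : 'I_#|P| => F (enum_val i))).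
by move=> i j _ _ /(inj _ _ (enum_valP i) (enum_valP j))/enum_val_inj.
Qed.

(** * The odd graph and its components *)

Section OddGraph.
Variables (R : rcfType) (c : nat -> R) (cP : dcos_family c).
Variables (I : finType) (m : I -> I -> nat) (W : groupType) (s : I -> W).
Hypothesis hW : coxeter_system m s.
Local Notation V := {ffun I -> R^o}.
Local Notation sroot := (@sroot R I).
Local Notation cox := (@cox R I m c).
Local Notation inW := (inW s).
Local Notation act := (act cP hW).
Local Notation mP := (coxeter_system_matrix hW).
Implicit Types (i j k l : I) (u v : V) (x y w g h : W) (J K L : {set I}).
Local Notation isneg := (isneg cP hW).
Local Notation neg := (neg cP hW).
Local Notation move_rel := (move_rel cP hW).

Lemma gen_neq1 i : s i <> 1%g.
Proof.
move=> e; have := act_gen_sroot cP hW i; rewrite e act1 => h.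
by have /ffunP/(_ i) := h; rewrite !vE eqxx /= {e h} => h1; lra.
Qed.

Lemma commute_label i j : i != j -> commute (s i) (s j) -> m i j = 2%N.
Proof.
move=> neq cij; have c0 : cox i j = 0.
  have := congr1 (fun w => act w (sroot j) i) cij; rewrite !actM act_gen_sroot.
  rewrite actN act_genE pair_sroot [act (s j) _]act_genE pairB pairZ !pair_sroot (cox_diag cP mP).
  by rewrite !vE eqxx (negbTE neq) /=; lra.
apply/eqP/negPn/negP => m2; have : edge m i j by rewrite /edge /diagram_edge neq.
by move/(wt_ge1 cP mP); move: c0; rewrite /wt coxE; lra.
Qed.

Lemma label_commute i j : m i j = 2%N -> commute (s i) (s j).
Proof.
move=> m2; have := coxeter_system_relations hW i j; rewrite m2 expgS expg1 => e.
by have := mulg1_eq e; rewrite invgM !(genV hW) /commute => ->.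
Qed.

Lemma elementary_commute L (l : nat) : elementary_abelian2 (std_parabolic s L) l ->
  forall i j, i \in L -> j \in L -> i != j -> m i j = 2%N.
Proof.
move=> [f [_ rf fM]] i j iL jL neq; apply: commute_label => //.
have inR k : k \in L -> range f (s k).
  by move=> kL; rewrite rf (std_parabolicE hW); apply: inW_gen.
have [[u _ <-] [v _ <-]] := (inR i iL, inR j jL).
by rewrite /commute -!fM addrC.
Qed.

Lemma odd_adjacent_move J K : odd_adjacent m s J K -> odd_move m J K.
Proof.
move=> [l [L [M [X [_ [-> dLX idJ [-> dMX idK]] eL eM [a [b [LM ML ab]]]]]]]].
have [aL aM] : a \in L /\ a \notin M by have : a \in L :\: M by [rewrite LM inE]; rewrite inE => /andP[].
have [bM bL] : b \in M /\ b \notin L by have : b \in M :\: L by [rewrite ML inE]; rewrite inE => /andP[].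
have notX (A : {set I}) i : [disjoint A & X]%B -> i \in A -> i \notin X.
  by move=> dA iA; rewrite (disjointFr dA).
have perp (A B : {set I}) i j : internal_direct_product (std_parabolic s (A :|: X)%SET)
    (std_parabolic s A) (std_parabolic s X) -> [disjoint A & X]%B -> i \in A -> j \in X -> m i j = 2%N.
  move=> [_ _ cAX] dA iA jX; apply: commute_label.
    by apply: contraNneq (notX _ _ dA iA) => ->.
  by apply: cAX; rewrite (std_parabolicE hW); apply: inW_gen.
have LE i : i \in L -> i != a -> i \in M.
  by move=> iL ia; apply: contraNT ia => iM; have : i \in L :\: M by [rewrite inE iM]; rewrite LM inE.
have ME i : i \in M -> i != b -> i \in L.
  by move=> iM ib; apply: contraNT ib => iL; have : i \in M :\: L by [rewrite inE iL]; rewrite ML inE.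
(* Generators common to [L] and [M] commute with [a] and [b] because W_L and W_M are abelian, those
   of [X] because the products are direct. *)
exists a, b, (L :&: M :|: X)%SET; split.
- apply/setP => i; rewrite !inE; have [->|ia] := eqVneq i a; first by rewrite aL.
  by have [iL|] //= := boolP (i \in L); rewrite LE.
- apply/setP => i; rewrite !inE; have [->|ib] := eqVneq i b; first by rewrite bM.
  by have [iM|] //= := boolP (i \in M); rewrite ?andbF // ME.
- by rewrite !inE negb_or negb_and aM orbT /= (notX _ _ dLX aL).
- by rewrite !inE negb_or negb_and bL /= (notX _ _ dMX bM).
split=> // i; rewrite !inE => /orP[/andP[iL iM]|iX].
  split; [apply: (elementary_commute eL) | apply: (elementary_commute eM)] => //.
    by apply: contraNneq aM => ->.
  by apply: contraNneq bL => ->.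
by split; [apply: (perp _ L _ _ idJ) | apply: (perp _ M _ _ idK)].
Qed.

Lemma inW1P a w : inW [set a]%SET w -> w = 1%g \/ w = s a.
Proof.
elim/inW_ind => [|i {}w]; first by left.
rewrite inE => /eqP -> _ [->|->]; first by right; rewrite mulg1.
by left; apply: (gen_sq hW).
Qed.

Lemma orthogonal_direct_product a (X : {set I}) : a \notin X -> (forall x : I, x \in X -> m a x = 2%N) ->
  [/\ [disjoint [set a]%SET & X]%B,
      internal_direct_product (std_parabolic s (a |: X)%SET) (std_parabolic s [set a]%SET) (std_parabolic s X)
    & elementary_abelian2 (std_parabolic s [set a]%SET) 1].
Proof.
move=> aX hX; rewrite !(std_parabolicE hW); split.
- by rewrite disjoints1.
- have comm (x y : W) : inW [set a]%SET x -> inW X y -> commute x y.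
    move=> /inW1P[->|->] Xy; first exact/commute_sym/commute1.
    elim/inW_ind: Xy => [|j {}y jX _ IH]; first exact: commute1.
    by apply: commuteM => //; apply: label_commute; apply: hX.
  split=> //.
    apply/seteqP; split=> w; last first.
      move=> [x ax [y Xy <-]]; apply: inWM; [apply: inWS ax | apply: inWS Xy].
        by rewrite finset.sub1set !inE eqxx.
      exact: finset.subsetUr.
    move=> /= Jw; elim/inW_ind: Jw => [|j {}w jJ _ [x ax [y Xy <-]]].
      by exists 1%g; [apply: inW1 | exists 1%g; [apply: inW1 | rewrite mulg1]].
    move: jJ; rewrite in_setU1 => /orP[/eqP->|jX].
      exists (s a * x)%g; first by apply: inWM => //; apply: inW_gen; rewrite inE.
      by exists y => //; rewrite mulgA.
    exists x => //; exists (s j * y)%g; first by apply: inWM => //; apply: inW_gen.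
    by rewrite !mulgA (comm x (s j)) //; apply: inW_gen.
  apply/seteqP; split=> w; last by move=> ->; split; apply: inW1.
  move=> [/= aw Xw]; apply: (@act_eq1 _ _ cP _ _ _ _ hW) => i.
  have [->|ia] := eqVneq i a; first exact: inW_act_ge0 Xw aX.
  by apply: (inW_act_ge0 cP hW aw); rewrite inE.
pose f (v : 'rV['F_2]_1) : W := if v ord0 ord0 == 0 then 1%g else s a.
have F2 (z : 'F_2) : z = 0 \/ z = 1.
  by case: z => [[|[|k]] hz] //; [left | right]; apply: val_inj.
exists f; split.
- move=> u v e; apply/rowP => i; rewrite !ord1; move: e; rewrite /f.
  have sa := @gen_neq1 a.
  by case: (F2 (u ord0 ord0)) => ->; case: (F2 (v ord0 ord0)) => -> //=; move=> h; case: sa.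
- apply/seteqP; split=> [_ [v _ <-]|w].
    by rewrite /f /=; case: ifP => _; [apply: inW1 | apply: inW_gen; rewrite inE].
  move=> /= /inW1P[->|->].
    by exists 0 => //; rewrite /f mxE eqxx.
  by exists (const_mx 1) => //; rewrite /f mxE.
move=> u v; rewrite /f mxE.
case: (F2 (u ord0 ord0)) => ->; case: (F2 (v ord0 ord0)) => ->;
  by rewrite ?addr0 ?add0r ?mul1g ?mulg1 //= (gen_sq hW).
Qed.

Lemma odd_move_adjacent J K : odd_move m J K -> odd_adjacent m s J K.
Proof.
move=> [a [b [X [-> -> aX bX [ab hX]]]]].
have [dA idA eA] := orthogonal_direct_product aX (fun (x : I) xX => (hX x xX).1).
have [dB idB eB] := orthogonal_direct_product bX (fun (x : I) xX => (hX x xX).2).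
have nab : a != b by case/andP: ab.
exists 1%N, [set a]%SET, [set b]%SET, X; split=> //.
exists a, b; split=> //; apply/setP => i; rewrite !inE.
  by case: (eqVneq i a) => [->|]; rewrite ?andbF // nab.
by case: (eqVneq i b) => [->|]; rewrite ?andbF // eq_sym nab.
Qed.

Lemma odd_graph_vertexP (k : nat) J : odd_graph_vertex m k J <-> #|J| = k /\ neg J.
Proof.
split=> [/asboolP[cJ /(neg_componentsP cP hW) nJ] //|[cJ /(neg_componentsP cP hW) hJ]].
by apply/asboolP.
Qed.

Lemma eq_card_connect J K : connect move_rel J K -> #|J| = #|K|.
Proof. by move=> /connect_carries[g /eq_card_carries]. Qed.

(** Moves preserve the number of generators, so a chain of moves starting in rank [k] stays inside
    the graph. *)
Lemma odd_graph_connect (k : nat) J K : odd_graph_vertex m k J ->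
  connect (odd_graph_edge m s k) J K = connect move_rel J K.
Proof.
move=> vJ; apply/idP/idP.
  apply: connect_sub => A B /and3P[/odd_graph_vertexP[_ nA] /odd_graph_vertexP[_ nB] /asboolP h].
  by apply: connect1; apply/asboolP; split=> //; apply: odd_adjacent_move.
case/connectP => p pJ ->; elim: p J vJ pJ => [|L p IH] J vJ /=; first by rewrite connect0.
move=> /andP[JL pL]; have cJL : #|J| = #|L| by apply: eq_card_connect; apply: connect1.
have /asboolP[nJ nL h] := JL; have [cJ _] := (odd_graph_vertexP k J).1 vJ.
have vL : odd_graph_vertex m k L by apply/odd_graph_vertexP; rewrite -cJL.
apply: connect_trans (IH L vL pL); apply: connect1; apply/and3P; split=> //.
by apply/asboolP; apply: odd_move_adjacent.
Qed.

Lemma odd_graph_connect_sym (k : nat) : connect_sym (odd_graph_edge m s k).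
Proof.
apply: sym_connect_sym => J K; rewrite /odd_graph_edge.
case: (boolP (odd_graph_vertex m k J)) => vJ; case: (boolP (odd_graph_vertex m k K)) => vK //=.
have mv A B : odd_move m A B -> odd_move m B A.
  move=> [a [b [X [eJ eK aX bX [ab hX]]]]]; exists b, a, X; split=> //.
  split; last by move=> x /hX[].
  by move: ab; rewrite /odd_edge eq_sym (cox_matrixC mP).
by apply/asboolP/asboolP => h; apply: odd_move_adjacent; apply: mv; apply: odd_adjacent_move.
Qed.

(** A parabolic subgroup determines its span: the root of a reflection in it is an eigenvector for
    -1, hence in the span. So the rank is well defined. *)
Lemma conj_set_eq J K g h : conj_set (std_parabolic s J) g = conj_set (std_parabolic s K) h ->
  #|J| = #|K|.
Proof.
rewrite !(std_parabolicE hW) => e.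
have sub A B a b : (conj_set [set w | inW A w] a `<=` conj_set [set w | inW B w] b)%classic ->
    forall v, supp A v -> supp B (act (b * a^-1)%g v).
  move=> sAB v sv; rewrite act_decomp => i iB; rewrite sum_ffunE big1 // => j _; rewrite vE.
  have [jA|jA] := boolP (j \in A); last by rewrite sv // mul0r.
  have [z /= Bz ez] : conj_set [set w | inW B w]%classic b (s j ^ a)%g.
    by apply: sAB; exists (s j) => //; apply: inW_gen.
  have ez' : z = ((b * a^-1) * s j * (b * a^-1)^-1)%g.
    by rewrite -[z](conjgK b) ez !conjgE !invgM !invgK !mulgA.
  have : supp B (act (b * a^-1)%g (sroot j)).
    apply: (inW_eigenN1 (cP := cP) (hW := hW) Bz).
    by rewrite ez' (actM _ _ (b * a^-1 * s j)%g) actK (actM _ _ (b * a^-1)%g) act_gen_sroot actN.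
  by move=> ->; rewrite ?mulr0.
have [||x cx] := @span_carries _ _ cP _ _ _ _ hW (h * g^-1)%g J K.
- by apply: sub; rewrite e.
- by rewrite invgM invgK; apply: sub; rewrite e.
exact: eq_card_carries cx.
Qed.

(** If a conjugate of W_K contains that of w_J, the eigenspace for -1 places the roots of [J] in the
    transported span of [K], and [reflection_inW] places their reflections in the subgroup. *)
Lemma isneg_closure J w g : isneg J w ->
  is_parabolic_closure s (w ^ g)%g (conj_set (std_parabolic s J) g).
Proof.
move=> hw; have [Jw hwJ] := hw; split.
- by exists #|J|, J, g.
- by exists w => //; rewrite (std_parabolicE hW).
move=> _ [k [K [h [_ ->]]]]; rewrite !(std_parabolicE hW) => -[z /= Kz ez] _ [y /= Jy <-].
have [a ea] : exists a, a = (h * g^-1)%g by exists (h * g^-1)%g.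
have ez' : z = (a * w * a^-1)%g by rewrite -[z](conjgK h) ez !conjgE ea !invgM !invgK !mulgA.
have sub j : j \in J -> inW K (a * s j * a^-1)%g.
  move=> jJ; apply: (@reflection_inW _ _ cP _ _ _ _ hW).
  apply: (inW_eigenN1 (cP := cP) (hW := hW) Kz).
  by rewrite ez' (actM _ _ (a * w)%g) actK (actM _ _ a w) hwJ // actN.
have Ky : inW K (a * y * a^-1)%g.
  elim/inW_ind: Jy => [|j {}y jJ _ IH]; first by rewrite mulg1 mulgV; apply: inW1.
  have -> : (a * (s j * y) * a^-1 = (a * s j * a^-1) * (a * y * a^-1))%g by rewrite !mulgA mulgVK.
  by apply: inWM => //; apply: sub.
exists (a * y * a^-1)%g => //.
by rewrite !conjgE ea !invgM !invgK !mulgA mulVg mul1g mulgVK.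
Qed.

Definition neg_elt J : W :=
  if pselect (neg J) is left nJ then projT1 (cid nJ) else 1%g.

Lemma neg_eltP J : neg J -> isneg J (neg_elt J).
Proof. by move=> nJ; rewrite /neg_elt; case: pselect => // {}nJ; apply: projT2. Qed.

Lemma neg_elt_involution J : neg J -> (0 < #|J|)%N -> is_involution (neg_elt J).
Proof.
move=> nJ; have hw := neg_eltP nJ; have [Jw hwJ] := hw; rewrite card_gt0 => /set0Pn[j jJ].
split; last by rewrite expgS expg1 (isneg_sq hw).
move=> e; have := hwJ j jJ; rewrite e act1 => h.
by have /ffunP/(_ j) := h; rewrite !vE eqxx /= {e h} => h1; lra.
Qed.

Lemma involution_conj (v : W) : is_involution v ->
  exists J g, [/\ neg J, (0 < #|J|)%N & v = (neg_elt J ^ g)%g].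
Proof.
move=> [v1 v2]; have vv : (v * v = 1)%g by rewrite -v2 expgS expg1.
have [g [J [_ _ hw]]] := inW_involution cP hW (inWT hW v) vv.
have nJ : neg J by exists (g * v * g^-1)%g.
have e : neg_elt J = (g * v * g^-1)%g := isneg_uniq (neg_eltP nJ) hw.
have ev : v = (neg_elt J ^ g)%g by rewrite e conjgE !mulgA mulVg mul1g mulgVK.
exists J, g; split=> //; rewrite card_gt0; apply/negP => /eqP J0; apply: v1.
have [Jw _] := hw; rewrite ev e; suff -> : (g * v * g^-1 = 1)%g by rewrite conj1g.
by apply: (inW_eq1 (cP := cP) (hW := hW) Jw) => j; rewrite J0 inE.
Qed.

Lemma involution_rank J g (k : nat) : neg J -> is_involution_of_rank s k (neg_elt J ^ g)%g -> #|J| = k.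
Proof.
move=> nJ [_ [P [[pP Pv minP] [K [h [cK eP]]]]]].
have [pJ Jv minJ] := isneg_closure g (neg_eltP nJ).
rewrite -cK; apply: (@conj_set_eq _ _ g h); rewrite -eP; apply/seteqP; split.
  exact: minJ.
exact: minP.
Qed.

Lemma conj_class_neg_elt J K : neg J -> neg K ->
  conj_class (neg_elt J) = conj_class (neg_elt K) <-> connect move_rel J K.
Proof.
move=> nJ nK; split=> [e|/connect_carries[g cg]].
  have [g _ eg] : conj_class (neg_elt J) (neg_elt K) by rewrite e; apply: conj_class_refl.
  apply: (isneg_conj_connect (g := g^-1%g) (neg_eltP nJ) (neg_eltP nK)).
  by rewrite invgK -eg conjgE.
have := carries_isneg cg (neg_eltP nJ) => /(isneg_uniq (neg_eltP nK)) ->.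
by rewrite -[RHS](conj_classJ _ g) conjgE !mulgA mulVg mul1g mulgVK.
Qed.

Local Notation reps k := (predI (roots (odd_graph_edge m s k)) (odd_graph_vertex m k)).

Lemma reps_inj (k : nat) : {in reps k &, injective (fun J => conj_class (neg_elt J))}.
Proof.
move=> J K; rewrite !inE => /andP[rJ vJ] /andP[rK vK] e.
have [[_ nJ] [_ nK]] := ((odd_graph_vertexP k J).1 vJ, (odd_graph_vertexP k K).1 vK).
have := (conj_class_neg_elt nJ nK).1 e; rewrite -(odd_graph_connect _ vJ).
rewrite -(root_connect (odd_graph_connect_sym k)).
by move: rJ rK => /eqP -> /eqP -> /eqP.
Qed.

Lemma class_rep J : neg J -> exists2 K, K \in reps #|J| &
  conj_class (neg_elt J) = conj_class (neg_elt K).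
Proof.
move=> nJ; set k := #|J|; have vJ : odd_graph_vertex m k J by apply/odd_graph_vertexP.
pose K := root (odd_graph_edge m s k) J.
have JK : connect (odd_graph_edge m s k) J K by apply: connect_root.
have JK' : connect move_rel J K by rewrite -(odd_graph_connect _ vJ).
have [g cg] := connect_carries JK'; have nK := carries_neg cg nJ.
exists K; last by apply/(conj_class_neg_elt nJ nK).
rewrite !inE; apply/andP; split; first exact/roots_root/odd_graph_connect_sym.
by apply/odd_graph_vertexP; rewrite -(eq_card_connect JK').
Qed.

Lemma rank_classes (k : nat) : (1 <= k)%N -> involution_classes_of_rank s k =
  [set conj_class (neg_elt J) | J in [set J | J \in reps k]]%classic.
Proof.
move=> k0; apply/seteqP; split=> [_ [v hv <-]|_ [J /= /andP[_ /odd_graph_vertexP[cJ nJ]] <-]].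
  have [iv _] := hv; have [J [g [nJ _ ev]]] := involution_conj iv.
  rewrite ev conj_classJ; rewrite /= ev in hv; have cJ := involution_rank nJ hv.
  by have [K rK ->] := class_rep nJ; exists K => //; rewrite -cJ.
exists (neg_elt J) => //; split.
  by apply: neg_elt_involution; rewrite // cJ.
exists (conj_set (std_parabolic s J) 1%g); split; last by exists J, 1%g.
by have := isneg_closure 1%g (neg_eltP nJ); rewrite conjg1.
Qed.

Lemma all_classes : involution_classes W =
  [set conj_class (neg_elt J) | J in [set J | J \in [pred J : {set I} | (0 < #|J|)%N & J \in reps #|J|]]]%classic.
Proof.
apply/seteqP; split=> [_ [v iv <-]|_ [J /= /andP[J0 /andP[_ /odd_graph_vertexP[_ nJ]]] <-]].
  have [J [g [nJ J0 ->]]] := involution_conj iv; rewrite conj_classJ.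
  have [K rK ->] := class_rep nJ; exists K => //=.
  have cK : #|K| = #|J| by move: rK; rewrite inE => /andP[_ /odd_graph_vertexP[]].
  by rewrite inE cK J0.
exists (neg_elt J) => //.
exact: neg_elt_involution.
Qed.

Lemma all_reps_inj : {in [pred J : {set I} | (0 < #|J|)%N & J \in reps #|J|] &,
  injective (fun J => conj_class (neg_elt J))}.
Proof.
move=> J K /andP[_ rJ] /andP[_ rK] e.
have nJ : neg J by move: rJ; rewrite inE => /andP[_ /odd_graph_vertexP[]].
have nK : neg K by move: rK; rewrite inE => /andP[_ /odd_graph_vertexP[]].
have cJK := eq_card_connect ((conj_class_neg_elt nJ nK).1 e).
by apply: (@reps_inj #|J|) => //; rewrite cJK.
Qed.

(** Each representative is counted only for k = #|J|. The empty set, whose w_J is the identity, is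
    excluded on both sides. *)
Lemma card_all_reps : #|[pred J : {set I} | (0 < #|J|)%N & J \in reps #|J|]| =
  (\sum_(1 <= k < #|I|.+1) card_pi0_odd_graph m s k)%N.
Proof.
have cardE (A : {pred {set I}}) : #|A| = (\sum_(J : {set I}) (J \in A))%N.
  by rewrite -sum1_card big_mkcond; apply: eq_bigr => J _; case: (J \in A).
have -> : (\sum_(1 <= k < #|I|.+1) card_pi0_odd_graph m s k)%N =
    (\sum_(1 <= k < #|I|.+1) \sum_(J : {set I}) (J \in reps k))%N.
  by apply: eq_bigr => k _; rewrite -cardE; apply: eq_card => J; rewrite !inE.
rewrite cardE exchange_big; apply: eq_bigr => J _.
have offk (k : nat) : k != #|J| -> (J \in reps k) = false.
  move=> kJ; apply: contraNF kJ; rewrite inE => /andP[_ /odd_graph_vertexP[-> _]].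
  exact: eqxx.
have [J0|J0] := posnP #|J|.
  rewrite inE J0 /= big_nat big1 // => k /andP[k1 _].
  by rewrite offk // J0 -lt0n.
rewrite (bigD1_seq #|J|) ?iota_uniq //=; last by rewrite mem_index_iota J0 ltnS max_card.
by rewrite big1 ?addn0 ?inE ?J0 // => k kJ; rewrite offk.
Qed.

Lemma odd_graph_classes :
  ((forall k : nat, (1 <= k)%N ->
     involution_classes_of_rank s k #= `I_(card_pi0_odd_graph m s k))
  /\
  involution_classes W
    #= `I_(\sum_(1 <= k < #|I|.+1) card_pi0_odd_graph m s k))%classic%card.
Proof.
split=> [k k0|]; last by rewrite all_classes -card_all_reps; apply: (card_image_pred all_reps_inj).
have -> : card_pi0_odd_graph m s k = #|reps k| by apply: eq_card => J; rewrite !inE.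
by rewrite rank_classes //; apply: (card_image_pred (@reps_inj k)).
Qed.

End OddGraph.

(** * Cosines *)

Section Cosines.
Variable R : realType.

(** The recurrence is sin ((k + 2) t) + sin (k t) = 2 cos t sin ((k + 1) t). *)
Lemma chebU_sin (t : R) k : chebU (2 * cos t) k * sin t = sin (t *+ k).
Proof.
suff [] : chebU (2 * cos t) k * sin t = sin (t *+ k) /\
          chebU (2 * cos t) k.+1 * sin t = sin (t *+ k.+1) by [].
elim: k => [|k [IH1 IH2]]; first by rewrite mulr0n sin0 mulr1n /chebU /= mul0r mul1r.
split=> //; rewrite chebUSS mulrBl IH1 -mulrA IH2.
have -> : sin (t *+ k) = sin (t *+ k.+1 - t) by rewrite mulrSr addrK.
by rewrite sinB (mulrSr t k.+1) sinD; ring.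
Qed.

Definition coxeter_cos (n : nat) : R := if n is 0%N then 2 else 2 * cos (pi / n%:R).

Lemma coxeter_cos_family : dcos_family coxeter_cos.
Proof.
split=> [||n n1]; rewrite /coxeter_cos //; first by rewrite divr1 cospi; ring.
case: n n1 => // n n1; set t : R := pi / n.+1%:R.
have n0 : 0 < n.+1%:R :> R by rewrite ltr0n.
have t0 : 0 < t by rewrite divr_gt0 // pi_gt0.
have tn : t *+ n.+1 = pi by rewrite -mulr_natr divfK // gt_eqF.
have tk k : (0 < k < n.+1)%N -> 0 < sin (t *+ k).
  move=> /andP[k0 lk]; apply: sin_gt0_pi; rewrite pmulrn_lgt0 // t0 /=.
  by rewrite -tn ltr_pMn2l.
have s0 : 0 < sin t by have := tk 1%N; rewrite mulr1n; apply.
split=> [k hk|].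
  by rewrite -(pmulr_lgt0 _ s0) chebU_sin tk.
by apply/eqP; rewrite -(mulIr_eq0 _ (mulIf (lt0r_neq0 s0))) chebU_sin tn sinpi.
Qed.

End Cosines.

Local Close Scope ring_scope.
Local Open Scope card_scope.
Local Open Scope classical_set_scope.

Theorem theorem1p1 (I : finType) (m : I -> I -> nat)
    (W : groupType) (s : I -> W) (hW : coxeter_system m s) :
  (forall k : nat, (1 <= k)%N ->
     involution_classes_of_rank s k #= `I_(card_pi0_odd_graph m s k))
  /\
  involution_classes W
    #= `I_(\sum_(1 <= k < #|I|.+1) card_pi0_odd_graph m s k).
Proof. exact: (odd_graph_classes (coxeter_cos_family Rdefinitions.R) hW). Qed.
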